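(* Let $0<\alpha<n$ and $1<p<q<\infty$ with $\frac1q=\frac1p-\frac{\alpha}{n}$. Suppose that $\mu,\lambda\in A_{p,q}$ are weights on $\mathbb{R}^n$, put $\nu=\mu\lambda^{-1}$, and let $b\in BMO\cap BMO(\nu)$. Then for every integer $k\ge 1$, $$ \big\|C_b^k(I_\alpha)\big\|_{L^p(\mu^p)\to L^q(\lambda^q)}\le C_{n,p,q,k}\big([\mu]_{A_{p,q}},[\lambda]_{A_{p,q}}\big)\,\|b\|_{BMO(\nu)}\,\|b\|_{BMO}^{k-1}, $$ where $C_{n,p,q,k}(\cdot,\cdot)$ is a function, depending only on $n,p,q,k$, that is monotone increasing in both variables.
   Context: A weight is a nonnegative locally integrable function on $\mathbb{R}^n$. For a weight $w$, $L^p(w)$ is the $L^p$ space with respect to the measure $w\,dx$, and $w(Q)=\int_Q w\,dx$. Cubes have sides parallel to the axes. For $0<\alpha<n$ and an integer $k\ge1$, the $k$-th order commutator of the fractional integral operator $I_\alpha f(x)=\int_{\mathbb{R}^n}\frac{f(y)}{|x-y|^{n-\alpha}}\,dy$ with the function $b$ is $$C_b^k(I_\alpha)(f)(x)=\int_{\mathbb{R}^n}\frac{(b(x)-b(y))^k f(y)}{|x-y|^{n-\alpha}}\,dy .$$ For $1<p,q<\infty$, with $p'=p/(p-1)$, a weight $w$ belongs to $A_{p,q}$ if $$[w]_{A_{p,q}}:=\sup_Q\Big(\frac1{|Q|}\int_Q w^q\,dx\Big)\Big(\frac1{|Q|}\int_Q w^{-p'}\,dx\Big)^{q/p'}<\infty,$$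 the supremum being over all cubes $Q\subset\mathbb{R}^n$. For a weight $w$, $BMO(w)$ is the space of locally integrable functions $b$ with $$\|b\|_{BMO(w)}:=\sup_Q\frac1{w(Q)}\int_Q|b(x)-\langle b\rangle_Q|\,dx<\infty,$$ where the supremum is over all cubes $Q$ and $\langle b\rangle_Q=\frac1{|Q|}\int_Q b$. $BMO$ denotes $BMO(w)$ with $w\equiv1$. *)

(* Defs.v *)
From HB Require Import structures.
From mathcomp Require Import all_boot all_order all_algebra.
From mathcomp Require Import all_classical all_reals all_analysis.
Set Implicit Arguments.
Unset Strict Implicit.
Unset Printing Implicit Defensive.
Import Order.TTheory GRing.Theory Num.Theory.
Import numFieldNormedType.Exports.
Local Open Scope classical_set_scope.
Local Open Scope ring_scope.

(* The library equips n.-tuple T with the product sigma-algebra; for the Borel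
   line T := measurableTypeR R this is the Borel sigma-algebra of R^n. *)
Notation Rn R n := (n.-tuple (measurableTypeR R)).

(* The library has binary products of measures only, so Lebesgue measure on R^n
   is iterated along the measurable isomorphism R * R^n -> R^(n+1). *)
Section lebesgue_measure_step.
Context {R : realType} {n : nat}.
Variable m : {sigma_finite_measure set (Rn R n) -> \bar R}.
Local Open Scope ereal_scope.

Definition cons_Rn (x : measurableTypeR R * Rn R n) : Rn R n.+1 :=
  [the n.+1.-tuple (measurableTypeR R) of x.1 :: x.2].

Lemma measurable_cons_Rn : measurable_fun setT cons_Rn.
Proof. exact: (measurable_cons measurable_fst measurable_snd). Qed.

Definition lebesgue_cons : set (Rn R n.+1) -> \bar R :=
  pushforward (lebesgue_measure \x m) cons_Rn.

HB.instance Definition _ := Measure.copy lebesgue_cons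
  (measure_function_pushforward__canonical__measure_function_Measure
    (lebesgue_measure \x m) measurable_cons_Rn).

Let sigma_finite_lebesgue_cons : sigma_finite setT lebesgue_cons.
Proof.
pose uncons (x : Rn R n.+1) : measurableTypeR R * Rn R n :=
  (thead x, [tuple of behead x]).
have consK : cancel cons_Rn uncons.
  by case=> x y; congr pair; apply/val_inj.
have munc : measurable_fun setT uncons.
  apply/measurable_fun_pairP; split; first exact: measurable_tnth.
  exact: measurable_behead.
have /sigma_finiteP[F [FT ndF Foo]] := sigma_finiteT (@lebesgue_measure R).
have /sigma_finiteP[G [GT ndG Goo]] := sigma_finiteT m.
exists (fun k => uncons @^-1` (F k `*` G k)).
  rewrite -preimage_bigcup; apply/esym/seteqP; split=> // x _ /=.
  have [[j _ Fj] [k _ Gk]] : (\bigcup_k F k) (uncons x).1 /\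
      (\bigcup_k G k) (uncons x).2 by rewrite -FT -GT.
  exists (maxn j k) => //; split.
    by move: Fj; exact/subsetPset/ndF/leq_maxl.
  by move: Gk; exact/subsetPset/ndG/leq_maxr.
move=> k; have [[mF Fk] [mG Gk]] := (Foo k, Goo k); split.
  by rewrite -[X in measurable X]setTI; apply: munc => //; exact: measurableX.
rewrite /lebesgue_cons /pushforward -comp_preimage.
rewrite (_ : uncons \o cons_Rn = id); last exact/funext.
by rewrite preimage_id product_measure1E// lte_mul_pinfty// ge0_fin_numE.
Qed.

HB.instance Definition _ := Measure_isSigmaFinite.Build _ _ _ lebesgue_cons
  sigma_finite_lebesgue_cons.

End lebesgue_measure_step.

Fixpoint lebesgue_Rn {R : realType} (n : nat) :
    {sigma_finite_measure set (Rn R n) -> \bar R} :=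
  match n with
  | 0 => \d_ [tuple]
  | n'.+1 => lebesgue_cons (lebesgue_Rn n')
  end.

Lemma lebesgue_Rn_box (R : realType) (n : nat) (A : 'I_n -> set (measurableTypeR R)) :
  (forall i, measurable (A i)) ->
  lebesgue_Rn n [set x | forall i, A i (tnth x i)] =
  (\prod_(i < n) lebesgue_measure (A i))%E.
Proof.
elim: n A => [|n IH] A mA.
  by rewrite big_ord0 /= diracE mem_set//= => -[].
have mbox : measurable [set x : Rn R n | forall i, A (lift ord0 i) (tnth x i)].
  rewrite (_ : mkset _ =
      \big[setI/setT]_(i < n) ((fun x => tnth x i) @^-1` A (lift ord0 i))).
    apply: bigsetI_measurable => i _; rewrite -[X in measurable X]setTI.
    exact: (@measurable_tnth _ (measurableTypeR R) n i measurableT).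
  rewrite -bigcap_seq; apply/seteqP; split=> x Ax i.
    by move=> _; exact: Ax.
  exact: (Ax i (mem_index_enum i)).
rewrite big_ord_recl -IH// -product_measure1E// /= /lebesgue_cons /pushforward.
congr product_measure1; apply/seteqP; split=> -[x y] /=.
  move=> Axy; split; first exact: (Axy ord0).
  by move=> i; have := Axy (lift ord0 i); rewrite tnthS.
by move=> [Ax Ay] i; case: (unliftP ord0 i) => [j|] -> //; rewrite tnthS.
Qed.

Section weighted_spaces.
Context {R : realType} {n : nat}.
Implicit Types (x y : Rn R n) (Q K : set (Rn R n)) (b f w : Rn R n -> R).

Local Notation leb := (@lebesgue_Rn R n).

Definition coord x (i : 'I_n) : R := tnth x i.

Definition euclidean_dist x y : R :=
  Num.sqrt (\sum_(i < n) (coord x i - coord y i) ^+ 2).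

Definition cube x (l : R) : set (Rn R n) :=
  [set y | forall i, coord x i <= coord y i <= coord x i + l].

Definition cubes : set (set (Rn R n)) :=
  [set Q | exists x l, 0 < l /\ Q = cube x l].

(* Tuples carry no topology in the library; that of R^n is read off 'rV[R]_n. *)
Definition compact_Rn K :=
  compact ((fun x => \row_(i < n) coord x i) @` K : set 'rV[R]_n).

Local Open Scope ereal_scope.

Definition loc_integrable f : Prop :=
  measurable_fun setT f /\
  forall K, compact_Rn K -> \int[leb]_(x in K) `|f x|%:E < +oo.

Definition weight w : Prop := (forall x, 0 <= w x)%R /\ loc_integrable w.

Definition average Q (g : Rn R n -> \bar R) : \bar R :=
  (\int[leb]_(x in Q) g x) / leb Q.

Definition conjugate_exponent (p : R) : R := (p / (p - 1))%R.

(* w^{-p'} is written (1/w)^{p'} in the extended reals, where 1/0 = +oo: the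
   real-valued power would give 0 at the zeros of w. *)
Definition Apq_const (p q : R) w : \bar R :=
  let p' := conjugate_exponent p in
  ereal_sup [set average Q (fun x => (w x `^ q)%:E) *
                 average Q (fun x => (w x)%:E^-1 `^ p') `^ (q / p')%R
            | Q in cubes].

Definition Apq (p q : R) w : Prop := weight w /\ Apq_const p q w < +oo.

Definition bmo_norm w b : \bar R :=
  ereal_sup [set (\int[leb]_(x in Q)
                    `|b x - fine (average Q (EFin \o b))|%:E) /
                 (\int[leb]_(x in Q) (w x)%:E)
            | Q in cubes].

Definition BMO w b : Prop := loc_integrable b /\ bmo_norm w b < +oo.

(* The norm of L^p(w), i.e. of L^p for the measure w dx. *)
Definition wLnorm (p : R) w (g : Rn R n -> \bar R) : \bar R :=
  (\int[leb]_x (`|g x| `^ p * (w x)%:E)) `^ p^-1.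

(* Operators take values in functions with extended real values, see
   commutator_frac_integral. *)
Definition operator_norm (p q : R) (u v : Rn R n -> R)
    (T : (Rn R n -> R) -> Rn R n -> \bar R) : \bar R :=
  ereal_sup [set wLnorm q v (T f) | f in
    [set f | measurable_fun setT f /\ wLnorm p u (EFin \o f) <= 1]].

(* The library's integral is \int f^+ - \int f^-, with +oo - +oo = -oo: the value
   at x is infinite unless the integral converges absolutely, so that a bound
   on the operator norm includes the convergence of the integral at almost
   every x (for a target weight that is positive almost everywhere). *)
Definition commutator_frac_integral (alpha : R) (k : nat) b f x : \bar R :=
  \int[leb]_y ((b x - b y) ^+ k * f y /
               euclidean_dist x y `^ (n%:R - alpha))%:E.

End weighted_spaces.

(* Main.v *)
(* Work on dyadic grids and write [a1 = p'], [a2 = q], [sigma = mu^-a1],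
   [w = lambda^a2].  Discretizing the kernel over the [2^n] grids obtained by
   translating a standard grid by [0] or a third of its largest side in each
   coordinate (every small ball lies in a cell of comparable size of one of
   them) and dualizing, one has to bound
     [sum_j l_j^(alpha - n) * int int_(x ~ y) |b x - b y|^k (h sigma)(y) (g w)(x)]
   for [h] and [g] in the unit balls of [L^p(sigma)] and [L^q'(w)], where
   [x ~ y] means that [x] and [y] share a cell of generation [j].
   Inserting the mean of [b] over the common cell leaves two symmetric sums, each
   controlled cell by cell by Hoelder's inequality with an exponent [r > a1].
   There the weighted oscillation [int_Q |b - b_Q|^(k r) sigma] is estimated by a
   stopping time argument in which the unweighted oscillation over a subcell [P]
   is at most [c_P = min (B1 * <nu>_P, B2)], so that
   [c_P^k <= B1 * B2^(k-1) * <nu>_P]; the reverse Hoelder inequality for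
   [lambda^-a1] pays for the passage from [a1] to [r].
   Finally [p < q] makes the resulting sums over all generations converge: this
   is an embedding theorem of Carleson type, based on the geometric decay
   [sigma(Q_(j+1)) <= theta * sigma(Q_j)] along nested cells. *)

Require Import Defs.
From mathcomp Require Import all_boot all_order all_algebra finmap.
From mathcomp Require Import all_classical all_reals all_analysis.
From HB Require Import structures.
From mathcomp Require Import measurable_realfun ring lra zify.
Set Implicit Arguments.
Unset Strict Implicit.
Unset Printing Implicit Defensive.
Import Order.TTheory GRing.Theory Num.Theory.
Import numFieldNormedType.Exports.
Local Open Scope classical_set_scope.
Local Open Scope ring_scope.

(** The passage to the limit in the scales forces uniformity: the kernel is truncated to distances
    between [2 ^- M] and [2 ^ M], and the grids change with [M], so every constant is fixed before
    the grid, the weights and [b]. Absorption needs quantities known to be finite, so the reverse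
    Hoelder and oscillation bounds are first proved for averaged functions, by induction on the
    number of generations; convergence of averages and Fatou's lemma carry them over to the
    functions themselves. In the oscillation bound each stopping step costs a factor [2 ^ rho]. It
    is not regained from the weight: the stopping cells have unweighted measure at most [kap / a],
    and a concave power [t < 1] of averages of an auxiliary function [Y] turns this into the small
    factor [a ^ (t - 1)]. The strict inequality [a1 < r] leaves the room needed later: the dual
    exponent [s] of [r] is then below [p], so that the embedding can be applied to [h ^ s] with
    exponent [p / s > 1]; at [r = a1] this would be the excluded endpoint 1. *)

(* [cell j x] is the cell of generation [j] containing [x], [kap j] the common
   measure of these cells and [D] their number of children.  [cell_gen] makes the
   averages converge: the unions of cells generate the sigma-algebra. *)
Record dyadic d (T : measurableType d) (R : realType)
    (m : {sigma_finite_measure set T -> \bar R}) (D : R) := Dyadic {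
  cell : nat -> T -> set T;
  kap : nat -> R;
  cell_refl : forall j x, cell j x x;
  cell_eq : forall j x y, cell j x y -> cell j y = cell j x;
  cell_nest : forall j x, cell j.+1 x `<=` cell j x;
  measurable_cell_rel : forall j, measurable [set z : T * T | cell j z.1 z.2];
  kap_gt0 : forall j, 0 < kap j;
  kapS : forall j, kap j = D * kap j.+1;
  cell_kap : forall j x, m (cell j x) = (kap j)%:E;
  cell_gen : measurable `<=` <<s [set A | measurable A /\
    exists j, forall x y, A x -> cell j x y -> A y] >> }.

(** [fine] sends an infinite integral to 0, so the value is meaningful only for functions in [lfin].
    The lock keeps the integral opaque to unification. *)
HB.lock Definition cell_int d (T : measurableType d) (R : realType)
    (m : {sigma_finite_measure set T -> \bar R}) (D : R) (G : dyadic m D)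
    (j : nat) (f : T -> R) (x : T) : R :=
  fine (\int[m]_(y in cell G j x) (f y)%:E)%E.

HB.lock Definition cell_av d (T : measurableType d) (R : realType)
    (m : {sigma_finite_measure set T -> \bar R}) (D : R) (G : dyadic m D)
    (j : nat) (f : T -> R) (x : T) : R :=
  cell_int G j f x / kap G j.

Ltac mfun := repeat (try assumption; lazymatch goal with
  | |- measurable_fun _ (fun _ => EFin _) => apply/measurable_EFinP
  | |- measurable_fun _ (comp EFin _) => apply/measurable_EFinP
  | |- measurable_fun _ (fun _ => GRing.mul _ _) => apply: measurable_funM
  | |- measurable_fun _ (fun _ => GRing.add _ (GRing.opp _)) => apply: measurable_funB
  | |- measurable_fun _ (fun _ => GRing.add _ _) => apply: measurable_funD
  | |- measurable_fun _ (fun _ => GRing.exp _ _) => apply: measurable_funX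
  | |- measurable_fun _ (fun _ => Num.max _ _) => apply: measurable_maxr
  | |- measurable_fun _ (fun _ => Num.min _ _) => apply: measurable_minr
  | |- measurable_fun _ (fun _ => powR _ _) =>
      apply: (measurableT_comp (@measurable_powR _ _))
  | |- measurable_fun _ (fun _ => Num.norm _) =>
      apply: (measurableT_comp (@normr_measurable _ _))
  | |- measurable_fun _ (fun _ => indic _ _) => apply: measurable_indic
  | |- measurable_fun _ (fun _ => mule _ _) => apply: emeasurable_funM
  | |- measurable_fun _ (fun _ => adde _ _) => apply: emeasurable_funD
  | |- measurable_fun _ (fun _ => poweR _ _) =>
      apply: (measurableT_comp (@measurable_poweR _ _))
  | |- measurable_fun _ (fun _ => ?c) => exact: measurable_cst
  end).

(** * Cells, cell integrals and averages *)

Section dyadic_theory.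
Context {d} {T : measurableType d} {R : realType}.
Context {m : {sigma_finite_measure set T -> \bar R}} {D : R}.
Variable G : dyadic m D.
Implicit Types (j i : nat) (x y : T) (f g h u v : T -> R) (F H : T -> \bar R).

Local Notation Q := (cell G).
Local Notation kap := (kap G).

Lemma cell_sym j x y : Q j x y -> Q j y x.
Proof. by move=> /(cell_eq) ->; exact: cell_refl. Qed.

Lemma cell_le i j x : (i <= j)%N -> Q j x `<=` Q i x.
Proof.
move=> /subnK <-; elim: (j - i)%N => [//|n IH].
by rewrite addSn; apply: subset_trans IH; exact: cell_nest.
Qed.

Lemma measurable_cell j x : measurable (Q j x).
Proof.
have := measurable_xsection x (measurable_cell_rel G j).
rewrite (_ : xsection _ x = Q j x)//; apply/seteqP; split=> y;
  by rewrite /xsection/= inE.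
Qed.
Hint Resolve measurable_cell : core.

Lemma measure_cell j x : (m : measure T R) (Q j x) = (kap j)%:E.
Proof. exact: cell_kap. Qed.

Definition saturated j (A : set T) := forall x y, A x -> Q j x y -> A y.

Lemma saturated_cell i j x : (i <= j)%N -> saturated j (Q i x).
Proof. by move=> ij y z xy /(cell_le ij); rewrite (cell_eq xy). Qed.

Lemma saturatedT j : saturated j setT. Proof. by []. Qed.

Let cellind j (z : T * T) : \bar R := (\1_[set z : T * T | Q j z.1 z.2] z)%:E.

Let cellindE j x y : cellind j (x, y) = (\1_(Q j x) y)%:E.
Proof.
by rewrite /cellind !indicE; congr (nat_of_bool _)%:R%:E; apply/idP/idP; rewrite !inE.
Qed.

Let integral_cellE j F x : (forall y, 0 <= F y)%E ->
  (\int[m]_(y in Q j x) F y = \int[m]_y (F y * (\1_(Q j x) y)%:E))%E.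
Proof.
move=> F0; rewrite integral_mkcond; apply: eq_integral => y _.
by rewrite epatch_indic.
Qed.

Let measurable_cell_kernel j F H : measurable_fun setT F -> measurable_fun setT H ->
  measurable_fun setT (fun z : T * T => F z.1 * H z.2 * cellind j z)%E.
Proof.
move=> mF mH; apply: emeasurable_funM; first apply: emeasurable_funM.
- exact: (measurableT_comp mF).
- exact: (measurableT_comp mH).
- apply/measurable_EFinP; apply: measurable_indic; exact: measurable_cell_rel.
Qed.

Let cellind_ge0 j z : (0 <= cellind j z)%E.
Proof. by rewrite lee_fin. Qed.

Lemma measurable_integral_cell j F : (forall y, 0 <= F y)%E ->
  measurable_fun setT F ->
  measurable_fun setT (fun x => \int[m]_(y in Q j x) F y)%E.
Proof.
move=> F0 mF.
have := @measurable_fun_fubini_tonelli_F _ _ _ _ _ m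
  (fun z : T * T => cst 1 z.1 * F z.2 * cellind j z)%E
  (measurable_cell_kernel _ (measurable_cst _) mF).
move/(_ (fun z => mule_ge0 (mule_ge0 lee01 (F0 _)) (cellind_ge0 j z))).
apply: eq_measurable_fun => x _; rewrite integral_cellE// /fubini_F.
by apply: eq_integral => y _ /=; rewrite cellindE mul1e.
Qed.

(** The indicator of the cell relation is jointly measurable and symmetric, so Tonelli exchanges the
    two variables: integration over cells is self-adjoint. *)
Lemma integral_cell_swap j F H : (forall y, 0 <= F y)%E -> (forall y, 0 <= H y)%E ->
  measurable_fun setT F -> measurable_fun setT H ->
  (\int[m]_x (F x * \int[m]_(y in Q j x) H y) =
   \int[m]_x (H x * \int[m]_(y in Q j x) F y))%E.
Proof.
move=> F0 H0 mF mH.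
transitivity (\int[m]_x \int[m]_y (F x * H y * cellind j (x, y)))%E.
  apply: eq_integral => x _; rewrite integral_cellE// -ge0_integralZl//.
  - by apply: eq_integral => y _; rewrite muleA cellindE.
  - apply: emeasurable_funM => //; apply/measurable_EFinP.
    exact: measurable_indic.
  - by move=> y _; rewrite mule_ge0// lee_fin.
rewrite (fubini_tonelli _ (measurable_cell_kernel _ mF mH)); last first.
  by move=> z; rewrite !mule_ge0.
apply: eq_integral => y _; rewrite integral_cellE// -ge0_integralZl//.
- apply: eq_integral => x _; rewrite cellindE/= (muleC (F x)) muleA.
  congr (_ * _%:E)%E; rewrite !indicE; congr (nat_of_bool _)%:R.
  by apply/idP/idP; rewrite !inE; exact: cell_sym.
- apply: emeasurable_funM => //; apply/measurable_EFinP.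
  exact: measurable_indic.
- by move=> x _; rewrite mule_ge0// lee_fin.
Qed.

(** Since [A] is a union of cells, averaging its indicator over the cell of [x] returns the
    indicator at [x]. Self-adjointness then moves the average from the indicator to [F]. *)
Lemma integral_tower j (A : set T) F : measurable A -> saturated j A ->
  (forall y, 0 <= F y)%E -> measurable_fun setT F ->
  (\int[m]_(x in A) F x =
   \int[m]_(x in A) ((kap j)^-1%:E * \int[m]_(y in Q j x) F y))%E.
Proof.
move=> mA sA F0 mF.
have k0 := kap_gt0 G j.
have mA1 : measurable_fun setT (fun x => (\1_A x)%:E : \bar R).
  by apply/measurable_EFinP; exact: measurable_indic.
transitivity (\int[m]_x (F x * \int[m]_(y in Q j x)
    ((kap j)^-1%:E * (\1_A y)%:E)))%E.
  rewrite integral_mkcond; apply: eq_integral => x _.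
  rewrite epatch_indic; congr (_ * _)%E.
  rewrite ge0_integralZl//; last 2 first.
  - exact: measurable_funTS.
  - by rewrite lee_fin invr_ge0 ltW.
  rewrite [X in (_ * X)%E](_ : _ = \int[m]_(y in Q j x) (\1_A x)%:E)%E; last first.
    apply: eq_integral => y; rewrite inE => xy; rewrite !indicE.
    congr (nat_of_bool _)%:R%:E; apply/idP/idP; rewrite !inE => ?.
      exact: sA (cell_sym xy).
    exact: sA xy.
  rewrite integral_cst// measure_cell.
  rewrite muleCA -EFinM mulVf ?gt_eqF//.
  by rewrite /= mulr1.
rewrite integral_cell_swap//; last 2 first.
- by move=> y; rewrite -EFinM lee_fin mulr_ge0// invr_ge0 ltW.
- exact: measurable_funeM.
rewrite [RHS]integral_mkcond; apply: eq_integral => x _.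
by rewrite epatch_indic -muleA (muleC (\1_A x)%:E)%E muleA.
Qed.

(** Generation 0 suffices for integrability on all cells, because its cells are the largest. *)
Definition lfin f := [/\ measurable_fun setT f, (forall x, 0 <= f x) &
  forall x, (\int[m]_(y in Q 0 x) (f y)%:E < +oo)%E].

Local Notation S := (cell_int G).

Local Notation av := (cell_av G).

Lemma S_def j f x : S j f x = fine (\int[m]_(y in Q j x) (f y)%:E)%E.
Proof. by rewrite cell_int.unlock. Qed.

Lemma av_def j f x : av j f x = S j f x / kap j.
Proof. by rewrite cell_av.unlock. Qed.

Lemma lfin_meas f : lfin f -> measurable_fun setT f. Proof. by case. Qed.
Lemma lfin_ge0 f : lfin f -> forall x, 0 <= f x. Proof. by case. Qed.

Lemma lfin_int j f x : lfin f -> (\int[m]_(y in Q j x) (f y)%:E < +oo)%E.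
Proof.
move=> [mf f0 ff]; apply: le_lt_trans (ff x); apply: ge0_subset_integral => //.
- by apply/measurable_funTS; mfun.
- by move=> y _; rewrite lee_fin.
- exact: (@cell_le 0 j x).
Qed.

Lemma SE j f x : lfin f -> (S j f x)%:E = (\int[m]_(y in Q j x) (f y)%:E)%E.
Proof.
move=> ff; rewrite S_def fineK// ge0_fin_numE ?lfin_int//.
by apply: integral_ge0 => y _; rewrite lee_fin lfin_ge0.
Qed.

Lemma S_ge0 j f x : (forall y, 0 <= f y) -> 0 <= S j f x.
Proof. by move=> f0; rewrite S_def; apply: fine_ge0; apply: integral_ge0 => y _; rewrite lee_fin. Qed.

Lemma av_ge0 j f x : (forall y, 0 <= f y) -> 0 <= av j f x.
Proof. by move=> f0; rewrite av_def divr_ge0 ?S_ge0// ltW// kap_gt0. Qed.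

Lemma S_cell j f x y : Q j x y -> S j f y = S j f x.
Proof. by move=> xy; rewrite !S_def (cell_eq xy). Qed.

Lemma av_cell j f x y : Q j x y -> av j f y = av j f x.
Proof. by move=> xy; rewrite !av_def (S_cell _ xy). Qed.

Lemma eq_S j f g x : (forall y, Q j x y -> f y = g y) -> S j f x = S j g x.
Proof.
by move=> fg; rewrite !S_def; congr fine; apply: eq_integral => y; rewrite inE => /fg ->.
Qed.

Lemma eq_av j f g x : (forall y, Q j x y -> f y = g y) -> av j f x = av j g x.
Proof. by move=> /eq_S fg; rewrite !av_def fg. Qed.

Lemma eq_lfin f g : (forall y, f y = g y) -> lfin f -> lfin g.
Proof. by move=> /funext ->. Qed.

Lemma lfin_le f g : measurable_fun setT f -> (forall x, 0 <= f x <= g x) ->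
  lfin g -> lfin f.
Proof.
move=> mf fg [mg g0 gf]; split=> // x; first by case/andP: (fg x).
apply: le_lt_trans (gf x); apply: ge0_le_integral => //.
- by move=> y _; rewrite lee_fin; case/andP: (fg y).
- by apply/measurable_funTS; mfun.
- by apply/measurable_funTS; mfun.
- by move=> y _; rewrite lee_fin; case/andP: (fg y).
Qed.

Lemma le_S j f g x : lfin f -> lfin g ->
  (forall y, Q j x y -> f y <= g y) -> S j f x <= S j g x.
Proof.
move=> ff fg le; rewrite -lee_fin !SE//; have [mf f0 _] := ff.
have [mg g0 _] := fg; apply: ge0_le_integral => //.
- by move=> y _; rewrite lee_fin.
- by apply/measurable_funTS; mfun.
- by apply/measurable_funTS; mfun.
Qed.

Lemma le_av j f g x : lfin f -> lfin g ->
  (forall y, Q j x y -> f y <= g y) -> av j f x <= av j g x.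
Proof.
by move=> ff fg le; rewrite !av_def ler_pM2r ?invr_gt0 ?kap_gt0//; exact: le_S.
Qed.

Lemma integral_cellD j f g x : lfin f -> lfin g ->
  (\int[m]_(y in Q j x) (f y + g y)%:E = (S j f x + S j g x)%:E)%E.
Proof.
move=> ff fg; rewrite EFinD !SE// -ge0_integralD//.
- by move=> y _; rewrite lee_fin lfin_ge0.
- by apply/measurable_funTS; apply/measurable_EFinP; exact: lfin_meas.
- by move=> y _; rewrite lee_fin lfin_ge0.
- by apply/measurable_funTS; apply/measurable_EFinP; exact: lfin_meas.
Qed.

Lemma lfinD f g : lfin f -> lfin g -> lfin (fun x => f x + g x).
Proof.
move=> ff fg; split=> [|x|x].
- by apply: measurable_funD; exact: lfin_meas.
- by rewrite addr_ge0// lfin_ge0.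
- by rewrite integral_cellD// ltry.
Qed.

Lemma SD j f g x : lfin f -> lfin g ->
  S j (fun x => f x + g x) x = S j f x + S j g x.
Proof. by move=> ff fg; rewrite {1}S_def integral_cellD. Qed.

Lemma avD j f g x : lfin f -> lfin g ->
  av j (fun x => f x + g x) x = av j f x + av j g x.
Proof. by move=> ff fg; rewrite !av_def SD// mulrDl. Qed.

Lemma integral_cellZ j c f x : 0 <= c -> lfin f ->
  (\int[m]_(y in Q j x) (c * f y)%:E = (c * S j f x)%:E)%E.
Proof.
move=> c0 ff; rewrite EFinM !SE// -ge0_integralZl//.
- by apply/measurable_funTS; apply/measurable_EFinP; exact: lfin_meas.
- by move=> y _; rewrite lee_fin lfin_ge0.
Qed.

Lemma lfinZ c f : 0 <= c -> lfin f -> lfin (fun x => c * f x).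
Proof.
move=> c0 ff; split=> [|x|x].
- by apply: measurable_funM => //; exact: lfin_meas.
- by rewrite mulr_ge0// lfin_ge0.
- by rewrite integral_cellZ// ltry.
Qed.

Lemma SZ j c f x : 0 <= c -> lfin f -> S j (fun x => c * f x) x = c * S j f x.
Proof. by move=> ff fg; rewrite {1}S_def integral_cellZ. Qed.

Lemma avZ j c f x : 0 <= c -> lfin f -> av j (fun x => c * f x) x = c * av j f x.
Proof. by move=> ff fg; rewrite !av_def SZ// mulrA. Qed.

Lemma lfin_cst c : 0 <= c -> lfin (fun=> c).
Proof.
move=> c0; split=> // x.
by rewrite integral_cst// measure_cell -EFinM ltry.
Qed.

Lemma S_cst j c x : S j (fun=> c) x = c * kap j.
Proof. by rewrite S_def integral_cst// measure_cell. Qed.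

Lemma av_cst j c x : av j (fun=> c) x = c.
Proof. by rewrite av_def S_cst mulfK// gt_eqF// kap_gt0. Qed.

Lemma S_ae0 j f x : (forall y, Q j x y -> f y = 0) -> S j f x = 0.
Proof. by move=> f0; rewrite (eq_S f0) (S_cst j 0 x) mul0r. Qed.

Lemma lfin_mulb g f : measurable_fun setT g -> (forall x, 0 <= g x) ->
  (forall x, exists M, forall y, Q 0 x y -> g y <= M) -> lfin f ->
  lfin (fun x => g x * f x).
Proof.
move=> mg g0 gb ff; have [mf f0 _] := ff; split=> [|x|x].
- exact: measurable_funM.
- exact: mulr_ge0.
- have [M gM] := gb x.
  have M0 : 0 <= M by rewrite (le_trans (g0 x))// gM//; exact: cell_refl.
  have [_ _ /(_ x)] := lfinZ M0 ff; apply: le_lt_trans.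
  apply: ge0_le_integral => //.
  + by move=> y _; rewrite lee_fin mulr_ge0.
  + by apply/measurable_funTS; mfun.
  + by apply/measurable_funTS; mfun.
  + by move=> y xy; rewrite lee_fin ler_wpM2r// gM.
Qed.

Lemma lfin_ind (A : set T) f : measurable A -> lfin f ->
  lfin (fun x => \1_A x * f x).
Proof.
move=> mA; apply: lfin_mulb => //.
by move=> x; exists 1 => y _; rewrite indicE lern1; case: (_ \in _).
Qed.

Lemma S_cstl j g f x : 0 <= g x -> (forall y, Q j x y -> g y = g x) -> lfin f ->
  S j (fun y => g y * f y) x = g x * S j f x.
Proof.
by move=> g0 gc ff; rewrite -SZ//; apply: eq_S => y /gc ->.
Qed.

Lemma measurable_S j f : lfin f -> measurable_fun setT (S j f).
Proof.
move=> ff; have [mf f0 _] := ff; apply/measurable_EFinP.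
have := @measurable_integral_cell j (EFin \o f) _ _.
rewrite (_ : EFin \o S j f = fun x => \int[m]_(y in Q j x) (EFin \o f) y)%E.
  by apply; [move=> y; rewrite lee_fin|mfun].
by apply/funext => x /=; rewrite SE.
Qed.

Lemma measurable_av j f : lfin f -> measurable_fun setT (av j f).
Proof. move=> ff; rewrite (_ : av j f = fun x => S j f x / kap j).
  by apply: measurable_funM => //; exact: measurable_S.
by apply/funext => x; rewrite av_def. Qed.

(** Localized tower property. Stopping cells of varying generation are integrated over with it, one
    generation at a time. *)
Lemma S_tower_ind i j (A : set T) f x : (j <= i)%N -> measurable A -> saturated i A ->
  lfin f ->
  S j (fun y => \1_A y * f y) x = S j (fun y => \1_A y * av i f y) x.
Proof.
move=> ji mA sA ff; have [mf f0 _] := ff; rewrite !S_def; congr fine.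
have E (g : T -> R) : (\int[m]_(y in Q j x) (\1_A y * g y)%:E =
   \int[m]_(y in Q j x `&` A) (g y)%:E)%E.
  rewrite integral_mkcond [RHS]integral_mkcond; apply: eq_integral => y _.
  rewrite !epatch_indic/= indicI/= -!EFinM; congr EFin.
  by ring.
rewrite !E (@integral_tower i)//; last 2 first.
- by move=> y z [Qy Ay] yz; split; [exact: (saturated_cell ji) yz|exact: sA yz].
- by mfun.
- apply: eq_integral => y _; rewrite -SE// -EFinM; congr EFin.
  by rewrite av_def mulrC.
- by apply: measurableI.
Qed.

Lemma S_tower i j f x : (j <= i)%N -> lfin f -> S j f x = S j (av i f) x.
Proof.
move=> ji ff; have one g : S j (fun y => \1_(@setT T) y * g y) x = S j g x.
  by apply: eq_S => y _; rewrite indicE mem_set// mul1r.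
by rewrite -one (S_tower_ind x ji (@measurableT _ T) (@saturatedT i) ff) one.
Qed.

Lemma lfin_av i f : lfin f -> lfin (av i f).
Proof.
move=> ff; have [mf f0 fi] := ff; split.
- exact: measurable_av.
- by move=> x; rewrite av_ge0.
move=> x; have := fi x; rewrite (@integral_tower i)//.
- apply: le_lt_trans; rewrite le_eqVlt; apply/orP; left; apply/eqP.
  by apply: eq_integral => y _; rewrite -SE// -EFinM av_def mulrC.
- exact: saturated_cell.
- by mfun.
Qed.

Lemma S_child j f x : lfin f -> S j.+1 f x <= S j f x.
Proof.
move=> ff; have [mf f0 _] := ff; rewrite -lee_fin !SE//.
apply: ge0_subset_integral => //; last exact: cell_nest.
- by apply/measurable_funTS; mfun.
- by move=> y _; rewrite lee_fin.
Qed.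

Lemma D_gt0 : 0 < D.
Proof. by have := kap_gt0 G 0; rewrite kapS pmulr_lgt0// kap_gt0. Qed.

Lemma av_child j f x : lfin f -> av j.+1 f x <= D * av j f x.
Proof.
move=> ff; rewrite !av_def [in leRHS]kapS mulrCA invfM mulVKf ?gt_eqF ?D_gt0//.
by rewrite ler_pM2r ?S_child// invr_gt0 kap_gt0.
Qed.

(** Crude, but it makes averages of a fixed generation bounded on every cell of generation 0, so
    that products with their powers stay in [lfin]. *)
Lemma av_bound j f x : lfin f -> av j f x <= D ^+ j * av 0 f x.
Proof.
move=> ff; elim: j => [|j IH]; first by rewrite mul1r.
apply: le_trans (av_child _ _ ff) _; rewrite exprS -mulrA.
by rewrite ler_wpM2l// ltW// D_gt0.
Qed.

End dyadic_theory.

(** * Hoelder inequalities for normalized norms on a cell *)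

HB.lock Definition cell_Nm d (T : measurableType d) (R : realType)
    (m : {sigma_finite_measure set T -> \bar R}) (D : R) (G : dyadic m D)
    (a : R) (j : nat) (f : T -> R) (x : T) : R :=
  cell_av G j (fun y => f y `^ a) x `^ a^-1.

Section holder.
Local Opaque powR.
Context {d} {T : measurableType d} {R : realType}.
Context {m : {sigma_finite_measure set T -> \bar R}} {D : R}.
Variable G : dyadic m D.
Implicit Types (j i : nat) (x y : T) (f g h u v : T -> R) (a b c t : R).
Local Notation lfin := (lfin G).
Local Notation av := (cell_av G).

(** Strictly larger factors are positive, so the proof of Hoelder's inequality can divide by them
    without treating vanishing norms apart. *)
Lemma le_mul_gt (x a b : R) : 0 <= a -> 0 <= b ->
  (forall s t, a < s -> b < t -> x <= s * t) -> x <= a * b.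
Proof.
move=> a0 b0 H; apply/ler_addgt0Pr => e e0.
(* For [t <= 1], expanding [(a + t) * (b + t)] exceeds [a * b] by at most [t * (a + b + 1)]. *)
have [t [t0 t1 te]] : exists t : R, [/\ 0 < t, t <= 1 & t * (a + b + 1) <= e].
  have ab1 : 0 < a + b + 1 by rewrite ltr_wpDl// addr_ge0.
  exists (Num.min 1 (e / (a + b + 1))); split.
  - by rewrite lt_min ltr01/= divr_gt0.
  - by rewrite ge_min lexx.
  - by rewrite -ler_pdivlMr// ge_min lexx orbT.
have := H (a + t) (b + t); rewrite !ltrDl => /(_ t0 t0) /le_trans; apply.
have : t * t <= t by rewrite ler_piMl// ltW.
nra.
Qed.

Lemma le_powR (a x y : R) : 0 <= a -> 0 <= x -> x <= y -> x `^ a <= y `^ a.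
Proof.
by move=> a0 x0 xy; apply: ge0_ler_powR => //; rewrite nnegrE// (le_trans x0).
Qed.

Lemma powRVK (a x : R) : 0 < a -> 0 <= x -> (x `^ a^-1) `^ a = x.
Proof. by move=> a0 x0; rewrite -powRrM mulVf ?gt_eqF// powRr1. Qed.

Lemma powRKV (a x : R) : 0 < a -> 0 <= x -> (x `^ a) `^ a^-1 = x.
Proof. by move=> a0 x0; rewrite -powRrM mulfV ?gt_eqF// powRr1. Qed.

Lemma le_powRV (a x y : R) : 0 < a -> 0 <= x -> x `^ a^-1 <= y -> x <= y `^ a.
Proof.
move=> a0 x0 xy; rewrite -[leLHS](powRVK a0 x0); apply: le_powR => //.
  exact: ltW.
exact: powR_ge0.
Qed.

Lemma av_holder a b j f g x : 0 < a -> 0 < b -> a^-1 + b^-1 = 1 ->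
  measurable_fun setT f -> measurable_fun setT g ->
  (forall y, 0 <= f y) -> (forall y, 0 <= g y) ->
  lfin (fun y => f y `^ a) -> lfin (fun y => g y `^ b) ->
  lfin (fun y => f y * g y) /\
  av j (fun y => f y * g y) x <=
  av j (fun y => f y `^ a) x `^ a^-1 * av j (fun y => g y `^ b) x `^ b^-1.
Proof.
move=> a0 b0 ab mf mg f0 g0 ff gg.
have ffg : lfin (fun y => f y * g y).
  apply: (@lfin_le _ _ _ _ _ _ _ (fun y => a^-1 * f y `^ a + b^-1 * g y `^ b)).
  - by mfun.
  - move=> y; rewrite mulr_ge0//= (le_trans (conjugate_powR _ _ _ _ ab))//.
    by rewrite ![_^-1 * _]mulrC.
  - by apply: lfinD; apply: lfinZ => //; rewrite invr_ge0 ltW.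
split=> //.
have A0 : 0 <= av j (fun y => f y `^ a) x by apply: av_ge0 => y; exact: powR_ge0.
have B0 : 0 <= av j (fun y => g y `^ b) x by apply: av_ge0 => y; exact: powR_ge0.
apply: le_mul_gt => [||s t]; [exact: powR_ge0|exact: powR_ge0|move=> As Bt].
have s0 : 0 < s by rewrite (le_lt_trans _ As)// powR_ge0.
have t0 : 0 < t by rewrite (le_lt_trans _ Bt)// powR_ge0.
have {}As : av j (fun y => f y `^ a) x <= s `^ a.
  by apply: le_powRV => //; exact: ltW.
have {}Bt : av j (fun y => g y `^ b) x <= t `^ b.
  by apply: le_powRV => //; exact: ltW.
have sa : 0 < s `^ a by rewrite powR_gt0.
have tb : 0 < t `^ b by rewrite powR_gt0.
have st : 0 < s * t by rewrite mulr_gt0.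
(* Young's inequality for [f / s] and [g / t], multiplied by [s * t], reads
   [f * g <= c1 * f ^ a + c2 * g ^ b]; the right-hand side has average at most [s * t]. *)
have [c1 Ec1] : exists c1, c1 = s * t / a / s `^ a by eexists.
have [c2 Ec2] : exists c2, c2 = s * t / b / t `^ b by eexists.
have c10 : 0 <= c1 by rewrite Ec1 !divr_ge0// ltW.
have c20 : 0 <= c2 by rewrite Ec2 !divr_ge0// ltW.
have -> : s * t = c1 * s `^ a + c2 * t `^ b.
  by rewrite Ec1 Ec2 !mulfVK ?gt_eqF// -mulrDr ab mulr1.
apply: (@le_trans _ _ (c1 * av j (fun y => f y `^ a) x + c2 * av j (fun y => g y `^ b) x)); last first.
  by apply: lerD; apply: ler_wpM2l.
rewrite -avZ// -avZ// -avD; [|exact: lfinZ|exact: lfinZ].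
apply: le_av => //; first by apply: lfinD; exact: lfinZ.
move=> y _.
have fs : 0 <= f y / s by rewrite divr_ge0// ltW.
have gt : 0 <= g y / t by rewrite divr_ge0// ltW.
have := conjugate_powR fs gt a0 b0 ab.
have inv (c z : R) : 0 < z -> z^-1 `^ c = (z `^ c)^-1.
  by move=> z0; rewrite -powR_inv1 ?ltW// -powRrM mulN1r powRN.
rewrite !powRM ?invr_ge0 ?(ltW s0) ?(ltW t0)// !inv// => H.
have -> : f y * g y = s * t * (f y / s * (g y / t)).
  by field; rewrite !gt_eqF.
rewrite -(ler_pM2l st) in H; apply: le_trans H _.
rewrite le_eqVlt; apply/orP; left; apply/eqP.
by rewrite Ec1 Ec2; field; rewrite !gt_eqF.
Qed.

Local Notation Nm := (cell_Nm G).

Lemma Nm_def a j f x : Nm a j f x = av j (fun y => f y `^ a) x `^ a^-1.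
Proof. by rewrite cell_Nm.unlock. Qed.

Lemma Nm_ge0 a j f x : 0 <= Nm a j f x. Proof. by rewrite Nm_def; exact: powR_ge0. Qed.

Lemma Nm_powR a j f x : 0 < a -> Nm a j f x `^ a = av j (fun y => f y `^ a) x.
Proof.
move=> a0; rewrite Nm_def powRVK// av_ge0// => y.
exact: powR_ge0.
Qed.

Lemma Nm_pow a t j f x : 0 < t ->
  Nm a j (fun y => f y `^ t) x = Nm (a * t) j f x `^ t.
Proof.
move=> t0; have t1 : t != 0 by rewrite gt_eqF.
rewrite !Nm_def -[RHS]powRrM invfM (mulfVK t1).
by congr (cell_av _ _ _ _ `^ _); apply/funext => y; rewrite -powRrM mulrC.
Qed.

(** Hoelder with the conjugate exponents [a / c] and [b / c], applied to the powers [f ^ c] and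
    [g ^ c]. *)
Lemma Nm_holder a b c j f g x : 0 < a -> 0 < b -> 0 < c -> c^-1 = a^-1 + b^-1 ->
  measurable_fun setT f -> measurable_fun setT g ->
  (forall y, 0 <= f y) -> (forall y, 0 <= g y) ->
  lfin (fun y => f y `^ a) -> lfin (fun y => g y `^ b) ->
  lfin (fun y => (f y * g y) `^ c) /\
  Nm c j (fun y => f y * g y) x <= Nm a j f x * Nm b j g x.
Proof.
move=> a0 b0 c0 cab mf mg f0 g0 ff gg.
have E (s : R) (h : T -> R) y : (h y `^ c) `^ (s / c) = h y `^ s.
  by rewrite -powRrM; congr (_ `^ _); field; rewrite gt_eqF.
have [] := @av_holder (a / c) (b / c) j (fun y => f y `^ c) (fun y => g y `^ c) x.
- by rewrite divr_gt0.
- by rewrite divr_gt0.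
- by rewrite !invf_div -mulrDr -cab mulfV// gt_eqF.
- by mfun.
- by mfun.
- by move=> y; exact: powR_ge0.
- by move=> y; exact: powR_ge0.
- by apply: eq_lfin ff => y; rewrite E.
- by apply: eq_lfin gg => y; rewrite E.
move=> H1 H2; split; first by apply: eq_lfin H1 => y; rewrite powRM.
have {}H2 : av j (fun y => (f y * g y) `^ c) x <=
    av j (fun y => f y `^ a) x `^ (a / c)^-1 * av j (fun y => g y `^ b) x `^ (b / c)^-1.
  rewrite (eq_av (g := fun y => f y `^ c * g y `^ c)); last first.
    by move=> y _; rewrite powRM.
  have E1 : av j (fun y => f y `^ a) x = av j (fun y => (f y `^ c) `^ (a / c)) x.
    by apply: eq_av => y _; rewrite E.
  have E2 : av j (fun y => g y `^ b) x = av j (fun y => (g y `^ c) `^ (b / c)) x.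
    by apply: eq_av => y _; rewrite E.
  rewrite E1 E2; exact: H2.
rewrite !Nm_def.
have -> : a^-1 = (a / c)^-1 / c by field; rewrite !gt_eqF.
have -> : b^-1 = (b / c)^-1 / c by field; rewrite !gt_eqF.
rewrite [X in _ <= X * _]powRrM [X in _ <= _ * X]powRrM -powRM ?powR_ge0//.
apply: le_powR; [by rewrite invr_ge0 ltW| |exact: H2].
by apply: av_ge0 => y; exact: powR_ge0.
Qed.

(** Hoelder against the constant 1, whose normalized norm is 1. The case [a = b] is separate because
    the complementary exponent is then infinite. *)
Lemma Nm_le a b j f x : 0 < a -> a <= b ->
  measurable_fun setT f -> (forall y, 0 <= f y) -> lfin (fun y => f y `^ b) ->
  lfin (fun y => f y `^ a) /\ Nm a j f x <= Nm b j f x.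
Proof.
move=> a0; rewrite le_eqVlt => /predU1P[<-//|ab] mf f0 ff.
have b0 := lt_trans a0 ab.
have c0 : 0 < (a^-1 - b^-1) by rewrite subr_gt0 ltf_pV2.
have [] := @Nm_holder b (a^-1 - b^-1)^-1 a j f (fun=> 1) x.
- by [].
- by rewrite invr_gt0.
- by [].
- by rewrite invrK addrC subrK.
- by [].
- by mfun.
- by [].
- by [].
- by [].
- by under eq_fun do rewrite powR1; exact: lfin_cst.
move=> H1 H2; split; first by apply: eq_lfin H1 => y; rewrite mulr1.
apply: le_trans (le_trans _ H2) _.
  rewrite !Nm_def (@eq_av _ _ _ _ _ G j (fun y => f y `^ a) (fun y => (f y * 1) `^ a)) => [//|y _].
  by rewrite mulr1.
rewrite [X in _ * X <= _]Nm_def (@eq_av _ _ _ _ _ G j _ (fun=> 1)); last first.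
  by move=> y _; rewrite powR1.
by rewrite av_cst powR1 mulr1.
Qed.

End holder.

(** * Convergence of averages *)

Section levy.
Import HBNNSimple.
Context {d} {T : measurableType d} {R : realType}.
Context {m : {sigma_finite_measure set T -> \bar R}} {D : R}.
Variable G : dyadic m D.
Implicit Types (j i : nat) (x y : T) (f g h u v : T -> R) (a b c t : R).
Local Notation Q := (cell G).
Local Notation lfin := (lfin G).
Local Notation S := (cell_int G).
Local Notation av := (cell_av G).
Hint Resolve measurable_cell : core.

Lemma lfin_dist f g : lfin f -> lfin g -> lfin (fun x => `|f x - g x|).
Proof.
move=> ff fg; apply: (lfin_le _ _ (lfinD ff fg)).
- by have [mf _ _] := ff; have [mg _ _] := fg; mfun.
- move=> x; rewrite normr_ge0/=.
  by rewrite (le_trans (ler_normB _ _))// !ger0_norm ?(lfin_ge0 ff) ?(lfin_ge0 fg).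
Qed.

Lemma S_dist_tri j f g h x : lfin f -> lfin g -> lfin h ->
  S j (fun y => `|f y - h y|) x <=
  S j (fun y => `|f y - g y|) x + S j (fun y => `|g y - h y|) x.
Proof.
move=> ff fg fh; rewrite -SD; [|exact: lfin_dist|exact: lfin_dist].
apply: le_S; first exact: lfin_dist.
  by apply: lfinD; exact: lfin_dist.
by move=> y _; exact: ler_distD.
Qed.

Lemma av_dist i f g x : lfin f -> lfin g ->
  `|av i f x - av i g x| <= av i (fun y => `|f y - g y|) x.
Proof.
move=> ff fg; have fd := lfin_dist ff fg.
have fgd : lfin (fun y => g y + `|f y - g y|) by exact: lfinD.
have gfd : lfin (fun y => f y + `|f y - g y|) by exact: lfinD.
have : av i f x <= av i g x + av i (fun y => `|f y - g y|) x.
  rewrite -avD//; apply: le_av => // y _.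
  by have := ler_norm (f y - g y); lra.
have : av i g x <= av i f x + av i (fun y => `|f y - g y|) x.
  rewrite -avD//; apply: le_av => // y _.
  by have := ler_norm (g y - f y); rewrite distrC; lra.
by rewrite ler_norml => ? ?; apply/andP; split; lra.
Qed.

Lemma S_av_dist i f g x : lfin f -> lfin g ->
  S 0 (fun y => `|av i f y - av i g y|) x <= S 0 (fun y => `|f y - g y|) x.
Proof.
move=> ff fg; have fd := lfin_dist ff fg.
rewrite [leRHS](S_tower x (leq0n i) fd); apply: le_S.
- by apply: lfin_dist; exact: lfin_av.
- exact: lfin_av.
- by move=> y _; exact: av_dist.
Qed.

Variable x0 : T.

(** Convergence in L1 of the averages, as in Levy's upward theorem, on the cell of generation 0
    around [x0]. *)
Definition levy f := forall e, 0 < e -> exists N, forall i, (N <= i)%N ->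
  S 0 (fun y => `|av i f y - f y|) x0 <= e.

(** Averaging contracts L1 distances on the cell, so three errors of size [e / 3] suffice. *)
Lemma levy_lim f : lfin f -> (forall e, 0 < e -> exists g,
  [/\ lfin g, levy g & S 0 (fun y => `|f y - g y|) x0 <= e]) -> levy f.
Proof.
move=> ff H e e0; have e30 : 0 < e / 3 by lra.
have [g [fg lg ge]] := H _ e30; have [N HN] := lg _ e30.
exists N => i Ni; have faf := lfin_av i ff; have fag := lfin_av i fg.
have := HN _ Ni.
have := S_dist_tri 0 x0 faf fag ff.
have := S_dist_tri 0 x0 fag fg ff.
have := S_av_dist i x0 ff fg.
have -> : S 0 (fun y => `|g y - f y|) x0 = S 0 (fun y => `|f y - g y|) x0.
  by apply: eq_S => y _; rewrite distrC.
lra.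
Qed.

Lemma levyD f g : lfin f -> lfin g -> levy f -> levy g ->
  levy (fun x => f x + g x).
Proof.
move=> ff fg lf lg e e0; have e20 : 0 < e / 2 by lra.
have [N1 H1] := lf _ e20; have [N2 H2] := lg _ e20.
exists (maxn N1 N2) => i; rewrite geq_max => /andP[/H1 {}H1 /H2 {}H2].
have faf := lfin_av i ff; have fag := lfin_av i fg.
have d1 := lfin_dist faf ff; have d2 := lfin_dist fag fg.
apply: (@le_trans _ _ (S 0 (fun y => `|av i f y - f y| + `|av i g y - g y|) x0)).
  apply: le_S.
  - by apply: lfin_dist; [apply: lfin_av; exact: lfinD|exact: lfinD].
  - exact: lfinD.
  - move=> y _; rewrite avD// opprD addrACA; exact: ler_normD.
rewrite SD//; lra.
Qed.

Lemma levyZ c f : 0 <= c -> lfin f -> levy f -> levy (fun x => c * f x).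
Proof.
move=> c0 ff lf e e0; have c1 : 0 < c + 1 by rewrite ltr_wpDl.
have [N HN] := lf _ (divr_gt0 e0 c1); exists N => i Ni.
have fd := lfin_dist (lfin_av i ff) ff.
rewrite (eq_S (g := fun y => c * `|av i f y - f y|)); last first.
  by move=> y _; rewrite avZ// -mulrBr normrM ger0_norm.
rewrite SZ//; apply: (@le_trans _ _ (c * (e / (c + 1)))).
  by apply: ler_wpM2l => //; exact: HN.
rewrite mulrA ler_pdivrMr//; nra.
Qed.

Lemma levy_sat (A : set T) j : measurable A -> saturated G j A -> levy (\1_A : T -> R).
Proof.
move=> mA sA e e0; exists j => i ji.
rewrite (eq_S (g := fun=> 0)) ?S_cst ?mul0r ?ltW// => y _.
rewrite (eq_av (g := fun=> \1_A y)) ?av_cst ?subrr ?normr0// => z yz.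
have {}yz : Q j y z by exact: (@cell_le _ _ _ _ _ G j i y).
rewrite !indicE; congr (nat_of_bool _)%:R; apply/idP/idP; rewrite !inE => ?.
  exact: sA (cell_sym yz).
exact: sA yz.
Qed.

Lemma lfin_indic (A : set T) : measurable A -> lfin (\1_A : T -> R).
Proof.
move=> mA; apply: (@lfin_le _ _ _ _ _ _ _ (fun=> 1)); first exact: measurable_indic.
  by move=> x; rewrite indicE lern1 ler0n; case: (_ \in _).
exact: lfin_cst.
Qed.

Lemma levyC (A : set T) : measurable A -> levy (\1_A : T -> R) ->
  levy (\1_(~` A) : T -> R).
Proof.
move=> mA lA e e0; have [N HN] := lA _ e0; exists N => i Ni.
have fA := lfin_indic mA; have fA' := lfin_indic (measurableC mA).
have E y : (\1_A y + \1_(~` A) y = 1 :> R).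
  rewrite !indicE; have [yA|yA] := boolP (y \in A).
    by rewrite inE in yA; rewrite memNset ?addr0// => /(_ yA).
  by rewrite mem_set ?add0r// => Ay; rewrite mem_set in yA.
apply: le_trans (HN _ Ni).
rewrite (eq_S (g := fun y => `|av i (\1_A : T -> R) y - \1_A y|))// => y _.
have : av i (fun y => \1_A y + \1_(~` A) y) y = 1.
  by rewrite (eq_av (g := fun=> 1)) ?av_cst.
rewrite avD// => E1; rewrite -normrN opprB; congr `|_|.
by have := E y; lra.
Qed.

(** Domination by [h] upgrades pointwise convergence to L1 convergence on the cell, which [levy_lim]
    accepts. *)
Lemma levy_dct (f_ : nat -> T -> R) f h : lfin f -> lfin h ->
  (forall n, lfin (f_ n)) -> (forall n, levy (f_ n)) ->
  (forall n x, f_ n x <= h x) -> (forall x, f_ n x @[n --> \oo] --> f x) ->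
  levy f.
Proof.
move=> ff fh ffn lfn fnh fnf; apply: levy_lim => // e e0.
have [|||||_ + _] := @dominated_convergence _ _ _ m (Q 0 x0) (measurable_cell _ _ _)
  (fun n y => (f_ n y)%:E) (fun y => (f y)%:E) (fun y => (h y)%:E).
- by move=> n; apply/measurable_funTS/measurable_EFinP; exact: lfin_meas (ffn n).
- by apply/measurable_funTS/measurable_EFinP; exact: lfin_meas ff.
- by apply: aeW => y _; apply: cvg_EFin; [exact: nearW|exact: fnf].
- apply/integrableP; split.
    by apply/measurable_funTS/measurable_EFinP; exact: lfin_meas fh.
  have [_ h0 /(_ x0)] := fh; apply: le_lt_trans; rewrite le_eqVlt.
  by apply/orP; left; apply/eqP/eq_integral => y _; rewrite gee0_abs// lee_fin.
- apply: aeW => y n _; rewrite abse_EFin lee_fin ger0_norm//.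
  exact: (lfin_ge0 (ffn n)).
rewrite (_ : [sequence _]_n = EFin \o (fun n => S 0 (fun y => `|f_ n y - f y|) x0)); last first.
  apply/funext => n /=; rewrite SE//; exact: lfin_dist.
move=> /fine_cvgP[_ /cvgr0_norm_le /(_ _ e0)[N _ /(_ N (leqnn _))]] /= le.
exists (f_ N); split=> //; apply: le_trans (le_trans (ler_norm _) le).
by rewrite le_eqVlt; apply/orP; left; apply/eqP/eq_S => y _; rewrite distrC.
Qed.

(** A pi-lambda argument: unions of cells of one generation are stable under intersection, generate
    the sigma-algebra, and have indicators that coincide with their averages from that generation
    on. *)
Lemma levy_indic (A : set T) : measurable A -> levy (\1_A : T -> R).
Proof.
move=> mA.
pose gen := [set A | measurable A /\ exists j, forall x y, A x -> Q j x y -> A y].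
have genE : measurable = <<s gen >>.
  apply/seteqP; split; first by move=> B mB; have := @cell_gen _ _ _ _ _ G B mB.
  by apply: smallest_sub; [exact: sigma_algebra_measurable|move=> B []].
apply: (@dynkin_induction _ T gen (fun A => measurable A /\ levy (\1_A : T -> R)) genE
  _ _ _ _ _ A _).2.
- move=> X Y [mX [i sX]] [mY [j sY]]; split; first exact: measurableI.
  exists (maxn i j) => x y [Xx Yx] xy; split.
    by apply: (sX x) => //; apply: cell_le xy; rewrite leq_maxl.
  by apply: (sY x) => //; apply: cell_le xy; rewrite leq_maxr.
- split => //; apply: (@levy_sat _ 0) => //; exact: saturatedT.
- by move=> X [mX [j sX]]; split => //; exact: (@levy_sat _ j).
- by move=> X mX [_ lX]; split; [exact: measurableC|exact: levyC].
- move=> F mF tF HF; have mU : measurable (\bigcup_k F k) by exact: bigcup_measurable.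
  split => //.
  (* Disjointness makes the indicator of a finite union the sum of the indicators, so [levyD]
     reaches every [U n]; the countable union is a dominated limit. *)
  pose U n : set T := \big[setU/set0]_(k < n) F k.
  have mUn n : measurable (U n) by apply: bigsetU_measurable.
  apply: (@levy_dct (fun n => \1_(U n)) _ (fun=> 1)).
  + exact: lfin_indic.
  + exact: lfin_cst.
  + by move=> n; exact: lfin_indic.
  + elim=> [|n IH].
      by apply: (@levy_sat _ 0) => // x y; rewrite /U big_ord0.
    move=> e e0; have [N HN] := levyD (lfin_indic (mUn n)) (lfin_indic (mF n)) IH (HF n).2 e0.
    suff E : (\1_(U n.+1) : T -> R) = fun y => \1_(U n) y + \1_(F n) y.
      by exists N; rewrite E.
    apply/funext => y; rewrite /U big_ord_recr/= -/(U n) indicE in_setU !indicE.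
    have [Fy|] := boolP (y \in F n); last by rewrite orbF addr0.
    rewrite orbT memNset ?add0r// /U -bigcup_mkord => -[k /= kn Fky].
    have := tF k n I I; rewrite inE in Fy.
    by move=> /(_ (ex_intro _ y (conj Fky Fy))) kE; rewrite kE ltnn in kn.
  + by move=> n x; rewrite indicE lern1; case: (_ \in _).
  + move=> x; have [[k _ Fk]|nF] := pselect ((\bigcup_k F k) x).
      rewrite indicE mem_set//; last by exists k.
      apply: cvg_near_cst; exists k.+1 => // n /= kn.
      by rewrite indicE mem_set//= /U -bigcup_mkord; exists k.
    rewrite indicE memNset//; apply: cvg_near_cst; exists 0 => // n _ /=.
    by rewrite indicE memNset// /U -bigcup_mkord => -[k _ Fk]; apply: nF; exists k.
- by rewrite -genE.
Qed.

Lemma levy_all f : lfin f -> levy f.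
Proof.
move=> ff; have [mf f0 _] := ff.
have mf' : measurable_fun setT (fun x => (f x)%:E) by exact/measurable_EFinP.
have f0' x : [set: T] x -> (0 <= (f x)%:E)%E by rewrite lee_fin.
pose f_ n := nnsfun_approx measurableT mf' n.
have fle n x : f_ n x <= f x.
  by rewrite -lee_fin nnsfun_approxE; apply: le_approx.
have ffn n : lfin (f_ n).
  by apply: lfin_le ff => // x; rewrite fle andbT.
apply: (@levy_dct (fun n => f_ n : T -> R) _ f) => //; last first.
  move=> x; have /fine_cvgP[_] := cvg_nnsfun_approx measurableT mf' f0' (I : setT x).
  by [].
move=> n; set s := f_ n.
pose r := finmap.enum_fset (fset_set (range s)).
have E : (s : T -> R) = fun x => \sum_(i < size r) r`_i * \1_(s @^-1` [set r`_i]) x.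
  by apply/funext => x; rewrite [LHS]fimfunEord.
(* The values of the simple function are added one at a time, since only binary sums and nonnegative
   multiples have been treated. *)
have H : forall k : nat, (k <= size r)%N ->
    lfin (fun x => \sum_(i < k) r`_i * \1_(s @^-1` [set r`_i]) x) /\
    levy (fun x => \sum_(i < k) r`_i * \1_(s @^-1` [set r`_i]) x).
  elim=> [_|k IH kr].
    have -> : (fun x => \sum_(i < 0) r`_i * \1_(s @^-1` [set r`_i]) x) = fun x : T => 0 * \1_(@setT T) x.
      by apply/funext => x; rewrite big_ord0 mul0r.
    split; first by apply: lfinZ => //; exact: lfin_indic.
    by apply: levyZ => //; [exact: lfin_indic|exact: levy_indic].
  have [fk lk] := IH (ltnW kr).
  have r0 : 0 <= r`_k.
    have : r`_k \in fset_set (range s) by exact: mem_nth.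
    by rewrite in_fset_set// inE => -[y _ <-].
  have mk : measurable (s @^-1` [set r`_k]) by [].
  have -> : (fun x => \sum_(i < k.+1) r`_i * \1_(s @^-1` [set r`_i]) x) =
     fun x => \sum_(i < k) r`_i * \1_(s @^-1` [set r`_i]) x + r`_k * \1_(s @^-1` [set r`_k]) x.
    by apply/funext => x; rewrite big_ord_recr.
  have fi := lfin_indic mk; have li := levy_indic mk.
  split; first by apply: lfinD => //; exact: lfinZ.
  by apply: levyD => //; [exact: lfinZ|exact: levyZ].
by rewrite E; exact: (H _ (leqnn _)).2.
Qed.

End levy.

Lemma cvg_powR_gt0 (R : realType) (u : nat -> R) (t a : R) : 0 < t ->
  u n @[n --> \oo] --> t -> (u n) `^ a @[n --> \oo] --> t `^ a.
Proof.
move=> t0 ut.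
have H : expR (a * ln (u n)) @[n --> \oo] --> expR (a * ln t).
  apply: continuous_cvg; first exact: continuous_expR.
  by apply: cvgMr; apply: continuous_cvg => //; exact: continuous_ln.
have un0 : \forall n \near \oo, 0 < u n by exact: (cvgr_gt t).
have -> : t `^ a = expR (a * ln t) by rewrite /powR gt_eqF.
have E : \forall n \near \oo, expR (a * ln (u n)) = u n `^ a.
  by apply: filterS un0 => n un; rewrite /powR gt_eqF.
by move: E => /near_eq_cvg/cvg_trans; apply.
Qed.

Lemma limn_einf_ge0 (R : realType) (u : (\bar R)^nat) :
  (forall n, 0 <= u n)%E -> (0 <= limn_einf u)%E.
Proof.
move=> u0; rewrite limn_einf_lim; apply: lime_ge; first exact: is_cvg_einfs.
by apply: nearW => n; apply: le_ereal_inf_tmp => _ [k _ <-].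
Qed.

Lemma limn_einf_le (R : realType) (u : (\bar R)^nat) c :
  (forall n, u n <= c)%E -> (limn_einf u <= c)%E.
Proof.
move=> uc; rewrite limn_einf_lim; apply: lime_le; first exact: is_cvg_einfs.
apply: nearW => n; apply: le_trans (uc n).
by apply: ereal_inf_lbound; exists n => /=.
Qed.

Section fatou_L1.
Context {d} {T : measurableType d} {R : realType}.
Context {m : {sigma_finite_measure set T -> \bar R}} {D : R}.
Variable G : dyadic m D.
Implicit Types (j i : nat) (x y : T) (f g h u v : T -> R) (a b c t : R).
Local Notation Q := (cell G).
Local Notation lfin := (lfin G).
Local Notation S := (cell_int G).
Hint Resolve measurable_cell : core.

(** Along indices whose L1 distances are at most [1 / 2 ^ (k + 1)] the series of distances has
    integral at most 1. It is therefore finite almost everywhere, and its terms tend to 0 there. The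
    bound [j <= phi k] keeps the subsequence among generations finer than the cell considered. *)
Lemma L1_ae_subseq (g_ : nat -> T -> R) g x0 j :
  (forall i, lfin (fun y => `|g_ i y - g y|)) ->
  (forall e, 0 < e -> exists N, forall i, (N <= i)%N ->
     S 0 (fun y => `|g_ i y - g y|) x0 <= e) ->
  exists phi : nat -> nat, (forall k, (j <= phi k)%N) /\
   {ae m, forall y, Q j x0 y -> `|g_ (phi k) y - g y| @[k --> \oo] --> 0}.
Proof.
move=> lf H.
have e0 k : 0 < 1 / (2 ^ (k + 1))%:R :> R by rewrite divr_gt0// ltr0n expn_gt0.
have H' k : exists i, (j <= i)%N /\ S 0 (fun y => `|g_ i y - g y|) x0 <= 1 / (2 ^ (k + 1))%:R.
  have [N HN] := H _ (e0 k); exists (maxn N j); split; first exact: leq_maxr.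
  by apply: HN; exact: leq_maxl.
have [phi Hphi] := choice H'; exists phi; split; first by move=> k; have [] := Hphi k.
pose F k y : \bar R := `|g_ (phi k) y - g y|%:E.
have mF k : measurable_fun (Q 0 x0) (F k).
  by apply/measurable_funTS/measurable_EFinP; exact: lfin_meas (lf _).
have F0 k y : (0 <= F k y)%E by rewrite lee_fin.
have F0' k y : Q 0 x0 y -> (0 <= F k y)%E by move=> _.
have mSF : measurable_fun (Q 0 x0) (fun y => \sum_(0 <= k <oo) F k y)%E.
  exact: ge0_emeasurable_sum.
have iF : (\int[m]_(y in Q 0 x0) (\sum_(0 <= k <oo) F k y) <= 1)%E.
  rewrite integral_nneseries//.
  have <- : (\sum_(0 <= k <oo) (1 / (2 ^ (k + 1))%:R)%:E)%E = 1%E :> \bar R.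
    apply/cvg_lim => //; have := @cvg_geometric_eseries_half R 1 0.
    by rewrite expr0 divr1.
  apply: lee_nneseries => k _; first by move=> _; exact: integral_ge0.
  rewrite -SE//; have [_] := Hphi k; by rewrite lee_fin.
have inF : m.-integrable (Q 0 x0) (fun y => \sum_(0 <= k <oo) F k y)%E.
  apply/integrableP; split=> //.
  rewrite (eq_integral (fun y => \sum_(0 <= k <oo) F k y)%E).
    by apply: le_lt_trans iF _; rewrite ltry.
  by move=> y _; rewrite gee0_abs//; exact: nneseries_ge0.
have := integrable_ae (measurable_cell G 0 x0) inF.
apply: filterS => y Hy /(@cell_le _ _ _ _ _ G 0 j x0 (leq0n j)) /Hy fy.
have /(nneseries_tail_cvg) : (\sum_(0 <= k <oo) F k y < +oo)%E by rewrite ltey_eq fy.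
move=> /(_ (fun k _ => F0 k y)) tl.
have : F k y @[k --> \oo] --> 0%E.
  apply: (squeeze_cvge _ (cvg_cst 0%E) tl); apply: nearW => k.
  rewrite F0/=; apply: le_trans (nneseries_lim_ge k.+1 _) => //.
  by rewrite big_nat1.
by move=> /fine_cvgP[_].
Qed.

(** Transfers estimates proved for averages to the function itself; it also yields finiteness of
    integrals that are not known to be finite beforehand. *)
Lemma fatou_L1 (g_ : nat -> T -> R) g u x0 j c rho (C : \bar R) :
  0 < rho -> measurable_fun setT g -> (forall i, measurable_fun setT (g_ i)) ->
  measurable_fun setT u -> (forall y, 0 <= u y) ->
  (forall i, lfin (fun y => `|g_ i y - g y|)) ->
  (forall e, 0 < e -> exists N, forall i, (N <= i)%N ->
     S 0 (fun y => `|g_ i y - g y|) x0 <= e) ->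
  (forall i, (j <= i)%N -> \int[m]_(y in Q j x0) (`|g_ i y - c| `^ rho * u y)%:E <= C)%E ->
  (\int[m]_(y in Q j x0) (`|g y - c| `^ rho * u y)%:E <= C)%E.
Proof.
move=> rho0 mg mg_ mu u0 lf L1 le.
have [phi [phij cv]] := L1_ae_subseq j lf L1.
pose F k y := (`|g_ (phi k) y - c| `^ rho * u y)%:E.
have mF k : measurable_fun (Q j x0) (F k).
  by have := mg_ (phi k) => ?; rewrite /F; apply/measurable_funTS; mfun.
have F0 k y : Q j x0 y -> (0 <= F k y)%E by rewrite lee_fin mulr_ge0// powR_ge0.
apply: (@le_trans _ _ (\int[m]_(y in Q j x0) limn_einf (F^~ y))%E); last first.
  apply: le_trans (fatou m _ mF F0) _ => //.
  by apply: limn_einf_le => k; exact: le.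
apply: ae_ge0_le_integral => //.
- by move=> y _; rewrite lee_fin mulr_ge0// powR_ge0.
- by apply/measurable_funTS; mfun.
- by move=> y Qy; apply: limn_einf_ge0 => k; exact: F0.
- apply: (measurableT_comp (@oppe_measurable _ _)).
  apply: measurable_fun_limn_esup => k.
  by apply: (measurableT_comp (@oppe_measurable _ _)); exact: mF.
apply: filterS cv => y H Qy; have {}H := H Qy.
(* Where the limit vanishes the integrand is 0 because [rho > 0]; elsewhere the power is
   continuous. *)
have [g0|g0] := eqVneq (`|g y - c|) 0.
  rewrite g0 powR0 ?gt_eqF// mul0r.
  by apply: limn_einf_ge0 => k; exact: F0.
have t0 : 0 < `|g y - c| by rewrite lt_neqAle eq_sym g0 normr_ge0.
have cg : `|g_ (phi k) y - c| @[k --> \oo] --> `|g y - c|.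
  apply: cvg_norm; apply: cvgB; last exact: cvg_cst.
  apply/cvgrPdist_le => e e0; move/cvgr0_norm_le: H => /(_ _ e0).
  apply: filterS => k; by rewrite normr_id distrC.
have cF : F k y @[k --> \oo] --> (`|g y - c| `^ rho * u y)%:E.
  apply: cvg_EFin; first exact: nearW.
  by apply: cvgMl; exact: cvg_powR_gt0.
by have [-> _] := cvg_limn_einf_sup cF.
Qed.

End fatou_L1.

(** * Stopping cells and reverse Hoelder inequalities *)

Section stopping.
Context {d} {T : measurableType d} {R : realType}.
Context {m : {sigma_finite_measure set T -> \bar R}} {D : R}.
Variable G : dyadic m D.
Implicit Types (j i : nat) (x y : T) (f g h u v : T -> R) (a b c t : R).
Local Notation Q := (cell G).
Local Notation kap := (kap G).
Local Notation lfin := (lfin G).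
Local Notation S := (cell_int G).
Local Notation av := (cell_av G).
Hint Resolve measurable_cell : core.

Lemma S_gt0 j f x : lfin f -> (forall y, 0 < f y) -> 0 < S j f x.
Proof.
move=> ff f0; rewrite lt_neqAle S_ge0 ?andbT; last by move=> y; exact: ltW.
apply/eqP => /esym S0.
have mf : measurable_fun (Q j x) (fun y => (f y)%:E).
  by apply/measurable_funTS/measurable_EFinP; exact: lfin_meas ff.
have /(ae_eq_integral_abs m (measurable_cell G j x) mf) : (\int[m]_(y in Q j x) `|(f y)%:E| = 0)%E.
  rewrite (eq_integral (fun y => (f y)%:E)); first by rewrite -SE// S0.
  by move=> y _; rewrite gee0_abs// lee_fin ltW.
move=> [N [mN N0 QN]].
have : (m (Q j x) <= m N)%E.
  apply: le_measure; [by rewrite inE; exact: measurable_cell|by rewrite inE|].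
  by move=> y Qy; apply: QN => /(_ Qy) /eqP; rewrite eqe gt_eqF.
by rewrite N0 cell_kap lee_fin leNgt kap_gt0.
Qed.

Lemma av_gt0 j f x : lfin f -> (forall y, 0 < f y) -> 0 < av j f x.
Proof. by move=> ff f0; rewrite av_def divr_gt0 ?kap_gt0//; exact: S_gt0. Qed.

Lemma S_av j f x : S j f x = kap j * av j f x.
Proof. by rewrite av_def mulrC divfK// gt_eqF// kap_gt0. Qed.

Lemma lfin_sum n (f : nat -> T -> R) : (forall k, lfin (f k)) ->
  lfin (fun y => \sum_(k < n) f k y).
Proof.
move=> ff; elim: n => [|n IH].
  by apply: (@eq_lfin _ _ _ _ _ _ (fun=> 0)); [move=> y; rewrite big_ord0|exact: lfin_cst].
apply: (@eq_lfin _ _ _ _ _ _ (fun y => \sum_(k < n) f k y + f n y)); last exact: lfinD.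
by move=> y; rewrite big_ord_recr.
Qed.

Lemma S_sum j n (f : nat -> T -> R) x : (forall k, lfin (f k)) ->
  S j (fun y => \sum_(k < n) f k y) x = \sum_(k < n) S j (f k) x.
Proof.
move=> ff; elim: n => [|n IH].
  by rewrite big_ord0; apply: S_ae0 => y _; rewrite big_ord0.
rewrite big_ord_recr/= -IH -SD//; last exact: lfin_sum.
by apply: eq_S => y _; rewrite big_ord_recr.
Qed.

(* [Om k] is the union of the maximal cells of generation [j + k + 1] below
   [cell j x] over which the average of [psi] exceeds [A]. *)
Lemma stopping j n psi x A : lfin psi -> 0 < A -> av j psi x <= A ->
  exists (Om : nat -> set T) (O0 : set T),
  [/\ forall k, measurable (Om k) /\ saturated G (j + k.+1) (Om k),
      measurable O0,
      forall y, Q j x y -> \1_(~` O0) y = \sum_(k < n) \1_(Om k) y :> R,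
      (forall y, O0 y -> av (j + n) psi y <= A) &
      (forall k y, Q j x y -> Om k y -> av (j + k.+1) psi y <= D * A) /\
      A * S j (\1_(~` O0) : T -> R) x <= S j psi x].
Proof.
move=> fpsi A0 avA.
pose low k := [set y | av (j + k) psi y <= A].
have mlow k : measurable (low k).
  rewrite -[low k]setTI; apply: measurable_fun_le => //.
  exact: measurable_av.
pose Low n := \big[setI/setT]_(k < n) low k.
have LowE n' y : Low n' y <-> forall k, (k < n')%N -> low k y.
  rewrite /Low -bigcap_mkord; split=> [H k kn|H k kn]; exact: H.
have mLow n' : measurable (Low n') by apply: bigsetI_measurable.
(* Generation [j + k + 1] is the first one above the threshold. Since [low 0] holds on the whole
   cell, these disjoint sets exhaust the complement of [Low n.+1] there. *)
pose Om k := Low k.+1 `\` low k.+1.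
have satlow i k : (j + k <= i)%N -> saturated G i (low k).
  move=> ki y z /= Hy yz; rewrite /low/= (@av_cell _ _ _ _ _ G _ _ y)//.
  exact: (@cell_le _ _ _ _ _ G _ i y).
have mOm k : measurable (Om k) by apply: measurableD.
have avz i y z : Q i y z -> av i psi z = av i psi y by exact: av_cell.
have satOm k : saturated G (j + k.+1) (Om k).
  move=> y z [/LowE Ly nly] yz; split.
    apply/LowE => l lk; apply: (satlow (j + k.+1)%N) yz; last exact: Ly.
    by rewrite leq_add2l ltnW// ltnS.
  move=> lz; apply: nly; exact: (satlow _ _ (leqnn _) z y lz (cell_sym yz)).
have part y : Q j x y -> \1_(~` Low n.+1) y = \sum_(k < n) \1_(Om k) y :> R.
  move=> xy; have L0 : low 0%N y by rewrite /low/= addn0 (av_cell _ xy).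
  elim: n => [|n' IH].
    rewrite big_ord0 indicE memNset// => /(_ _)[]; apply/LowE => k.
    by rewrite ltnS leqn0 => /eqP ->.
  rewrite big_ord_recr/= -IH !indicE.
  have [Ln|nLn] := pselect (Low n'.+1 y).
    have [ln|nln] := pselect (low n'.+1 y).
      have Ln2 : Low n'.+2 y.
        by apply/LowE => k; rewrite ltnS leq_eqVlt => /predU1P[->//|/((LowE _ _).1 Ln)].
      by rewrite !memNset ?addr0// => -[]// _.
    rewrite mem_set; last by move/LowE => /(_ _ (ltnSn _)).
    rewrite memNset; last by move=> /(_ Ln).
    by rewrite mem_set ?add0r.
  rewrite mem_set; last first.
    by move/LowE => H; apply: nLn; apply/LowE => k kn; apply: H; rewrite ltnW.
  rewrite mem_set// memNset ?addr0// => -[//].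
exists Om, (Low n.+1); split=> //.
- by move=> y /LowE /(_ n (ltnSn _)).
split.
(* The parent generation is still below the threshold, and passing to a child multiplies an average
   by at most [D]. *)
- move=> k y xy [/LowE /(_ k (ltnSn _)) Lk _].
  rewrite addnS; apply: le_trans (av_child _ _ fpsi) _.
  by rewrite ler_wpM2l// ltW// (D_gt0 G).
have fO k : lfin (\1_(Om k) : T -> R) by exact: lfin_indic.
have fOp k : lfin (fun y => \1_(Om k) y * psi y) by exact: lfin_ind.
rewrite (eq_S (g := fun y => \sum_(k < n) \1_(Om k) y))//.
rewrite (@S_sum _ _ (fun k => \1_(Om k) : T -> R))//.
apply: (@le_trans _ _ (S j (fun y => \sum_(k < n) \1_(Om k) y * psi y) x)); last first.
  apply: le_S => //; first exact: (@lfin_sum _ (fun k y => \1_(Om k) y * psi y)).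
  move=> y xy; rewrite -mulr_suml -part// indicE.
  by case: (_ \in _); rewrite ?mul1r// mul0r (lfin_ge0 fpsi).
rewrite (@S_sum _ _ (fun k y => \1_(Om k) y * psi y))// mulr_sumr; apply: ler_sum => k _.
rewrite (@S_tower_ind _ _ _ _ _ G (j + k.+1)%N)//; last first.
  by rewrite leq_addr.
rewrite -SZ//; last exact: ltW.
apply: le_S.
- by apply: lfinZ => //; exact: ltW.
- by apply: lfin_ind => //; exact: lfin_av.
- move=> y xy; rewrite indicE; have [|_] := boolP (y \in Om k); last by rewrite mulr0 mul0r.
  by rewrite inE => -[_ /negP]; rewrite mulr1 mul1r -ltNge => /ltW.
Qed.

End stopping.

Section reverse_holder.
Context {d} {T : measurableType d} {R : realType}.
Context {m : {sigma_finite_measure set T -> \bar R}} {D : R}.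
Variable G : dyadic m D.
Implicit Types (j i : nat) (x y : T) (f g h u v : T -> R) (a b c t : R).
Local Notation Q := (cell G).
Local Notation kap := (kap G).
Local Notation lfin := (lfin G).
Local Notation S := (cell_int G).
Local Notation av := (cell_av G).
Hint Resolve measurable_cell : core.

Lemma S_split j n (Om : nat -> set T) (B0 : set T) f x :
  (forall k, measurable (Om k)) -> measurable B0 ->
  (forall y, Q j x y -> \1_(~` B0) y = \sum_(k < n) \1_(Om k) y :> R) ->
  lfin f ->
  S j f x = S j (fun y => \1_B0 y * f y) x + \sum_(k < n) S j (fun y => \1_(Om k) y * f y) x.
Proof.
move=> mOm mB0 part ff.
have fO k : lfin (fun y => \1_(Om k) y * f y) by exact: lfin_ind.
rewrite -(@S_sum _ _ _ _ _ _ _ _ (fun k y => \1_(Om k) y * f y))//.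
rewrite -SD; [|exact: lfin_ind|exact: (@lfin_sum _ _ _ _ _ _ _ (fun k y => \1_(Om k) y * f y))].
apply: eq_S => y xy; rewrite -mulr_suml -part//.
rewrite !indicE -mulrDl; have [|] := boolP (y \in B0).
  by rewrite inE => Oy; rewrite memNset ?addr0 ?mul1r//; exact.
by move=> yO; rewrite mem_set ?add0r ?mul1r// => Oy; rewrite mem_set in yO.
Qed.

Lemma lfin_avpow N f u a : 0 <= a -> lfin f -> lfin u -> lfin (fun y => av N f y `^ a * u y).
Proof.
move=> a0 ff fu; apply: lfin_mulb => //.
- by have := measurable_av N ff => ?; mfun.
- by move=> x; exact: powR_ge0.
- move=> x; exists ((D ^+ N * av 0 f x) `^ a) => y xy.
  apply: le_powR => //; first by apply: av_ge0; exact: lfin_ge0 ff.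
  by rewrite -(av_cell f xy); exact: av_bound.
Qed.

(** A quantitative form of the A-infinity condition. The fraction one half is matched by the
    stopping level, twice the average, in the reverse Hoelder inequality. *)
Definition Ainf (th : R) v := forall j x (E : set T), measurable E ->
  2 * S j (\1_E : T -> R) x <= kap j -> S j (fun y => \1_E y * v y) x <= th * S j v x.

(** Stopping at twice the average, the part never stopped is bounded directly. On a stopping cell
    the average is at most [2 * D] times the original one, so induction over the fewer remaining
    generations costs [P], while all these cells together carry only the fraction [th] of the mass.
    Since [th * P < 1], the recursion closes. *)
Lemma reverse_holder_av th ep P : 1 <= D -> 0 < th -> 0 < ep ->
  (2 * D) `^ ep = P -> th * P < 1 ->
  forall v, lfin v -> (forall y, 0 < v y) -> Ainf th v ->
  forall n j x, S j (fun y => av (j + n) v y `^ ep * v y) x <=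
    P / (1 - th * P) * av j v x `^ ep * S j v x.
Proof.
move=> D1 th0 ep0 EP thP v fv v0 Av.
have D0 : 0 < D by exact: lt_le_trans D1.
have P1 : 1 <= P.
  have H : 1 <= 2 * D by lra.
  by have := le_powR (ltW ep0) ler01 H; rewrite powR1 EP.
have [C EC] : exists C, C = P / (1 - th * P) by eexists.
have thP1 : 0 < 1 - th * P by rewrite subr_gt0.
(* [C] is the fixed point of the recursion: [P] from the unstopped part and [C * th * P] from the
   stopping cells. *)
have CE : C = P + C * th * P by rewrite EC; field; rewrite gt_eqF.
have C0 : 0 <= C by rewrite EC divr_ge0 ?(ltW thP1)// -EP powR_ge0.
have C1 : 1 <= C.
  by rewrite EC ler_pdivlMr// mul1r; have := mulr_ge0 (ltW th0) (le_trans ler01 P1); lra.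
rewrite -EC.
elim/ltn_ind => n IH j x.
have a0 i y : 0 < av i v y by exact: av_gt0.
have S0 : 0 <= S j v x by apply: S_ge0; exact: lfin_ge0 fv.
have [->|n0] := posnP n.
  rewrite addn0 (@S_cstl _ _ _ _ _ G j (fun y => av j v y `^ ep)) ?powR_ge0//; last first.
    by move=> y xy; rewrite (av_cell v xy).
  by rewrite -mulrA ler_peMl// mulr_ge0// powR_ge0.
(* At this level the stopping cells fill at most half of the cell, as [Ainf] requires. *)
pose A := 2 * av j v x.
have A0 : 0 < A by rewrite mulr_gt0.
have avA : av j v x <= A by rewrite /A; have := a0 j x; lra.
have [Om [B0 [H1 mB0 part hB0 hh]]] := stopping n fv A0 avA.
have [hOm hE] := hh.
pose F y := av (j + n) v y `^ ep * v y.
have fF : lfin F by apply: lfin_avpow => //; exact: ltW.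
have mOm k : measurable (Om k) by have [] := H1 k.
have fOm k f : lfin f -> lfin (fun y => \1_(Om k) y * f y) by exact: lfin_ind.
rewrite -[leLHS]/(S j F x) (S_split mOm mB0 part fF).
have E0 : S j (fun y => \1_B0 y * F y) x <= A `^ ep * S j v x.
  rewrite -SZ ?powR_ge0//; apply: le_S.
  - exact: lfin_ind.
  - by apply: lfinZ => //; exact: powR_ge0.
  - move=> y xy; rewrite indicE; have [|_] := boolP (y \in B0).
      rewrite inE mul1r => Oy; rewrite /F; apply: ler_wpM2r; first exact: ltW.
      by apply: le_powR; [exact: ltW|exact: ltW|exact: hB0].
    by rewrite mul0r mulr_ge0 ?powR_ge0// ltW.
have Ek (k : 'I_n) : S j (fun y => \1_(Om k) y * F y) x <=
    C * (D * A) `^ ep * S j (fun y => \1_(Om k) y * v y) x.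
  have [_ sk] := H1 k; have jk : (j <= j + k.+1)%N by rewrite leq_addr.
  rewrite (S_tower_ind x jk (mOm k) sk fF) (S_tower_ind x jk (mOm k) sk fv).
  have DA0 : 0 <= (D * A) `^ ep by exact: powR_ge0.
  rewrite -SZ ?mulr_ge0//; last by apply: fOm; exact: lfin_av.
  apply: le_S.
  - by apply: fOm; exact: lfin_av.
  - by apply: lfinZ; [exact: mulr_ge0|apply: fOm; exact: lfin_av].
  - move=> y xy; rewrite indicE; have [|_] := boolP (y \in Om k); last first.
      by rewrite !mul0r mulr0.
    rewrite inE !mul1r => Oy.
    have nk : (n - k.+1 < n)%N by rewrite ltn_subrL.
    have := IH _ nk (j + k.+1)%N y.
    rewrite -addnA subnKC; last by exact: (valP k).
    rewrite -/F => {}IH.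
    rewrite !av_def mulrA ler_pM2r ?invr_gt0 ?kap_gt0//.
    apply: le_trans IH _; rewrite ler_wpM2r//.
      by apply: S_ge0; exact: lfin_ge0 fv.
    rewrite ler_wpM2l//; apply: le_powR; [exact: ltW|exact: ltW|].
    exact: hOm.
apply: (@le_trans _ _ (A `^ ep * S j v x +
   \sum_(k < n) C * (D * A) `^ ep * S j (fun y => \1_(Om k) y * v y) x)).
  by apply: lerD => //; apply: ler_sum => k _; exact: Ek.
rewrite -mulr_sumr.
have -> : \sum_(k < n) S j (fun y => \1_(Om k) y * v y) x = S j (fun y => \1_(~` B0) y * v y) x.
  rewrite -(@S_sum _ _ _ _ _ _ _ _ (fun k y => \1_(Om k) y * v y)); last by move=> k; exact: fOm.
  by apply: eq_S => y xy; rewrite part// mulr_suml.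
have hEv : S j (fun y => \1_(~` B0) y * v y) x <= th * S j v x.
  apply: Av; first exact: measurableC.
  move: hE; rewrite /A [S j v x]S_av mulrAC.
  by rewrite ler_pM2r.
have Pa : (D * A) `^ ep = P * av j v x `^ ep.
  by rewrite /A -EP mulrA (mulrC D) powRM// ltW// mulr_gt0.
have Aa : A `^ ep <= P * av j v x `^ ep.
  rewrite -Pa; apply: le_powR; [exact: ltW|exact: ltW|].
  by rewrite ler_peMl// ltW.
apply: (@le_trans _ _ (P * av j v x `^ ep * S j v x +
   C * (P * av j v x `^ ep) * (th * S j v x))).
  apply: lerD; first by rewrite ler_wpM2r.
  rewrite Pa; apply: ler_wpM2l => //.
  by apply: mulr_ge0 => //; apply: mulr_ge0; [exact: le_trans P1|exact: powR_ge0].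
rewrite [in leRHS]CE.
by rewrite le_eqVlt; apply/orP; left; apply/eqP; ring.
Qed.

End reverse_holder.

Section uniform_reverse_holder.
Context {d} {T : measurableType d} {R : realType}.
Context {m : {sigma_finite_measure set T -> \bar R}} {D : R}.
Implicit Types (G : dyadic m D) (j i : nat) (x y : T) (b f g h u v mu lam : T -> R) (a t : R).
Local Notation Q := cell.
Local Notation S := cell_int.
Local Notation av := cell_av.
Hint Resolve measurable_cell : core.

(** The extra power [v ^ ep] is approximated by powers of averages, integrated against [v]; the
    bound of [reverse_holder_av] does not depend on the number of generations, so [fatou_L1]
    applies. *)
Lemma reverse_holder th : 1 <= D -> 0 < th < 1 -> exists ep C,
  [/\ 0 < ep, 0 < C & forall G v, lfin G v -> (forall y, 0 < v y) -> Ainf G th v ->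
   lfin G (fun y => v y `^ (1 + ep)) /\
   forall j x, av G j (fun y => v y `^ (1 + ep)) x <= C * av G j v x `^ (1 + ep)].
Proof.
move=> D1 /andP[th0 th1].
have D2 : 1 < 2 * D by lra.
(* Chosen so that [th * (2 * D) ^ ep] is the midpoint [(1 + th) / 2] of [th] and 1. *)
pose ep := ln ((1 + th) / (2 * th)) / ln (2 * D).
have q1 : 1 < (1 + th) / (2 * th) by rewrite ltr_pdivlMr ?mulr_gt0//; lra.
have ep0 : 0 < ep by rewrite divr_gt0// ln_gt0.
have PE : (2 * D) `^ ep = (1 + th) / (2 * th).
  rewrite /powR gt_eqF; last by lra.
  rewrite /ep divfK ?lnK ?gt_eqF ?ln_gt0//.
  by rewrite posrE (lt_trans ltr01).
have thP : th * (2 * D) `^ ep < 1.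
  rewrite PE [X in X < _](_ : _ = (1 + th) / 2); first by lra.
  by field; rewrite gt_eqF.
exists ep, ((2 * D) `^ ep / (1 - th * (2 * D) `^ ep)); split=> //.
  by rewrite divr_gt0 ?subr_gt0// powR_gt0; lra.
move=> G v fv v0 Av; have a0 i y : 0 < av G i v y by exact: av_gt0.
set C := _ / _.
have C0 : 0 <= C by rewrite divr_ge0 ?powR_ge0// subr_ge0 ltW.
have mv := lfin_meas fv.
have epv y : v y `^ (1 + ep) = `|v y - 0| `^ ep * v y.
  rewrite subr0 gtr0_norm// powRD; last by rewrite (gt_eqF (v0 y)) implybT.
  by rewrite powRr1 ?(ltW (v0 y))// mulrC.
have lim j x : (\int[m]_(y in Q G j x) (v y `^ (1 + ep))%:E <=
   (C * av G j v x `^ ep * S G j v x)%:E)%E.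
  rewrite (eq_integral (fun y => (`|v y - 0| `^ ep * v y)%:E)); last by move=> y _; rewrite epv.
  apply: (@fatou_L1 _ _ _ _ _ G (fun i => av G i v) v v x j) => //.
  - by move=> i; exact: measurable_av.
  - by move=> y; exact: ltW.
  - by move=> i; apply: lfin_dist => //; exact: lfin_av.
  - exact: (@levy_all _ _ _ _ _ G x).
  - move=> i /subnKC <-.
    have fF := lfin_avpow (j + (i - j))%N (ltW ep0) fv fv.
    rewrite (eq_integral (fun y => (av G (j + (i - j)) v y `^ ep * v y)%:E)); last first.
      by move=> y _; rewrite subr0 ger0_norm// ltW.
    by rewrite -SE// lee_fin; exact: (reverse_holder_av D1 th0 ep0 erefl thP fv v0 Av).
have lf : lfin G (fun y => v y `^ (1 + ep)).
  split=> [|y|x]; first by mfun.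
    exact: powR_ge0.
  by apply: le_lt_trans (lim 0%N x) _; rewrite ltry.
split=> // j x; have := lim j x; rewrite -SE// lee_fin => le.
rewrite av_def ler_pdivrMr ?kap_gt0//; apply: le_trans le _.
rewrite S_av powRD; last by rewrite (gt_eqF (a0 j x)) implybT.
rewrite powRr1 ?(ltW (a0 _ _))// le_eqVlt; apply/orP; left; apply/eqP; ring.
Qed.

End uniform_reverse_holder.

(** Both terms are bounded by the larger one, which serves exponents below and above 1 alike. *)
Lemma powRD_le (R : realType) (u v r : R) : 0 <= r -> 0 <= u -> 0 <= v ->
  (u + v) `^ r <= 2 `^ r * (u `^ r + v `^ r).
Proof.
move=> r0 u0 v0; wlog uv : u v u0 v0 / u <= v.
  move=> H; have [uv|/ltW vu] := leP u v; first exact: H.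
  by rewrite addrC [X in _ <= _ * X]addrC; exact: H.
apply: (@le_trans _ _ ((2 * v) `^ r)).
  by apply: le_powR => //; [exact: addr_ge0|lra].
by rewrite powRM// ler_wpM2l ?powR_ge0// lerDr powR_ge0.
Qed.

(** Below [s] the last term suffices, above [s] the first one. This linearizes a concave power of an
    average, which can then be summed over stopping cells. *)
Lemma powR_young (R : realType) (g s t : R) : 0 < t < 1 -> 0 < s -> 0 <= g ->
  g `^ t <= s `^ (t - 1) * g + s `^ t.
Proof.
move=> /andP[t0 t1] s0 g0; have [gs|sg] := leP g s.
  have := le_powR (ltW t0) g0 gs.
  have := mulr_ge0 (powR_ge0 s (t - 1)) g0; lra.
have g1 : 0 < g by exact: lt_trans sg.
have -> : g `^ t = g `^ (t - 1) * g.
  by rewrite -[X in _ * X]powRr1// -powRD ?subrK// (gt_eqF g1) implybT.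
have : g `^ (t - 1) <= s `^ (t - 1).
  rewrite -(opprB 1 t) !powRN lef_pV2 ?posrE ?powR_gt0//.
  by apply: le_powR; [lra|exact: ltW|exact: ltW].
have := powR_ge0 s t; nra.
Qed.

(** * Oscillations *)

Section oscillation.
Context {d} {T : measurableType d} {R : realType}.
Context {m : {sigma_finite_measure set T -> \bar R}} {D : R}.
Variable G : dyadic m D.
Implicit Types (j i : nat) (x y : T) (b f g h u v : T -> R) (a c t : R).
Local Notation Q := (cell G).
Local Notation lfin := (lfin G).
Local Notation S := (cell_int G).
Local Notation av := (cell_av G).
Hint Resolve measurable_cell : core.

(** The average of a signed function; [cell_av] is only controlled on nonnegative ones, hence the
    two parts. *)
Definition mean i b x : R :=
  av i (fun y => Num.max (b y) 0) x - av i (fun y => Num.max (- b y) 0) x.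

Definition labs b := measurable_fun setT b /\ lfin (fun y => `|b y|).

Lemma labs_pos b : labs b -> lfin (fun y => Num.max (b y) 0).
Proof.
move=> [mb fb]; apply: lfin_le fb; first by mfun.
by move=> y; rewrite le_max lexx orbT ge_max ler_norm normr_ge0.
Qed.

Lemma labsN b : labs b -> labs (fun y => - b y).
Proof.
move=> [mb fb]; split; first exact: measurable_funN.
by apply: eq_lfin fb => y; rewrite normrN.
Qed.

Lemma labs_neg b : labs b -> lfin (fun y => Num.max (- b y) 0).
Proof. by move=> /labsN; exact: labs_pos. Qed.

Lemma labsB b c : labs b -> labs (fun y => b y - c).
Proof.
move=> [mb fb]; split; first by mfun.
apply: (lfin_le _ _ (lfinD fb (lfin_cst _ (normr_ge0 c)))); first by mfun.
by move=> y; rewrite normr_ge0 ler_normB.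
Qed.

Lemma mean_cell i b x y : Q i x y -> mean i b y = mean i b x.
Proof. by move=> xy; rewrite /mean !(av_cell _ xy). Qed.

Lemma measurable_mean i b : labs b -> measurable_fun setT (mean i b).
Proof.
move=> fb; apply: measurable_funB; apply: measurable_av.
  exact: labs_pos. exact: labs_neg.
Qed.

Lemma mean_dist i b c x : labs b ->
  `|mean i b x - c| <= av i (fun y => `|b y - c|) x.
Proof.
move=> fb; have fp := labs_pos fb; have fn := labs_neg fb.
have fbc := labsB c fb; have [mb fbc'] := fbc.
have c1 : 0 <= Num.max c 0 by rewrite le_max lexx orbT.
have c2 : 0 <= Num.max (- c) 0 by rewrite le_max lexx orbT.
have maxE (z : R) : z = Num.max z 0 - Num.max (- z) 0.
  by have [z0|z0] := leP z 0; have [z1|z1] := leP (- z) 0; lra.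
(* Additivity and monotonicity of averages are available for nonnegative functions only, so the
   parts of [b] and of [c] are distributed over the two sides until nothing is subtracted. *)
have key f g (u w : R) : lfin f -> lfin g -> 0 <= u -> 0 <= w ->
    (forall y, f y + u <= g y + w + `|b y - c|) ->
    av i f x + u <= av i g x + w + av i (fun y => `|b y - c|) x.
  move=> ff fg u0 w0 le.
  have fu := lfin_cst G u0; have fw := lfin_cst G w0.
  have := @le_av _ _ _ _ _ G i (fun y => f y + u) (fun y => (g y + w) + `|b y - c|) x.
  rewrite avD// avD//; last exact: lfinD.
  rewrite avD// !av_cst; apply; first exact: lfinD.
    by apply: lfinD => //; exact: lfinD.
  by move=> y _; exact: le.
have H1 := key _ _ _ _ fp fn c2 c1; have H2 := key _ _ _ _ fn fp c1 c2.
rewrite /mean ler_norml.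
have {}H1 : av i (fun y => Num.max (b y) 0) x + Num.max (- c) 0 <=
    av i (fun y => Num.max (- b y) 0) x + Num.max c 0 + av i (fun y => `|b y - c|) x.
  apply: H1 => y; have := maxE (b y); have := maxE c; have := ler_norm (b y - c); lra.
have {}H2 : av i (fun y => Num.max (- b y) 0) x + Num.max c 0 <=
    av i (fun y => Num.max (b y) 0) x + Num.max (- c) 0 + av i (fun y => `|b y - c|) x.
  apply: H2 => y; have := maxE (b y); have := maxE c; have := ler_norm (c - b y).
  rewrite distrC; lra.
by apply/andP; have := maxE c; split; lra.
Qed.

Lemma mean_abs_le i b x : labs b -> `|mean i b x| <= D ^+ i * av 0 (fun y => `|b y|) x.
Proof.
move=> fb; have [_ fb'] := fb; have := mean_dist i 0 x fb.
rewrite subr0 => /le_trans; apply.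
rewrite (eq_av (g := fun y => `|b y|)); last by move=> y _; rewrite subr0.
exact: av_bound.
Qed.

(** [levy_all] for the positive and the negative part, each contributing half of the error. *)
Lemma mean_L1 b x0 : labs b ->
  (forall i, lfin (fun y => `|mean i b y - b y|)) /\
  (forall e, 0 < e -> exists N, forall i, (N <= i)%N ->
     S 0 (fun y => `|mean i b y - b y|) x0 <= e).
Proof.
move=> fb; have fp := labs_pos fb; have fn := labs_neg fb; have [mb _] := fb.
pose dp i y := `|av i (fun y => Num.max (b y) 0) y - Num.max (b y) 0|.
pose dn i y := `|av i (fun y => Num.max (- b y) 0) y - Num.max (- b y) 0|.
have fdp i : lfin (dp i) by apply: lfin_dist => //; exact: lfin_av.
have fdn i : lfin (dn i) by apply: lfin_dist => //; exact: lfin_av.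
have le i y : `|mean i b y - b y| <= dp i y + dn i y.
  have maxE (z : R) : z = Num.max z 0 - Num.max (- z) 0.
    by have [z0|z0] := leP z 0; have [z1|z1] := leP (- z) 0; lra.
  rewrite /mean [X in _ - _ - X]maxE /dp /dn -[X in _ <= _ + X]normrN.
  by apply: le_trans (ler_normD _ _); rewrite le_eqVlt; apply/orP; left; apply/eqP; congr `|_|; ring.
have fd i : lfin (fun y => `|mean i b y - b y|).
  apply: (lfin_le _ _ (lfinD (fdp i) (fdn i))).
    by have := measurable_mean i fb => ?; mfun.
  by move=> y; rewrite normr_ge0 le.
split=> // e e0; have e20 : 0 < e / 2 by lra.
have [N1 H1] := levy_all x0 fp e20; have [N2 H2] := levy_all x0 fn e20.
exists (maxn N1 N2) => i; rewrite geq_max => /andP[/H1 {}H1 /H2 {}H2].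
apply: (@le_trans _ _ (S 0 (fun y => dp i y + dn i y) x0)).
  by apply: le_S => //; exact: lfinD.
by rewrite SD//; have : S 0 (dp i) x0 <= e / 2 := H1; have : S 0 (dn i) x0 <= e / 2 := H2; lra.
Qed.

End oscillation.

Section oscillation_bound.
Context {d} {T : measurableType d} {R : realType}.
Context {m : {sigma_finite_measure set T -> \bar R}} {D : R}.
Variable G : dyadic m D.
Implicit Types (j i : nat) (x y : T) (b f g h u v : T -> R) (a t : R).
Local Notation kap := (kap G).
Local Notation lfin := (lfin G).
Local Notation labs := (labs G).
Local Notation mean := (mean G).
Local Notation S := (cell_int G).
Local Notation av := (cell_av G).
Hint Resolve measurable_cell : core.

Lemma lfin_mean_pow N b c sg rho : 0 <= rho -> labs b -> lfin sg ->
  lfin (fun y => `|mean N b y - c| `^ rho * sg y).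
Proof.
move=> r0 fb fs; apply: lfin_mulb => //.
- by have := measurable_mean N fb => ?; mfun.
- move=> x; exists ((D ^+ N * av 0 (fun y => `|b y|) x + `|c|) `^ rho) => y xy.
  apply: le_powR => //; apply: le_trans (ler_normB _ _) _; rewrite lerD2r.
  by rewrite -(av_cell _ xy); exact: mean_abs_le.
Qed.

(** Stop where the average of [|b - mean|] exceeds [a * c]. Unstopped points are bounded directly;
    on a stopping cell the triangle inequality separates the jump of the means, at most [D * A],
    from the oscillation inside, which is covered by induction. The inner terms [kap * (av Y) ^ t]
    are summed after linearizing at the scale [a * av Y]: both resulting terms carry [a ^ (t - 1)],
    whose prescribed value offsets the loss [P]. *)
Lemma osc_av rho t P a : 1 <= D -> 0 < rho -> 0 < t < 1 -> 2 `^ rho = P -> 1 <= a ->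
  a `^ (t - 1) = (4 * P)^-1 ->
  forall b sg Y (c : nat -> T -> R), labs b -> lfin sg -> (forall y, 0 < sg y) ->
  lfin Y -> (forall y, 0 < Y y) -> (forall j x, 0 < c j x) ->
  (forall j x, av j (fun y => `|b y - mean j b x|) x <= c j x) ->
  (forall j x, c j x `^ rho * S j sg x <= kap j * av j Y x `^ t) ->
  forall n j x, S j (fun y => `|mean (j + n) b y - mean j b x| `^ rho * sg y) x <=
    2 * (P * (D * a) `^ rho) * (kap j * av j Y x `^ t).
Proof.
move=> D1 rho0 t01 EP a1 aP b sg Y c fb fs s0 fY Y0 c0 bc cY.
have [t0 t1] := andP t01.
have D0 : 0 < D by exact: lt_le_trans D1.
have a0 : 0 < a by exact: lt_le_trans a1.
have P1 : 1 <= P.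
  have H : 1 <= 2 :> R by lra.
  by have := le_powR (ltW rho0) ler01 H; rewrite powR1 EP.
have P0 : 0 < P by exact: lt_le_trans P1.
have M0 : 0 <= P * (D * a) `^ rho by rewrite mulr_ge0 ?(ltW P0)// powR_ge0.
elim/ltn_ind => n IH j x.
have avY0 i y : 0 < av i Y y by exact: av_gt0.
have k0 i : 0 < kap i by exact: kap_gt0.
have [->|n0] := posnP n.
  rewrite addn0 S_ae0; last first.
    by move=> y xy; rewrite (mean_cell _ xy) subrr normr0 powR0 ?gt_eqF// mul0r.
  by rewrite !mulr_ge0// ?powR_ge0// ltW.
have [be Ebe] : exists be, be = mean j b x by eexists.
rewrite -Ebe.
have [A EA] : exists A, A = a * c j x by eexists.
have A0 : 0 < A by rewrite EA mulr_gt0.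
have [mb fpsi] := labsB be fb.
have avc : av j (fun y => `|b y - be|) x <= c j x by rewrite Ebe.
have avA : av j (fun y => `|b y - be|) x <= A.
  by apply: le_trans avc _; rewrite EA ler_peMl// ltW.
have [Om [B0 [H1 mB0 part hB0 hh]]] := stopping n fpsi A0 avA.
have [hOm hE] := hh.
have mOm k : measurable (Om k) by have [] := H1 k.
have fOm k f : lfin f -> lfin (fun y => \1_(Om k) y * f y) by exact: lfin_ind.
have DA0 : 0 <= (D * A) `^ rho by exact: powR_ge0.
have PDA0 : 0 <= P * (D * A) `^ rho by rewrite mulr_ge0// ltW.
have fF i c' : lfin (fun y => `|mean i b y - c'| `^ rho * sg y).
  by apply: lfin_mean_pow => //; exact: ltW.
rewrite (S_split mOm mB0 part (fF (j + n)%N be)).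
have E0 : S j (fun y => \1_B0 y * (`|mean (j + n) b y - be| `^ rho * sg y)) x <=
    S j (fun y => \1_B0 y * (P * (D * A) `^ rho * sg y)) x.
  apply: le_S; try (apply: lfin_ind => //; exact: lfinZ).
  move=> y xy; rewrite indicE; have [|_] := boolP (y \in B0); last by rewrite !mul0r.
  rewrite inE !mul1r => By; apply: ler_wpM2r; first exact: ltW.
  apply: (@le_trans _ _ ((D * A) `^ rho)); last by rewrite ler_peMl.
  apply: le_powR; [exact: ltW|exact: normr_ge0|].
  apply: le_trans (mean_dist _ _ _ fb) _; apply: le_trans (hB0 _ By) _.
  by rewrite ler_peMl// ltW.
pose Fk (k : nat) y := `|mean (j + n) b y - mean (j + k.+1) b y| `^ rho * sg y.
have fFk k : lfin (Fk k).
  apply: lfin_mulb => //.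
  - have m1 := measurable_mean (j + n) fb; have m2 := measurable_mean (j + k.+1) fb.
    by mfun.
  - move=> z; exists ((D ^+ (j + n) * av 0 (fun y => `|b y|) z + D ^+ (j + k.+1) * av 0 (fun y => `|b y|) z) `^ rho) => y xy.
    apply: le_powR; [exact: ltW|exact: normr_ge0|].
    apply: le_trans (ler_normB _ _) _.
    by rewrite -(av_cell _ xy) lerD// mean_abs_le.
have [C EC] : exists C, C = 2 * (P * (D * a) `^ rho) by eexists.
have C0 : 0 <= C by rewrite EC mulr_ge0.
rewrite -EC.
(* With this scale the linear term in [Y] and the measure of the stopping cells, at most [kap / a],
   contribute equally. *)
have [s Es] : exists s, s = a * av j Y x by eexists.
have s0' : 0 < s by rewrite Es mulr_gt0.
have lc0 (z : R) : 0 < z -> 0 <= z `^ (t - 1) by move=> _; exact: powR_ge0.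
have Ek (k : 'I_n) : S j (fun y => \1_(Om k) y * (`|mean (j + n) b y - be| `^ rho * sg y)) x <=
    S j (fun y => \1_(Om k) y * (P * (D * A) `^ rho * sg y)) x +
    P * (C * (s `^ (t - 1) * S j (fun y => \1_(Om k) y * Y y) x + s `^ t * S j (\1_(Om k) : T -> R) x)).
  have [_ sk] := H1 k; have jk : (j <= j + k.+1)%N by rewrite leq_addr.
  apply: (@le_trans _ _ (S j (fun y => \1_(Om k) y * (P * (D * A) `^ rho * sg y)) x +
     P * S j (fun y => \1_(Om k) y * Fk k y) x)).
    rewrite -SZ ?(ltW P0)//; last exact: fOm.
    rewrite -SD; [|by apply: fOm; exact: lfinZ|by apply: lfinZ; [exact: ltW|exact: fOm]].
    apply: le_S; first exact: fOm.
      by apply: lfinD; [by apply: fOm; exact: lfinZ|by apply: lfinZ; [exact: ltW|exact: fOm]].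
    move=> y xy; rewrite indicE; have [|_] := boolP (y \in Om k); last first.
      by rewrite !mul0r mulr0 addr0.
    rewrite inE !mul1r => Oy; rewrite /Fk mulrA -mulrDl; apply: ler_wpM2r; first exact: ltW.
    have tri : `|mean (j + n) b y - be| <= `|mean (j + n) b y - mean (j + k.+1) b y| + D * A.
      apply: le_trans (ler_distD (mean (j + k.+1) b y) _ _) _; rewrite lerD2l.
      by apply: le_trans (mean_dist _ _ _ fb) _; exact: hOm.
    apply: le_trans (le_powR (ltW rho0) (normr_ge0 _) tri) _.
    apply: le_trans (powRD_le (ltW rho0) (normr_ge0 _) _) _.
      by rewrite mulr_ge0// ltW.
    by rewrite EP; lra.
  rewrite lerD2l ler_wpM2l ?(ltW P0)//.
  rewrite (S_tower_ind x jk (mOm k) sk (fFk k)) (S_tower_ind x jk (mOm k) sk fY).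
  have sc0 : 0 <= s `^ (t - 1) by exact: powR_ge0.
  have st0 : 0 <= s `^ t by exact: powR_ge0.
  have f1 : lfin (fun y => \1_(Om k) y * av (j + k.+1) Y y) by apply: fOm; exact: lfin_av.
  have f2 : lfin (\1_(Om k) : T -> R) by exact: lfin_indic.
  rewrite -SZ// -[s `^ t * _]SZ// -SD; [|exact: lfinZ|exact: lfinZ].
  rewrite -SZ//; last by apply: lfinD; exact: lfinZ.
  apply: le_S.
  - by apply: fOm; exact: lfin_av.
  - by apply: lfinZ => //; apply: lfinD; exact: lfinZ.
  - move=> y xy; rewrite indicE; have [|_] := boolP (y \in Om k); last first.
      by rewrite !mul0r !mulr0 addr0 mulr0.
    rewrite inE !mul1r mulr1 => Oy.
    have nk : (n - k.+1 < n)%N by rewrite ltn_subrL.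
    have := IH _ nk (j + k.+1)%N y.
    rewrite -addnA subnKC; last by exact: (valP k).
    rewrite -EC => {}IH.
    have IH' : av (j + k.+1) (Fk k) y <= C * av (j + k.+1) Y y `^ t.
      rewrite av_def ler_pdivrMr//; apply: le_trans (le_trans _ IH) _.
        rewrite le_eqVlt; apply/orP; left; apply/eqP.
        by apply: eq_S => z yz; rewrite /Fk (mean_cell _ yz).
      by rewrite le_eqVlt; apply/orP; left; apply/eqP; ring.
    apply: le_trans IH' _; apply: ler_wpM2l => //.
    exact: (powR_young t01 s0' (ltW (avY0 _ _))).
apply: (@le_trans _ _ (S j (fun y => \1_B0 y * (P * (D * A) `^ rho * sg y)) x +
  \sum_(k < n) (S j (fun y => \1_(Om k) y * (P * (D * A) `^ rho * sg y)) x +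
    P * (C * (s `^ (t - 1) * S j (fun y => \1_(Om k) y * Y y) x + s `^ t * S j (\1_(Om k) : T -> R) x))))).
  by apply: lerD => //; apply: ler_sum => k _; exact: Ek.
rewrite big_split/= addrA.
rewrite -(S_split mOm mB0 part (lfinZ PDA0 fs)).
rewrite -mulr_sumr -mulr_sumr big_split/= -!mulr_sumr.
have -> : \sum_(k < n) S j (\1_(Om k) : T -> R) x = S j (\1_(~` B0) : T -> R) x.
  rewrite -(@S_sum _ _ _ _ _ _ _ _ (fun k => \1_(Om k) : T -> R)); last by move=> k; exact: lfin_indic.
  by apply: eq_S => y xy; rewrite part.
have sumY : \sum_(k < n) S j (fun y => \1_(Om k) y * Y y) x <= kap j * av j Y x.
  rewrite -S_av (S_split mOm mB0 part fY) lerDr; apply: S_ge0 => y.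
  by rewrite mulr_ge0// ltW.
(* Chebyshev: the threshold is [a] times the bound [c] for the average being stopped. *)
have sumE : S j (\1_(~` B0) : T -> R) x <= kap j / a.
  rewrite ler_pdivlMr// mulrC -(ler_pM2l (c0 j x)) mulrA (mulrC _ a) -EA.
  apply: le_trans hE _; rewrite S_av mulrC; apply: ler_wpM2r => //.
  exact: ltW.
have h1 : S j (fun y => P * (D * A) `^ rho * sg y) x <= P * (D * a) `^ rho * (kap j * av j Y x `^ t).
  rewrite SZ// EA mulrA powRM ?mulr_ge0 ?(ltW D0) ?(ltW a0) ?(ltW (c0 _ _))//.
  rewrite -[leLHS]mulrA -[leRHS]mulrA.
  apply: ler_wpM2l; first exact: ltW.
  by rewrite -[leLHS]mulrA; apply: ler_wpM2l; [exact: powR_ge0|exact: cY].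
have sE : s `^ (t - 1) = (4 * P)^-1 * av j Y x `^ (t - 1).
  by rewrite Es powRM ?(ltW a0) ?(ltW (avY0 _ _))// aP.
have pE (z : R) : 0 < z -> z `^ t = z * z `^ (t - 1).
  move=> z0; have := @powRD R z 1 (t - 1); rewrite (gt_eqF z0) implybT powRr1 ?ltW//.
  by move=> /(_ isT) <-; rewrite addrC subrK.
(* Multiplied by [P * C] this is half of the claimed bound; the direct part [h1] supplies the other
   half, because [C] is twice its constant. *)
have h2 : s `^ (t - 1) * (\sum_(k < n) S j (fun y => \1_(Om k) y * Y y) x) +
    s `^ t * S j (\1_(~` B0) : T -> R) x <= 2 * (4 * P)^-1 * (kap j * av j Y x `^ t).
  have -> : 2 * (4 * P)^-1 * (kap j * av j Y x `^ t) =
    s `^ (t - 1) * (kap j * av j Y x) + s `^ t * (kap j / a).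
    rewrite (pE s)// (pE (av j Y x))// sE Es.
    by field; rewrite ?gt_eqF.
  by apply: lerD; apply: ler_wpM2l => //; exact: powR_ge0.
have h3 := ler_wpM2l (ltW P0) (ler_wpM2l C0 h2).
apply: le_trans (lerD h1 h3) _.
rewrite le_eqVlt; apply/orP; left; apply/eqP; rewrite EC.
by field; rewrite gt_eqF.
Qed.

End oscillation_bound.

Section uniform_oscillation.
Context {d} {T : measurableType d} {R : realType}.
Context {m : {sigma_finite_measure set T -> \bar R}} {D : R}.
Implicit Types (G : dyadic m D) (j i : nat) (x y : T) (b f g h u v mu lam : T -> R) (a t : R).
Local Notation Q := cell.
Local Notation S := cell_int.
Local Notation av := cell_av.
Hint Resolve measurable_cell : core.

Lemma osc_bound rho t : 1 <= D -> 0 < rho -> 0 < t < 1 -> exists C, 0 < C /\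
  forall G b sg Y (c : nat -> T -> R), labs G b -> lfin G sg -> (forall y, 0 < sg y) ->
  lfin G Y -> (forall y, 0 < Y y) -> (forall j x, 0 < c j x) ->
  (forall j x, av G j (fun y => `|b y - mean G j b x|) x <= c j x) ->
  (forall j x, c j x `^ rho * S G j sg x <= kap G j * av G j Y x `^ t) ->
  forall j x, (\int[m]_(y in Q G j x) (`|b y - mean G j b x| `^ rho * sg y)%:E <=
    (C * (kap G j * av G j Y x `^ t))%:E)%E.
Proof.
move=> D1 rho0 t01; have [t0 t1] := andP t01.
have D0 : 0 < D by exact: lt_le_trans D1.
have [P EP] : exists P, 2 `^ rho = P :> R by eexists.
have P1 : 1 <= P.
  have H : 1 <= 2 :> R by lra.
  by have := le_powR (ltW rho0) ler01 H; rewrite powR1 EP.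
(* The solution of [a ^ (t - 1) = (4 * P)^-1]; it exists because [t < 1]. *)
pose a := (4 * P) `^ (1 - t)^-1.
have P4 : 1 <= 4 * P by lra.
have a1 : 1 <= a.
  have t1' : 0 <= (1 - t)^-1 by rewrite invr_ge0; lra.
  by have := le_powR t1' ler01 P4; rewrite powR1.
have aP : a `^ (t - 1) = (4 * P)^-1.
  rewrite /a -powRrM -(opprB 1 t) mulrN mulVf; last by rewrite subr_eq0 gt_eqF.
  by rewrite powR_inv1//; lra.
exists (2 * (P * (D * a) `^ rho)); split.
  have a0 : 0 < a by exact: lt_le_trans a1.
  have Da : 0 < D * a by rewrite mulr_gt0.
  by rewrite mulr_gt0// mulr_gt0 ?powR_gt0// (lt_le_trans _ P1).
move=> G b sg Y c fb fs s0 fY Y0 c0 bc cY j x; have [mb _] := fb.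
have [l1 l2] := mean_L1 x fb.
apply: (@fatou_L1 _ _ _ _ _ G (fun i => mean G i b) b sg x j) => //.
- by move=> i; exact: measurable_mean.
- exact: lfin_meas fs.
- by move=> y; exact: ltW.
- move=> i /subnKC <-.
  rewrite -SE ?lee_fin; last by apply: lfin_mean_pow => //; exact: ltW.
  exact: (@osc_av _ _ _ _ _ G rho t P a _ _ _ _ _ _ b sg Y c).
Qed.

End uniform_oscillation.

Section single_cube.
Context {d} {T : measurableType d} {R : realType}.
Context {m : {sigma_finite_measure set T -> \bar R}} {D : R}.
Variable G : dyadic m D.
Implicit Types (j i : nat) (x y : T) (b f g h u v mu lam : T -> R) (a t : R).
Local Notation kap := (kap G).
Local Notation lfin := (lfin G).
Local Notation S := (cell_int G).
Local Notation av := (cell_av G).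
Local Notation Nm := (cell_Nm G).
Hint Resolve measurable_cell : core.

(* With [a1 = p'] and [a2 = q] this is A_(p,q); in this form it is invariant under
   [mu := mu^-1] and [a1 <-> a2], which exchanges the two halves of the bilinear
   form. *)
Definition dyadic_Apq a1 a2 (K : R) mu :=
  [/\ measurable_fun setT mu, (forall y, 0 < mu y),
      lfin (fun y => mu y `^ a2), lfin (fun y => (mu y)^-1 `^ a1) &
      forall j x, Nm a2 j mu x * Nm a1 j (fun y => (mu y)^-1) x <= K].

(** On positive values the inverse is the real power with exponent [- 1]. *)
Lemma measurable_inv mu : measurable_fun setT mu -> (forall y, 0 < mu y) ->
  measurable_fun setT (fun y => (mu y)^-1).
Proof.
move=> mm m0; rewrite (_ : (fun y => _) = fun y => mu y `^ (- 1)); first by mfun.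
by apply/funext => y; rewrite powR_inv1// ltW.
Qed.

Lemma Aw_inv a1 a2 K mu : dyadic_Apq a1 a2 K mu -> dyadic_Apq a2 a1 K (fun y => (mu y)^-1).
Proof.
move=> [mm m0 f1 f2 H]; split.
- exact: measurable_inv.
- by move=> y; rewrite invr_gt0.
- exact: f2.
- by apply: eq_lfin f1 => y; rewrite invrK.
- move=> j x; rewrite mulrC (_ : (fun y => (mu y)^-1^-1) = mu)//.
  by apply/funext => y; rewrite invrK.
Qed.

(** The complement of [E] fills at least half of the cell. Writing its indicator as a product with
    [mu^-1 * mu], Hoelder and the weight condition bound the mass of the complement below by the
    fraction [(2 * K)^-1 ^ a1]; the rest is what [E] can carry. *)
Lemma Aw_Ainf a1 a2 K mu : 1 < a1 -> 1 < a2 -> a1^-1 + a2^-1 < 1 -> 1 <= K ->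
  dyadic_Apq a1 a2 K mu ->
  Ainf G (1 - ((2 * K)^-1) `^ a1) (fun y => (mu y)^-1 `^ a1).
Proof.
move=> a11 a21 a12 K1 [mm m0 f1 f2 H] j x E mE hE.
have a10 : 0 < a1 by exact: lt_trans a11.
have a20 : 0 < a2 by exact: lt_trans a21.
have K0 : 0 < K by exact: lt_le_trans K1.
have K20 : 0 <= (2 * K)^-1 by rewrite invr_ge0 mulr_ge0// ltW.
have mi := measurable_inv mm m0.
pose v y := (mu y)^-1 `^ a1.
have mF := measurableC mE.
have v0 y : 0 < v y by rewrite powR_gt0// invr_gt0.
have fE := lfin_indic G mE; have fF := lfin_indic G mF.
have fEv : lfin (fun y => \1_E y * v y) by exact: lfin_ind.
have fFv : lfin (fun y => \1_(~` E) y * v y) by exact: lfin_ind.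
have one y : \1_E y + \1_(~` E) y = 1 :> R.
  rewrite !indicE; have [yA|yA] := boolP (y \in E).
    by rewrite inE in yA; rewrite memNset ?addr0// => /(_ yA).
  by rewrite mem_set ?add0r// => Ay; rewrite mem_set in yA.
have Sv : S j v x = S j (fun y => \1_E y * v y) x + S j (fun y => \1_(~` E) y * v y) x.
  by rewrite -SD//; apply: eq_S => y _; rewrite -mulrDl one mul1r.
have S1 : kap j = S j (\1_E : T -> R) x + S j (\1_(~` E) : T -> R) x.
  rewrite -SD// (eq_S (g := fun=> 1)); last by move=> y _; rewrite one.
  by rewrite S_cst mul1r.
have k0 := kap_gt0 G j.
have half : 2^-1 <= av j (\1_(~` E) : T -> R) x.
  by rewrite av_def ler_pdivlMr//; lra.
(* The exponent conjugate to [a1]. It is at most [a2] because [a1^-1 + a2^-1 < 1], so its norm of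
   [mu] is dominated by the one in the weight condition. *)
pose c1 := (1 - a1^-1)^-1.
have a1i : a1^-1 < 1 by rewrite invf_lt1.
have c10 : 0 < c1 by rewrite invr_gt0 subr_gt0.
have c1a : c1 <= a2.
  rewrite /c1 invf_ple ?posrE ?subr_gt0//; lra.
have [fc1 Nc1] := Nm_le j x c10 c1a mm (fun y => ltW (m0 y)) f1.
have powE y : (\1_(~` E) y * (mu y)^-1) `^ a1 = \1_(~` E) y * v y.
  rewrite indicE; case: (_ \in _); first by rewrite !mul1r.
  by rewrite !mul0r powR0// gt_eqF.
have fFa : lfin (fun y => (\1_(~` E) y * (mu y)^-1) `^ a1).
  by apply: eq_lfin fFv => y; rewrite powE.
have i0 y : 0 <= \1_(~` E) y * (mu y)^-1.
  by rewrite mulr_ge0// invr_ge0 ltW.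
have ac : a1^-1 + c1^-1 = 1 by rewrite /c1 invrK addrC subrK.
have [_ hol] := av_holder j x a10 c10 ac
  (measurable_funM (measurable_indic mF) mi) mm i0 (fun y => ltW (m0 y)) fFa fc1.
have avF : av j (\1_(~` E) : T -> R) x <= av j (fun y => \1_(~` E) y * v y) x `^ a1^-1 * Nm a2 j mu x.
  rewrite (eq_av (g := fun y => \1_(~` E) y * (mu y)^-1 * mu y)); last first.
    by move=> y _; rewrite mulfVK// gt_eqF.
  apply: le_trans hol _; rewrite (eq_av (g := fun y => \1_(~` E) y * v y)); last first.
    by move=> y _; exact: powE.
  apply: ler_wpM2l; first exact: powR_ge0.
  by apply: le_trans Nc1; rewrite Nm_def lexx.
have av0 : 0 < av j v x := av_gt0 j x f2 v0.
have avF0 : 0 <= av j (fun y => \1_(~` E) y * v y) x.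
  by apply: av_ge0 => y; rewrite mulr_ge0// ltW.
have avv0 : 0 < av j v x `^ a1^-1 by rewrite powR_gt0.
have Hj : Nm a2 j mu x * av j v x `^ a1^-1 <= K by have := H j x; rewrite [X in _ * X]Nm_def.
have key : (2 * K)^-1 * av j v x `^ a1^-1 <= av j (fun y => \1_(~` E) y * v y) x `^ a1^-1.
  have h : 2^-1 * av j v x `^ a1^-1 <= av j (fun y => \1_(~` E) y * v y) x `^ a1^-1 * K.
    apply: le_trans (ler_wpM2r (ltW avv0) (le_trans half avF)) _.
    by rewrite -mulrA; apply: ler_wpM2l => //; exact: powR_ge0.
  rewrite invfM -mulrA mulrCA ler_pdivrMl//; apply: le_trans h _.
  by rewrite mulrC.
have {key} : ((2 * K)^-1) `^ a1 * av j v x <= av j (fun y => \1_(~` E) y * v y) x.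
  have := le_powR (ltW a10) (mulr_ge0 K20 (ltW avv0)) key.
  by rewrite powRM// ?(ltW avv0)// !powRVK// ltW.
rewrite !av_def mulrA ler_pM2r ?invr_gt0// => key.
have -> : S j (fun y => \1_E y * (mu y)^-1 `^ a1) x = S j (fun y => \1_E y * v y) x by [].
have -> : S j (fun y => (mu y)^-1 `^ a1) x = S j v x by [].
by rewrite mulrBl mul1r lerBrDr [leRHS]Sv lerD2l.
Qed.

End single_cube.

Section uniform_weights.
Context {d} {T : measurableType d} {R : realType}.
Context {m : {sigma_finite_measure set T -> \bar R}} {D : R}.
Implicit Types (G : dyadic m D) (j i : nat) (x y : T) (b f g h u v mu lam : T -> R) (a t : R).
Local Notation av := cell_av.
Local Notation Nm := cell_Nm.
Hint Resolve measurable_cell : core.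

Lemma Aw_reverse_holder a1 a2 K : 1 <= D -> 1 < a1 -> 1 < a2 -> a1^-1 + a2^-1 < 1 -> 1 <= K ->
  exists ep C, [/\ 0 < ep, 0 < C & forall G mu, dyadic_Apq G a1 a2 K mu ->
    lfin G (fun y => (mu y)^-1 `^ (a1 * (1 + ep))) /\
    forall j x, Nm G (a1 * (1 + ep)) j (fun y => (mu y)^-1) x <=
      C * Nm G a1 j (fun y => (mu y)^-1) x].
Proof.
move=> D1 a11 a21 a12 K1.
have a10 : 0 < a1 by exact: lt_trans a11.
have K20 : 0 < (2 * K)^-1 by rewrite invr_gt0; lra.
have th : 0 < 1 - ((2 * K)^-1) `^ a1 < 1.
  rewrite subr_gt0 ltrBlDr ltrDl powR_gt0// andbT.
  have K21 : (2 * K)^-1 < 1 by rewrite invf_lt1; lra.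
  have := @gt0_ltr_powR R a1 a10 (2 * K)^-1 1; rewrite !nnegrE (ltW K20) ler01 powR1.
  by apply.
have [ep [C [ep0 C0 H]]] := reverse_holder (m := m) D1 th.
have e1 : 0 < 1 + ep by lra.
have ae : 0 < a1 * (1 + ep) by rewrite mulr_gt0.
exists ep, (C `^ (a1 * (1 + ep))^-1); split=> //; first by rewrite powR_gt0.
move=> G mu Amu; have [mm m0 f1 f2 _] := Amu.
have v0 y : 0 < (mu y)^-1 `^ a1 by rewrite powR_gt0// invr_gt0.
have [l1 l2] := H G _ f2 v0 (Aw_Ainf a11 a21 a12 K1 Amu).
have l3 : lfin G (fun y => (mu y)^-1 `^ (a1 * (1 + ep))).
  by apply: eq_lfin l1 => y; rewrite -powRrM.
split=> // j x; rewrite !Nm_def.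
have a0 : 0 <= av G j (fun y => (mu y)^-1 `^ a1) x by apply: av_ge0 => y; exact: powR_ge0.
have a0' : 0 <= av G j (fun y => (mu y)^-1 `^ (a1 * (1 + ep))) x by apply: av_ge0 => y; exact: powR_ge0.
have le : av G j (fun y => (mu y)^-1 `^ (a1 * (1 + ep))) x <= C * av G j (fun y => (mu y)^-1 `^ a1) x `^ (1 + ep).
  apply: le_trans (l2 j x); rewrite le_eqVlt; apply/orP; left; apply/eqP.
  by apply: eq_av => y _; rewrite powRrM.
apply: le_trans (le_powR _ a0' le) _; first by rewrite invr_ge0 ltW.
rewrite powRM ?(ltW C0) ?powR_ge0// -powRrM invfM mulrCA mulfV ?gt_eqF// mulr1.
exact: lexx.
Qed.

End uniform_weights.

(** * The estimate on a single cell *)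

(** The exponents serve the factorization [mu / lam = (mu ^ eta / lam) * mu ^ (1 - eta)]. The first
    factor is measured with exponent [e], the second with its conjugate [e']; inside the first,
    [mu ^ eta] takes [a] and [lam^-1] the improved exponent [a1 * (1 + ep)]. The relation
    [r * (1 - eta) = a1] lets the mass of [mu^-a1] pair with the power [1 - eta] of the norm of
    [mu]. *)
Lemma single_cube_exponents (R : realType) (a1 a2 ep : R) :
  1 < a1 -> 1 < a2 -> a1^-1 + a2^-1 < 1 -> 0 < ep ->
  exists e e' a eta r : R,
  [/\ [/\ 0 < a, a * eta <= a2 & e^-1 = a^-1 + (a1 * (1 + ep))^-1],
      [/\ a1 < r, r < e & r * (1 - eta) = a1],
      0 < eta < 1 &
      [/\ 0 < e', e' * (1 - eta) <= a2 & 1^-1 = e^-1 + e'^-1] ].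
Proof.
move=> a11 a21 a12 ep0.
have a10 : 0 < a1 by lra.
have a20 : 0 < a2 by lra.
(* Half of the gain is used by [e]; the other half makes [a] positive. *)
have [e Ee] : exists e, e = a1 * (1 + ep / 2) by eexists.
have e0 : 0 < e by rewrite Ee mulr_gt0//; lra.
have ae : a1 < e by rewrite Ee ltr_pMr//; lra.
have e1 : 1 < e by lra.
have ee : e < a1 * (1 + ep) by rewrite Ee ltr_pM2l//; lra.
have ei : e^-1 < a1^-1 by rewrite ltf_pV2.
have eei : (a1 * (1 + ep))^-1 < e^-1 by rewrite ltf_pV2// posrE; lra.
pose a := (e^-1 - (a1 * (1 + ep))^-1)^-1.
have a0 : 0 < a by rewrite invr_gt0 subr_gt0.
have q1 : a1 / e < 1 by rewrite ltr_pdivrMr// mul1r.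
(* The last bound forces [r = a1 / (1 - eta) < e]. *)
have [eta [h0 h1 h2]] : exists eta, [/\ 0 < eta, a * eta <= a2 & eta <= (1 - a1 / e) / 2].
  exists (Num.min (a2 / a) ((1 - a1 / e) / 2)); split.
  - by rewrite lt_min !divr_gt0// subr_gt0.
  - by rewrite mulrC -ler_pdivlMr// ge_min lexx.
  - by rewrite ge_min lexx orbT.
have q0 : 0 < a1 / e by rewrite divr_gt0.
have eta1 : eta < 1 by lra.
have a2i : 0 < a2^-1 by rewrite invr_gt0.
have f0 : 0 < 1 - e^-1 by lra.
exists e, (1 - e^-1)^-1, a, eta, (a1 / (1 - eta)); split.
- by split=> //; rewrite /a invrK subrK.
- split.
  + by rewrite ltr_pdivlMr; [rewrite gtr_pMr//; lra|lra].
  + rewrite ltr_pdivrMr; last by lra.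
    by rewrite mulrC -ltr_pdivrMr//; lra.
  + by rewrite divfK// gt_eqF; lra.
- by rewrite h0 eta1.
- split; first by rewrite invr_gt0.
    rewrite mulrC ler_pdivrMr//.
    have : 1 < a2 * (1 - e^-1).
      by rewrite -ltr_pdivrMl// mulr1; lra.
    lra.
  by rewrite invrK invr1 addrC subrK.
Qed.

(** Here one of the [k] factors is charged to the weighted oscillation bound and the other [k - 1]
    to the unweighted one. *)
Lemma min_pow_le (R : realType) (c u v r : R) (k : nat) : (0 < k)%N -> 0 <= r ->
  0 <= c -> c <= u -> c <= v -> c `^ (k%:R * r) <= (u * v ^+ k.-1) `^ r.
Proof.
move=> k0 r0 c0 cu cv; rewrite powRrM powR_mulrn//; apply: le_powR => //.
  exact: exprn_ge0.
rewrite -[in leLHS](prednK k0) exprS; apply: ler_pM => //; first exact: exprn_ge0.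
by apply: lerXn2r; rewrite ?nnegrE// (le_trans c0).
Qed.

Section single_cube.
Context {d} {T : measurableType d} {R : realType}.
Context {m : {sigma_finite_measure set T -> \bar R}} {D : R}.
Variable G : dyadic m D.
Implicit Types (j i : nat) (x y : T) (b f g h u v mu lam : T -> R) (a t : R).
Local Notation kap := (kap G).
Local Notation lfin := (lfin G).
Local Notation labs := (labs G).
Local Notation mean := (mean G).
Local Notation S := (cell_int G).
Local Notation av := (cell_av G).
Local Notation Nm := (cell_Nm G).
Hint Resolve measurable_cell : core.

(** [B1] and [B2] stand for the norms of [b] in BMO(nu) and BMO. Positivity is required since the
    minimum of the two bounds must be positive in [osc_bound]. *)
Definition dyadic_bmo mu lam b (B1 B2 : R) := [/\ labs b, 0 < B1, 0 < B2,
  forall j x, av j (fun y => `|b y - mean j b x|) x <= B1 * av j (fun y => mu y * (lam y)^-1) x &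
  forall j x, av j (fun y => `|b y - mean j b x|) x <= B2].

Lemma S_Nm a j f x : 0 < a -> S j (fun y => f y `^ a) x = kap j * Nm a j f x `^ a.
Proof. by move=> a0; rewrite Nm_powR// S_av. Qed.

Lemma av_scale_pow a L j f x : 0 < a -> 0 <= L -> (forall y, 0 <= f y) ->
  lfin (fun y => f y `^ a) ->
  lfin (fun y => (L * f y) `^ a) /\
  av j (fun y => (L * f y) `^ a) x = (L * Nm a j f x) `^ a.
Proof.
move=> a0 L0 f0 ff; have l : lfin (fun y => L `^ a * f y `^ a).
  by apply: lfinZ => //; exact: powR_ge0.
split; first by apply: eq_lfin l => y; rewrite powRM.
rewrite (eq_av (g := fun y => L `^ a * f y `^ a)); last by move=> y _; rewrite powRM.
by rewrite avZ ?powR_ge0// powRM// ?Nm_ge0// Nm_powR.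
Qed.

(** Hoelder for [mu / lam] factored as [mu ^ eta / lam] times [mu ^ (1 - eta)]; the second exponent
    is raised to [a2] by [Nm_le]. *)
Lemma Nm_nu a2 e e' eta j x mu lam : 0 < e -> 0 < e' -> 1^-1 = e^-1 + e'^-1 ->
  0 < eta < 1 -> e' * (1 - eta) <= a2 ->
  measurable_fun setT mu -> measurable_fun setT lam ->
  (forall y, 0 < mu y) -> (forall y, 0 < lam y) ->
  lfin (fun y => mu y `^ a2) -> lfin (fun y => (mu y `^ eta * (lam y)^-1) `^ e) ->
  lfin (fun y => mu y * (lam y)^-1) /\
  av j (fun y => mu y * (lam y)^-1) x <=
    Nm e j (fun y => mu y `^ eta * (lam y)^-1) x * Nm a2 j mu x `^ (1 - eta).
Proof.
move=> e0 e'0 ee /andP[eta0 eta1] e'a mm ml m0 l0 fm fo.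
have eta1' : 0 < 1 - eta by rewrite subr_gt0.
have ea0 : 0 < e' * (1 - eta) by rewrite mulr_gt0.
have mi := measurable_inv ml l0.
have [f1 le1] := Nm_le j x ea0 e'a mm (fun y => ltW (m0 y)) fm.
have f2 : lfin (fun y => (mu y `^ (1 - eta)) `^ e').
  by apply: eq_lfin f1 => y; rewrite -powRrM mulrC.
have [] := @Nm_holder _ _ _ _ _ G e e' 1 j (fun y => mu y `^ eta * (lam y)^-1)
  (fun y => mu y `^ (1 - eta)) x e0 e'0 ltr01 ee.
- by mfun.
- by mfun.
- by move=> y; rewrite mulr_ge0 ?powR_ge0// invr_ge0 ltW.
- by move=> y; exact: powR_ge0.
- exact: fo.
- exact: f2.
have E y : mu y `^ eta * (lam y)^-1 * mu y `^ (1 - eta) = mu y * (lam y)^-1.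
  rewrite mulrAC -powRD; last by rewrite (gt_eqF (m0 y)) implybT.
  by rewrite addrC subrK powRr1// ltW.
move=> h1 h2; split.
  apply: eq_lfin h1 => y; rewrite E powRr1// mulr_ge0// ?invr_ge0 ltW//.
have -> : av j (fun y => mu y * (lam y)^-1) x =
    Nm 1 j (fun y => mu y `^ eta * (lam y)^-1 * mu y `^ (1 - eta)) x.
  rewrite Nm_def invr1 powRr1; last by apply: av_ge0 => y; exact: powR_ge0.
  by apply: eq_av => y _; rewrite E powRr1// mulr_ge0// ?invr_ge0 ltW.
apply: le_trans h2 _; apply: ler_wpM2l; first exact: Nm_ge0.
rewrite (Nm_pow G e' j mu x eta1'); apply: le_powR => //; [exact: ltW|exact: Nm_ge0].
Qed.

(** The norm of [lam^-1] appears with an exponent above [a1]; only the reverse Hoelder inequality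
    brings it back to [a1]. *)
Lemma Nm_omega a1 a2 e a ep eta j x mu lam : 0 < e -> 0 < a -> 0 < a1 * (1 + ep) ->
  e^-1 = a^-1 + (a1 * (1 + ep))^-1 -> 0 < eta -> a * eta <= a2 ->
  measurable_fun setT mu -> measurable_fun setT lam ->
  (forall y, 0 < mu y) -> (forall y, 0 < lam y) ->
  lfin (fun y => mu y `^ a2) -> lfin (fun y => (lam y)^-1 `^ (a1 * (1 + ep))) ->
  lfin (fun y => (mu y `^ eta * (lam y)^-1) `^ e) /\
  Nm e j (fun y => mu y `^ eta * (lam y)^-1) x <=
    Nm a2 j mu x `^ eta * Nm (a1 * (1 + ep)) j (fun y => (lam y)^-1) x.
Proof.
move=> e0 a0 ae0 ee eta0 aeta mm ml m0 l0 fm fl.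
have ea0 : 0 < a * eta by rewrite mulr_gt0.
have mi := measurable_inv ml l0.
have [f1 le1] := Nm_le j x ea0 aeta mm (fun y => ltW (m0 y)) fm.
have f2 : lfin (fun y => (mu y `^ eta) `^ a).
  by apply: eq_lfin f1 => y; rewrite -powRrM mulrC.
have [] := @Nm_holder _ _ _ _ _ G a (a1 * (1 + ep)) e j (fun y => mu y `^ eta)
  (fun y => (lam y)^-1) x a0 ae0 e0 ee.
- by mfun.
- exact: mi.
- by move=> y; exact: powR_ge0.
- by move=> y; rewrite invr_ge0 ltW.
- exact: f2.
- exact: fl.
move=> h1 h2; split=> //; apply: le_trans h2 _.
apply: ler_wpM2r; first exact: Nm_ge0.
rewrite (Nm_pow G a j mu x eta0); apply: le_powR => //; [exact: ltW|exact: Nm_ge0].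
Qed.

End single_cube.

Section uniform_single_cube.
Context {d} {T : measurableType d} {R : realType}.
Context {m : {sigma_finite_measure set T -> \bar R}} {D : R}.
Implicit Types (G : dyadic m D) (j i : nat) (x y : T) (b f g h u v mu lam : T -> R) (a t : R).
Local Notation Q := cell.
Local Notation S := cell_int.
Local Notation av := cell_av.
Local Notation Nm := cell_Nm.
Hint Resolve measurable_cell : core.

(** [osc_bound] with [sg = mu^-a1], [t = r / e] and [Y] a multiple of [(mu ^ eta / lam) ^ e], so
    that [(av Y) ^ t] is the [r]-th power of a norm of [mu ^ eta / lam]. The powers of [kap] then
    cancel, and the norms pair up into the weight constants: [mu] contributes [K ^ (1 - eta)] and
    [K ^ eta], [lam] contributes [K], whence [K ^ 2]. *)
Theorem single_cube a1 a2 K (k : nat) : 1 <= D -> 1 < a1 -> 1 < a2 ->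
  a1^-1 + a2^-1 < 1 -> 1 <= K -> (0 < k)%N ->
  exists r C, [/\ a1 < r, 0 < C & forall G mu lam b B1 B2,
   dyadic_Apq G a1 a2 K mu -> dyadic_Apq G a1 a2 K lam -> dyadic_bmo G mu lam b B1 B2 -> forall j x,
   (\int[m]_(y in Q G j x) (`|b y - mean G j b x| `^ (k%:R * r) * (mu y)^-1 `^ a1)%:E < +oo)%E /\
   S G j (fun y => `|b y - mean G j b x| `^ (k%:R * r) * (mu y)^-1 `^ a1) x `^ r^-1 *
   S G j (fun y => (mu y)^-1 `^ a1) x `^ (a1^-1 - r^-1) * S G j (fun y => lam y `^ a2) x `^ a2^-1
   <= C * (B1 * B2 ^+ k.-1) * kap G j `^ (a1^-1 + a2^-1)].
Proof.
move=> D1 a11 a21 a12 K1 k0.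
have a10 : 0 < a1 by exact: lt_trans a11.
have a20 : 0 < a2 by exact: lt_trans a21.
have K0 : 0 < K by exact: lt_le_trans K1.
have [ep [C1 [ep0 C10 RH]]] := Aw_reverse_holder (m := m) D1 a11 a21 a12 K1.
have [e [e' [a [eta [r [[a0 aeta ee] [ar re rE] etab [e'0 e'a ee']]]]]]] :=
  single_cube_exponents a11 a21 a12 ep0.
have [eta0 eta1] := andP etab.
have r0 : 0 < r by exact: lt_trans ar.
have e0 : 0 < e by exact: lt_trans re.
have ae0 : 0 < a1 * (1 + ep) by rewrite mulr_gt0// addr_gt0.
have rho0 : 0 < k%:R * r by rewrite mulr_gt0// ltr0n.
(* The exponent is below 1 because the reverse Hoelder gain left room for [r < e]. *)
have t01 : 0 < r / e < 1 by rewrite divr_gt0//= ltr_pdivrMr// mul1r.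
have [C0 [C00 osc]] := osc_bound (m := m) D1 rho0 t01.
exists r, (C0 `^ r^-1 * C1 * K ^+ 2); split=> //.
  by rewrite !mulr_gt0 ?powR_gt0// exprn_gt0.
move=> G mu lam b B1 B2 Amu Alam [fb B10 B20 bB1 bB2] j x.
have [mm m0 fm2 fm1 Hm] := Amu; have [ml l0 fl2 fl1 Hl] := Alam.
have [fl3 Nl3] := RH G _ Alam.
have sg0 y : 0 < (mu y)^-1 `^ a1 by rewrite powR_gt0// invr_gt0.
have om0 y : 0 < mu y `^ eta * (lam y)^-1 by rewrite mulr_gt0 ?powR_gt0// invr_gt0.
have fom : lfin G (fun y => (mu y `^ eta * (lam y)^-1) `^ e).
  by have [] := Nm_omega j x e0 a0 ae0 ee eta0 aeta mm ml m0 l0 fm2 fl3.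
have nu0 y : 0 < mu y * (lam y)^-1 by rewrite mulr_gt0// invr_gt0.
have fnu : lfin G (fun y => mu y * (lam y)^-1).
  by have [] := Nm_nu j x e0 e'0 ee' etab e'a mm ml m0 l0 fm2 fom.
have BB0 : 0 < B1 * B2 ^+ k.-1 by rewrite mulr_gt0// exprn_gt0.
have [L EL] : exists L, L = B1 * B2 ^+ k.-1 * K `^ (1 - eta) by eexists.
have L0 : 0 < L by rewrite EL mulr_gt0// powR_gt0.
pose No i y := Nm G e i (fun y => mu y `^ eta * (lam y)^-1) y.
have No0 i y : 0 <= No i y by exact: Nm_ge0.
pose Y y := (L * (mu y `^ eta * (lam y)^-1)) `^ e.
have Y0 y : 0 < Y y by rewrite powR_gt0// mulr_gt0.
have [fY _] := av_scale_pow j x e0 (ltW L0) (fun y => ltW (om0 y)) fom.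
have avY i y : av G i Y y `^ (r / e) = (L * No i y) `^ r.
  have [_ ->] := av_scale_pow i y e0 (ltW L0) (fun y => ltW (om0 y)) fom.
  have E : e * (r / e) = r by rewrite mulrC divfK// gt_eqF.
  by rewrite -powRrM E.
(* The minimum keeps both oscillation bounds available on every subcell visited by the stopping
   argument. *)
pose c i y := Num.min (B1 * av G i (fun y => mu y * (lam y)^-1) y) B2.
have nup i y : 0 < av G i (fun y => mu y * (lam y)^-1) y by exact: av_gt0.
have c0 i y : 0 < c i y by rewrite lt_min B20 mulr_gt0.
have bc i y : av G i (fun z => `|b z - mean G i b y|) y <= c i y by rewrite le_min bB1 bB2.
(* Since [a1 = (1 - eta) * r], the average of [mu^-a1] is an [r]-th power, and its base meets the
   norm of [mu] to the power [1 - eta] from [Nm_nu]; their product is at most [K ^ (1 - eta)], the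
   factor built into [L]. *)
have cY i y : c i y `^ (k%:R * r) * S G i (fun y => (mu y)^-1 `^ a1) y <=
    kap G i * av G i Y y `^ (r / e).
  rewrite avY S_Nm// mulrCA; apply: ler_wpM2l; first by rewrite ltW// kap_gt0.
  have h1 : c i y `^ (k%:R * r) <= (B1 * av G i (fun y => mu y * (lam y)^-1) y * B2 ^+ k.-1) `^ r.
    by apply: min_pow_le; [exact: k0|exact: ltW|exact: ltW|rewrite ge_min lexx|rewrite ge_min lexx orbT].
  have [_ h2] := Nm_nu i y e0 e'0 ee' etab e'a mm ml m0 l0 fm2 fom.
  have N20 := Nm_ge0 G a1 i (fun y => (mu y)^-1) y.
  have N10 := Nm_ge0 G a2 i mu y.
  have E2 : Nm G a1 i (fun y => (mu y)^-1) y `^ a1 = (Nm G a1 i (fun y => (mu y)^-1) y `^ (1 - eta)) `^ r.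
    by rewrite -powRrM (mulrC _ r) rE.
  rewrite E2 [leLHS]mulrC.
  have N2p := powR_ge0 (Nm G a1 i (fun y => (mu y)^-1) y) (1 - eta).
  have N1p := powR_ge0 (Nm G a2 i mu y) (1 - eta).
  apply: le_trans (ler_wpM2l (powR_ge0 _ _) h1) _.
  rewrite -powRM//; last by rewrite !mulr_ge0 ?exprn_ge0 ?ltW.
  apply: le_powR; [exact: ltW| |].
    apply: mulr_ge0 => //; apply: mulr_ge0; last by rewrite exprn_ge0 ?ltW.
    by apply: mulr_ge0; exact: ltW.
  have h3 : Nm G a1 i (fun y => (mu y)^-1) y `^ (1 - eta) * av G i (fun y => mu y * (lam y)^-1) y <=
    K `^ (1 - eta) * No i y.
    apply: le_trans (ler_wpM2l N2p h2) _; rewrite mulrCA -/(No i y) [leRHS]mulrC.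
    apply: ler_wpM2l => //; rewrite -powRM//; apply: le_powR.
    - by rewrite subr_ge0 ltW.
    - exact: mulr_ge0.
    - by rewrite mulrC; exact: Hm.
  rewrite EL [leLHS](_ : _ = (B1 * B2 ^+ k.-1) * (Nm G a1 i (fun y => (mu y)^-1) y `^ (1 - eta) * av G i (fun y => mu y * (lam y)^-1) y)); last by ring.
  by rewrite -[leRHS]mulrA; apply: ler_wpM2l => //; exact: ltW.
have os := osc G b _ Y c fb fm1 sg0 fY Y0 c0 bc cY j x.
split; first by apply: le_lt_trans os _; rewrite ltry.
have k0' : 0 < kap G j by exact: kap_gt0.
have Xle : S G j (fun y => `|b y - mean G j b x| `^ (k%:R * r) * (mu y)^-1 `^ a1) x <=
    C0 * (kap G j * (L * No j x) `^ r).
  rewrite -avY -lee_fin S_def fineK//.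
  rewrite ge0_fin_numE; first by apply: le_lt_trans os _; rewrite ltry.
  by apply: integral_ge0 => y _; rewrite lee_fin mulr_ge0 ?powR_ge0.
have X0 : 0 <= S G j (fun y => `|b y - mean G j b x| `^ (k%:R * r) * (mu y)^-1 `^ a1) x.
  by apply: S_ge0 => y; rewrite mulr_ge0 ?powR_ge0.
have ri0 : 0 <= r^-1 by rewrite invr_ge0 ltW.
have X1 := le_powR ri0 X0 Xle.
have E1 : (C0 * (kap G j * (L * No j x) `^ r)) `^ r^-1 = C0 `^ r^-1 * (kap G j `^ r^-1 * (L * No j x)).
  rewrite (powRM _ (ltW C00) (mulr_ge0 (ltW k0') (powR_ge0 _ _))).
  by rewrite (powRM _ (ltW k0') (powR_ge0 _ _)) (powRKV r0 (mulr_ge0 (ltW L0) (No0 _ _))).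
rewrite E1 in X1.
have [_ h4] := Nm_omega j x e0 a0 ae0 ee eta0 aeta mm ml m0 l0 fm2 fl3.
have N10 := Nm_ge0 G a2 j mu x.
have N20 := Nm_ge0 G a1 j (fun y => (mu y)^-1) x.
have N30 := Nm_ge0 G a2 j lam x.
have N40 := Nm_ge0 G a1 j (fun y => (lam y)^-1) x.
have {}h4 : No j x <= Nm G a2 j mu x `^ eta * (C1 * Nm G a1 j (fun y => (lam y)^-1) x).
  by apply: le_trans h4 _; apply: ler_wpM2l; [exact: powR_ge0|exact: Nl3].
(* The spare power of the mass of [mu^-a1] is thus the power [eta] of the norm of [mu^-1], up to
   [kap], and matches the norm of [mu] to the power [eta] in [h4]. *)
have rEi : a1^-1 - r^-1 = eta * a1^-1.
  rewrite -rE; have e1' : 1 - eta != 0 by rewrite gt_eqF// subr_gt0.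
  by field; rewrite e1' gt_eqF.
rewrite (S_Nm G j (fun y => (mu y)^-1) x a10) (S_Nm G j lam x a20).
rewrite rEi (mulrC eta) [X in _ * X * _ <= _]powRrM.
rewrite [in X in _ * (X `^ eta) * _ <= _]powRM ?powR_ge0 ?(ltW k0')// powRKV//.
rewrite [X in _ * X <= _]powRM ?powR_ge0 ?(ltW k0')// powRKV//.
rewrite [X in _ * X * _ <= _]powRM ?powR_ge0//.
have kE : kap G j `^ (a1^-1 + a2^-1) = kap G j `^ r^-1 * (kap G j `^ a1^-1) `^ eta * kap G j `^ a2^-1.
  have kD s t : kap G j `^ (s + t) = kap G j `^ s * kap G j `^ t.
    by rewrite powRD// (gt_eqF k0') implybT.
  have Ex : a1^-1 = r^-1 + a1^-1 * eta by rewrite (mulrC _ eta) -rEi addrC subrK.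
  by rewrite [X in _ `^ (X + _)]Ex !kD [X in _ * X * _ = _]powRrM.
rewrite kE.
have kp s := powR_ge0 (kap G j) s; have kpp s t := powR_ge0 (kap G j `^ s) t.
set k1 := kap G j `^ r^-1 in X1 *; set k2 := (kap G j `^ a1^-1) `^ eta; set k3 := kap G j `^ a2^-1.
have k10 : 0 <= k1 by exact: powR_ge0.
have k20 : 0 <= k2 by exact: powR_ge0.
have k30 : 0 <= k3 by exact: powR_ge0.
have N1e := powR_ge0 (Nm G a2 j mu x) eta; have N2e := powR_ge0 (Nm G a1 j (fun y => (mu y)^-1) x) eta.
have Hme : Nm G a2 j mu x `^ eta * Nm G a1 j (fun y => (mu y)^-1) x `^ eta <= K `^ eta.
  by rewrite -powRM//; apply: le_powR; [exact: ltW|exact: mulr_ge0|exact: Hm].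
have KE : K `^ (1 - eta) * K `^ eta = K.
  by rewrite -powRD ?subrK ?powRr1 ?(ltW K0)// (gt_eqF K0) implybT.
have n2k : 0 <= k2 * Nm G a1 j (fun y => (mu y)^-1) x `^ eta by exact: mulr_ge0.
have n3k : 0 <= k3 * Nm G a2 j lam x by exact: mulr_ge0.
apply: (le_trans (ler_wpM2r n3k (ler_wpM2r n2k X1))).
move: n2k n3k h4 Hme N1e N2e KE (Hl j x) EL.
generalize (Nm G a2 j mu x `^ eta) (Nm G a1 j (fun y => (mu y)^-1) x `^ eta) (K `^ eta) (K `^ (1 - eta)).
move: N30 N40 L0 BB0 (No0 j x) (powR_ge0 C0 r^-1) k10 k20 k30.
generalize (Nm G a2 j lam x) (Nm G a1 j (fun y => (lam y)^-1) x) (B1 * B2 ^+ k.-1) (No j x) (C0 `^ r^-1) k1 k2 k3.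
clear -C10 K0.
move=> n3 n4 BB no c1 k1 k2 k3 n30 n40 L0 BB0 no0 c10 k10 k20 k30 n1 n2 Ke Ke'.
move=> n2k n3k h4 Hme N1e N2e KE Hl EL.
apply: (@le_trans _ _ (c1 * (k1 * (L * (n1 * (C1 * n4)))) * (k2 * n2) * (k3 * n3))).
  apply: ler_wpM2r => //; apply: ler_wpM2r => //; apply: ler_wpM2l => //.
  by apply: ler_wpM2l => //; apply: ler_wpM2l => //; exact: ltW.
have s2 : 0 <= c1 * C1 * k1 * k2 * k3 * L by rewrite !mulr_ge0// ltW.
have s3 : (n1 * n2) * (n3 * n4) <= Ke * K by apply: ler_pM => //; exact: mulr_ge0.
have := ler_wpM2l s2 s3.
rewrite (_ : c1 * C1 * k1 * k2 * k3 * L * (Ke * K) = c1 * C1 * k1 * k2 * k3 * BB * (Ke' * Ke) * K); last by rewrite EL; ring.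
rewrite KE => H.
rewrite (_ : c1 * (k1 * (L * (n1 * (C1 * n4)))) * (k2 * n2) * (k3 * n3) =
  c1 * C1 * k1 * k2 * k3 * L * (n1 * n2 * (n3 * n4))); last by ring.
apply: le_trans H _.
by rewrite le_eqVlt; apply/orP; left; apply/eqP; ring.
Qed.

End uniform_single_cube.

(** * Embedding and bilinear form *)

(** Below 1 the terms [t ^ a] decay geometrically; above 1 the terms [t ^ - b] grow geometrically
    until [t] passes 1. Both sums are bounded whatever the starting value. *)
Lemma geometric_min_sum (R : realType) (a b th : R) : 0 < a -> 0 < b -> 0 < th < 1 ->
  exists C, 0 < C /\ forall t : nat -> R, (forall j, 0 < t j) ->
   (forall j, t j.+1 <= th * t j) -> forall n,
   \sum_(j < n) Num.min (t j `^ a) ((t j `^ b)^-1) <= C.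
Proof.
move=> a0 b0 /andP[th0 th1].
have lt1 (c : R) : 0 < c -> 0 < th `^ c < 1.
  move=> c0; rewrite powR_gt0//=.
  by have := @gt0_ltr_powR R c c0 th 1; rewrite !nnegrE (ltW th0) ler01 powR1; apply.
have [A EA] : exists A, A = (1 - th `^ a)^-1 by eexists.
have [B EB] : exists B, B = th `^ b / (1 - th `^ b) by eexists.
have /andP[ta0 ta1] := lt1 _ a0; have /andP[tb0 tb1] := lt1 _ b0.
have A0 : 0 < A by rewrite EA invr_gt0 subr_gt0.
have B0 : 0 < B by rewrite EB divr_gt0// subr_gt0.
have AE : A = 1 + A * th `^ a.
  have n0 : 1 - th `^ a != 0 by rewrite gt_eqF// subr_gt0.
  by rewrite EA; field.
have BE : B * (th `^ b)^-1 = 1 + B.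
  have n0 : 1 - th `^ b != 0 by rewrite gt_eqF// subr_gt0.
  by rewrite EB; field; rewrite n0 gt_eqF.
exists (A + 1 + B); split; first by rewrite !addr_gt0.
move=> t t0 tS n.
(* A potential bounding the whole sum started at [z]: each term is paid for by the drop of [Phi].
   The summand 1 pays for the single step that crosses 1. *)
pose Phi (z : R) := if z <= 1 then A * z `^ a else A + 1 + B * (1 - (z `^ b)^-1).
have pa (z : R) : 0 < z -> z <= 1 -> z `^ a <= 1.
  by move=> z0 z1; have := le_powR (ltW a0) (ltW z0) z1; rewrite powR1.
have pb (z : R) : 0 < z -> 1 < z -> (z `^ b)^-1 <= 1.
  move=> z0 z1; rewrite invf_le1 ?powR_gt0//.
  by have := le_powR (ltW b0) ler01 (ltW z1); rewrite powR1.
have Phi0 z : 0 < z -> 0 <= Phi z.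
  move=> z0; rewrite /Phi; have [z1|z1] := leP z 1.
    by rewrite mulr_ge0 ?powR_ge0// ltW.
  apply: addr_ge0; first by rewrite addr_ge0// ltW.
  by apply: mulr_ge0; [exact: ltW|rewrite subr_ge0; exact: pb].
have PhiC z : 0 < z -> Phi z <= A + 1 + B.
  move=> z0; rewrite /Phi; have [z1|z1] := leP z 1.
    apply: (@le_trans _ _ A); last by rewrite -addrA lerDl addr_ge0// ltW.
    by rewrite -[leRHS]mulr1; apply: ler_wpM2l; [exact: ltW|exact: pa].
  by rewrite lerD2l -[leRHS]mulr1 ler_wpM2l ?(ltW B0)// lerBlDr lerDl invr_ge0 powR_ge0.
have step z w : 0 < z -> 0 < w -> w <= th * z -> Num.min (z `^ a) ((z `^ b)^-1) + Phi w <= Phi z.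
  move=> z0 w0 wz; rewrite /Phi; have [z1|z1] := leP z 1.
    have w1 : w <= 1 by apply: le_trans wz _; rewrite mulr_ile1// ltW.
    rewrite w1 [in leRHS]AE mulrDl mul1r; apply: lerD; first by rewrite ge_min lexx.
    rewrite -mulrA; apply: ler_wpM2l; first exact: ltW.
    rewrite -powRM; [|exact: ltW|exact: ltW].
    by apply: le_powR; [exact: ltW|exact: ltW|].
  have zb := pb _ z0 z1.
  have m1 : Num.min (z `^ a) ((z `^ b)^-1) <= (z `^ b)^-1 by rewrite ge_min lexx orbT.
  have [w1|w1] := leP w 1.
    have h1 : A * w `^ a <= A by rewrite -[leRHS]mulr1 ler_wpM2l ?(ltW A0)// pa.
    have h2 : 0 <= B * (1 - (z `^ b)^-1) by rewrite mulr_ge0 ?(ltW B0)// subr_ge0.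
    have := le_trans m1 zb; move: h1 h2.
    generalize (Num.min (z `^ a) ((z `^ b)^-1)) (A * w `^ a) (B * (1 - (z `^ b)^-1)).
    by clear; move=> ? ? ? ? ? ?; lra.
  have wb : (th `^ b)^-1 * (z `^ b)^-1 <= (w `^ b)^-1.
    rewrite -invfM lef_pV2 ?posrE ?mulr_gt0 ?powR_gt0//.
    by rewrite -powRM ?(ltW th0) ?(ltW z0)//; apply: le_powR; [exact: ltW|exact: ltW|].
  have := ler_wpM2l (ltW B0) wb; rewrite mulrA BE; move: m1.
  generalize (Num.min (z `^ a) ((z `^ b)^-1)) ((w `^ b)^-1) ((z `^ b)^-1).
  by clear; move=> ? ? ? ? ?; lra.
suff : \sum_(j < n) Num.min (t j `^ a) ((t j `^ b)^-1) <= Phi (t 0).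
  by move/le_trans; apply; exact: PhiC.
elim: n t t0 tS => [|n IH] t t0 tS; first by rewrite big_ord0 Phi0.
rewrite big_ord_recl/=; apply: le_trans (step _ _ (t0 0) (t0 1) (tS 0)).
by rewrite lerD2l; exact: (IH (fun j => t j.+1)).
Qed.

Section embedding.
Context {d} {T : measurableType d} {R : realType}.
Context {m : {sigma_finite_measure set T -> \bar R}} {D : R}.
Variable G : dyadic m D.
Implicit Types (j i : nat) (x y : T) (b f g h u v mu lam : T -> R) (a t : R).
Local Notation Q := (cell G).
Local Notation kap := (kap G).
Local Notation lfin := (lfin G).
Local Notation S := (cell_int G).
Local Notation av := (cell_av G).
Hint Resolve measurable_cell : core.

Lemma integral_cell_cst j (W : T -> R) f : measurable_fun setT W -> (forall x, 0 <= W x) ->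
  (forall x y, Q j x y -> W y = W x) -> lfin f ->
  (\int[m]_x (W x * f x)%:E = \int[m]_x (W x * (S j f x / kap j))%:E)%E.
Proof.
move=> mW W0 Wc ff; have mf := lfin_meas ff; have f0 := lfin_ge0 ff.
rewrite (@integral_tower _ _ _ _ _ G j setT (fun x => (W x * f x)%:E))//; last 2 first.
- by move=> y; rewrite lee_fin mulr_ge0.
- by mfun.
apply: eq_integral => x _.
rewrite [X in (_ * X)%E](_ : _ = \int[m]_(y in Q j x) (W x * f y)%:E)%E; last first.
  by apply: eq_integral => y; rewrite inE => /Wc ->.
by rewrite integral_cellZ// -EFinM; congr EFin; ring.
Qed.

Lemma S_holder_weight P j h sg x : 1 < P -> measurable_fun setT h -> (forall y, 0 <= h y) ->
  lfin sg -> (forall y, 0 < sg y) -> lfin (fun y => h y `^ P * sg y) ->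
  lfin (fun y => h y * sg y) /\
  S j (fun y => h y * sg y) x <= S j (fun y => h y `^ P * sg y) x `^ P^-1 * S j sg x `^ (1 - P^-1).
Proof.
move=> P1 mh h0 fs s0 fh; have ms := lfin_meas fs.
have P0 : 0 < P by exact: lt_trans P1.
have Pi1 : P^-1 < 1 by rewrite invf_lt1.
have P'0 : 0 < (1 - P^-1)^-1 by rewrite invr_gt0 subr_gt0.
have conj : P^-1 + (1 - P^-1)^-1^-1 = 1 by rewrite invrK addrC subrK.
have E1 y : (h y * sg y `^ P^-1) `^ P = h y `^ P * sg y.
  by rewrite powRM ?powR_ge0// powRVK// ltW.
have E2 y : (sg y `^ (1 - P^-1)) `^ (1 - P^-1)^-1 = sg y.
  by rewrite -powRrM mulfV ?powRr1 ?(ltW (s0 y))// gt_eqF// subr_gt0.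
have E3 y : h y * sg y `^ P^-1 * sg y `^ (1 - P^-1) = h y * sg y.
  by rewrite -mulrA -powRD ?(gt_eqF (s0 y)) ?implybT// addrC subrK powRr1// ltW.
have [] := @av_holder _ _ _ _ _ G P (1 - P^-1)^-1 j (fun y => h y * sg y `^ P^-1)
  (fun y => sg y `^ (1 - P^-1)) x P0 P'0 conj.
- by mfun.
- by mfun.
- by move=> y; rewrite mulr_ge0 ?powR_ge0.
- by move=> y; exact: powR_ge0.
- by apply: eq_lfin fh => y; rewrite E1.
- by apply: eq_lfin fs => y; rewrite E2.
move=> l1 l2; split; first by apply: eq_lfin l1 => y; rewrite E3.
have k0 := kap_gt0 G j.
rewrite invrK in l2.
have A1 : av j (fun y => h y * sg y `^ P^-1 * sg y `^ (1 - P^-1)) x = av j (fun y => h y * sg y) x.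
  by apply: eq_av => y _; rewrite E3.
have A2 : av j (fun y => (h y * sg y `^ P^-1) `^ P) x = av j (fun y => h y `^ P * sg y) x.
  by apply: eq_av => y _; rewrite E1.
have A3 : av j (fun y => (sg y `^ (1 - P^-1)) `^ (1 - P^-1)^-1) x = av j sg x.
  by apply: eq_av => y _; rewrite E2.
rewrite A1 A2 A3 in l2.
have a1 : 0 <= av j (fun y => h y `^ P * sg y) x by apply: av_ge0 => y; rewrite mulr_ge0 ?powR_ge0// ltW.
have a2 : 0 <= av j sg x by apply: av_ge0 => y; exact: ltW.
rewrite !S_av; apply: le_trans (ler_wpM2l (ltW k0) l2) _.
rewrite [X in _ <= X * _](powRM _ (ltW k0) a1) [X in _ <= _ * X](powRM _ (ltW k0) a2).
rewrite mulrACA -powRD ?(gt_eqF k0) ?implybT// (addrC P^-1) subrK powRr1// ltW//.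
Qed.

(** Points where [h] is at most half of its weighted mean contribute at most half of the integral,
    which is absorbed on the left. *)
Lemma S_gt_half j h sg x : lfin sg -> (forall y, 0 < sg y) -> measurable_fun setT h ->
  (forall y, 0 <= h y) -> lfin (fun y => h y * sg y) ->
  S j (fun y => h y * sg y) x <=
  2 * S j (fun y => \1_[set z | S j (fun y => h y * sg y) z / S j sg z < 2 * h z] y * (h y * sg y)) x.
Proof.
move=> fs s0 mh h0 fh.
set E := [set z | _].
have aux (p1 p2 : R) : p1 <= p2 + p1 / 2 -> p1 <= 2 * p2 by lra.
have S0 y : 0 < S j sg y by exact: S_gt0.
have mE : measurable E.
  have -> : E = ~` [set z | 2 * h z <= S j (fun y => h y * sg y) z / S j sg z].
    by apply/seteqP; split=> z; rewrite /E/= ltNge => /negP.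
  apply: measurableC; rewrite -[X in measurable X]setTI.
  apply: measurable_fun_le => //; first by mfun.
  apply: measurable_funM; first exact: measurable_S.
  by apply: measurable_inv => //; exact: measurable_S.
pose c := S j (fun y => h y * sg y) x / S j sg x.
have c0 : 0 <= c.
  apply: divr_ge0; last exact: ltW.
  by apply: S_ge0 => y; apply: mulr_ge0 => //; exact: ltW.
have c20 : 0 <= c / 2 by rewrite divr_ge0.
have fE : lfin (fun y => \1_E y * (h y * sg y)) by exact: lfin_ind.
have le : S j (fun y => h y * sg y) x <= S j (fun y => \1_E y * (h y * sg y) + c / 2 * sg y) x.
  apply: le_S => //; first by apply: lfinD => //; exact: lfinZ.
  move=> y xy; rewrite indicE; have [|] := boolP (y \in E).
    by rewrite mul1r lerDl mulr_ge0// ltW.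
  move=> yE; rewrite mul0r add0r; apply: ler_wpM2r; first exact: ltW.
  rewrite leNgt; apply/negP => hlt; move: yE; rewrite mem_set//.
  by rewrite /E/= (S_cell _ xy) (S_cell sg xy) -ltr_pdivrMl// mulrC.
rewrite SD// in le; last exact: lfinZ.
rewrite SZ// in le.
have cE : c / 2 * S j sg x = S j (fun y => h y * sg y) x / 2.
  by rewrite /c mulrAC divfK// gt_eqF.
rewrite cE in le; exact: aux.
Qed.

End embedding.

Section uniform_embedding.
Context {d} {T : measurableType d} {R : realType}.
Context {m : {sigma_finite_measure set T -> \bar R}} {D : R}.
Implicit Types (G : dyadic m D) (j i : nat) (x y : T) (b f g h u v mu lam : T -> R) (a t : R).
Local Notation Q := cell.
Local Notation S := cell_int.
Hint Resolve measurable_cell : core.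

(** By [S_gt_half] one factor of the weighted mean is replaced by [2 * h], restricted to points
    where the mean is below [2 * h]. Interchanging sum and integral leaves a pointwise sum over the
    nested cells around [x]; it is at most a constant times [(2 * h) ^ (P - 1)], and multiplication
    by [h] restores the [P]-th power. *)
Theorem embedding P q th : 1 < P -> P < q -> 0 < th < 1 -> exists C, 0 < C /\
  forall G sg h, lfin G sg -> (forall y, 0 < sg y) ->
  (forall j x, S G j.+1 sg x <= th * S G j sg x) ->
  measurable_fun setT h -> (forall y, 0 <= h y) ->
  (\int[m]_x (h x `^ P * sg x)%:E <= 1)%E -> forall n,
  (\sum_(j < n) \int[m]_x ((S G j (fun y => h y * sg y) x / S G j sg x) `^ q *
     S G j sg x `^ (q / P - 1) * sg x)%:E <= C%:E)%E.
Proof.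
move=> P1 Pq th01.
have P0 : 0 < P by exact: lt_trans P1.
have q0 : 0 < q by exact: lt_trans Pq.
have q1 : 0 < q - 1 by rewrite subr_gt0 (lt_trans P1).
have Pi1 : P^-1 < 1 by rewrite invf_lt1.
have al0 : 0 < q / P - 1 by rewrite subr_gt0 ltr_pdivlMr// mul1r.
have be0 : 0 < 1 - P^-1 by rewrite subr_gt0.
have [C [C0 geo]] := geometric_min_sum al0 be0 th01.
have PC0 : 0 < 2 * (C * 2 `^ (P - 1)) by rewrite !mulr_gt0// powR_gt0.
exists (2 * (C * 2 `^ (P - 1))); split=> // G sg h fs s0 dbl mh h0 hint n.
have ms := lfin_meas fs.
have sg0 j x : 0 < S G j sg x by exact: S_gt0.
have hP0 x : 0 <= h x `^ P * sg x by rewrite mulr_ge0 ?powR_ge0// ltW.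
have mhP : measurable_fun setT (fun x => h x `^ P * sg x) by mfun.
have fhP : lfin G (fun x => h x `^ P * sg x).
  split=> // x; apply: le_lt_trans (le_lt_trans hint (ltry 1)).
  by apply: ge0_subset_integral => //; [mfun|move=> y _; rewrite lee_fin].
have SP1 j x : S G j (fun x => h x `^ P * sg x) x <= 1.
  rewrite -lee_fin SE//; apply: le_trans hint.
  by apply: ge0_subset_integral => //; [mfun|move=> y _; rewrite lee_fin].
have fh : lfin G (fun y => h y * sg y).
  split=> [|y|x]; [by mfun|by apply: mulr_ge0 => //; exact: ltW|].
  by have [l _] := S_holder_weight 0 x P1 mh h0 fs s0 fhP; exact: lfin_int.
pose hj j x := S G j (fun y => h y * sg y) x / S G j sg x.
have hj0 j x : 0 <= hj j x.
  apply: divr_ge0; last exact: ltW.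
  by apply: S_ge0 => y; apply: mulr_ge0 => //; exact: ltW.
have mhj j : measurable_fun setT (hj j).
  apply: measurable_funM; first exact: measurable_S.
  by apply: measurable_inv => //; exact: measurable_S.
(* Hoelder and the unit bound on [h]. It controls large cells, where the bound by [2 * h] is too
   weak. *)
have hjle j x : hj j x <= (S G j sg x `^ P^-1)^-1.
  rewrite /hj ler_pdivrMr//.
  have [_ le] := S_holder_weight j x P1 mh h0 fs s0 fhP.
  have le1 : S G j (fun x => h x `^ P * sg x) x `^ P^-1 <= 1.
    have Pi0 : 0 <= P^-1 by rewrite invr_ge0 ltW.
    by have := le_powR Pi0 (S_ge0 G j x hP0) (SP1 j x); rewrite powR1.
  apply: le_trans le _; apply: le_trans (ler_wpM2r (powR_ge0 _ _) le1) _.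
  have h1 : S G j sg x `^ (1 - P^-1) = S G j sg x * (S G j sg x `^ P^-1)^-1.
    rewrite -powRN powRD; last by rewrite (gt_eqF (sg0 _ _)) implybT.
    by rewrite powRr1// ltW.
  by rewrite mul1r h1 mulrC.
pose W j x := hj j x `^ (q - 1) * S G j sg x `^ (q / P - 1).
have W0 j x : 0 <= W j x by rewrite mulr_ge0 ?powR_ge0.
have mW j : measurable_fun setT (W j).
  have ? := mhj j; have ? := measurable_S j fs.
  by rewrite /W; mfun.
have Wc j x y : Q G j x y -> W j y = W j x.
  by move=> xy; rewrite /W /hj !(S_cell _ xy).
pose E j := [set z | hj j z < 2 * h z].
have mE j : measurable (E j).
  have -> : E j = ~` [set z | 2 * h z <= hj j z].
    by apply/seteqP; split=> z; rewrite /E/= ltNge => /negP.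
  apply: measurableC; rewrite -[X in measurable X]setTI.
  by apply: measurable_fun_le => //; mfun.
have step j : (\int[m]_x (hj j x `^ q * S G j sg x `^ (q / P - 1) * sg x)%:E <=
   \int[m]_x (2 * (h x * sg x * (\1_(E j) x * W j x)))%:E)%E.
  have fE : lfin G (fun y => \1_(E j) y * (h y * sg y)) by exact: lfin_ind.
  rewrite (eq_integral (fun x => (W j x * hj j x * sg x)%:E)); last first.
    move=> x _; congr (_%:E); rewrite /W; congr (_ * _); rewrite mulrAC; congr (_ * _).
    have [->|hn0] := eqVneq (hj j x) 0.
      by rewrite mulr0 powR0// gt_eqF.
    have := @powRD R (hj j x) (q - 1) 1; rewrite hn0 implybT subrK powRr1//.
    by apply.
  rewrite [in leRHS](eq_integral (fun x => (2 * W j x * (\1_(E j) x * (h x * sg x)))%:E)); last first.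
    by move=> x _; congr (_%:E); ring.
  rewrite (@integral_cell_cst _ _ _ _ _ G j (fun x => W j x * hj j x))//; last 3 first.
  - by have ? := mW j; have ? := mhj j; mfun.
  - by move=> x; rewrite mulr_ge0.
  - by move=> x y xy; rewrite (Wc _ _ _ xy) /hj !(S_cell _ xy).
  rewrite [leRHS](@integral_cell_cst _ _ _ _ _ G j (fun x => 2 * W j x))//; last 3 first.
  - by have ? := mW j; mfun.
  - by move=> x; rewrite mulr_ge0.
  - by move=> x y xy; rewrite (Wc _ _ _ xy).
  have k0 := kap_gt0 G j; have mS1 := measurable_S j fs; have mS2 := measurable_S j fE.
  have mW' := mW j; have mh' := mhj j.
  apply: ge0_le_integral => //.
  - move=> x _; rewrite lee_fin; apply: mulr_ge0; first exact: mulr_ge0.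
    by apply: divr_ge0; exact: ltW.
  - by mfun.
  - by mfun.
  move=> x _; rewrite lee_fin.
  have H := S_gt_half j x fs s0 mh h0 fh.
  have H2 : hj j x * S G j sg x = S G j (fun y => h y * sg y) x by rewrite /hj divfK ?gt_eqF.
  rewrite -H2 in H; have := ler_wpM2l (W0 j x) H.
  have ki : 0 <= (kap G j)^-1 by rewrite invr_ge0 ltW.
  move/(ler_wpM2r ki); congr (_ <= _); ring.
have mterm j : measurable_fun setT (fun x => (2 * (h x * sg x * (\1_(E j) x * W j x)))%:E).
  by have ? := mW j; have ? := mE j; mfun.
apply: (@le_trans _ _ (\sum_(j < n) \int[m]_x (2 * (h x * sg x * (\1_(E j) x * W j x)))%:E)%E).
  by apply: lee_sum => j _; exact: step.
rewrite -(@ge0_integral_sum _ _ _ m setT measurableT _ (fun (j : 'I_n) x => (2 * (h x * sg x * (\1_(E j) x * W j x)))%:E))//; last first.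
  move=> j x _; rewrite lee_fin; apply: mulr_ge0 => //; apply: mulr_ge0; last exact: mulr_ge0.
  by apply: mulr_ge0 => //; exact: ltW.
have point x : \sum_(j < n) \1_(E j) x * W j x <= C * (2 * h x) `^ (P - 1).
  have [M EM] : exists M, M = 2 * h x by eexists.
  have [M0|M0] := eqVneq M 0.
    rewrite big1; first by rewrite mulr_ge0 ?powR_ge0 ?ltW.
    move=> j _; rewrite indicE memNset ?mul0r// /E/= -EM M0.
    by apply/negP; rewrite -leNgt.
  have Mgt0 : 0 < M by rewrite lt_neqAle eq_sym M0 EM mulr_ge0.
  have MP0 : 0 < M `^ P by rewrite powR_gt0.
  rewrite -EM.
  (* The two bounds for [hj], by [M] and by [S ^ - P^-1], give [W j <= M ^ (P - 1) * min (t ^ (q / P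
     - 1), t ^ - (1 - P^-1))]. The first exponent is positive because [P < q]. *)
  pose t j := M `^ P * S G j sg x.
  have t0 j : 0 < t j by rewrite mulr_gt0.
  have tS j : t j.+1 <= th * t j.
    by rewrite /t mulrCA; apply: ler_wpM2l; [exact: ltW|exact: dbl].
  have := geo t t0 tS n; rewrite -(ler_pM2r (powR_gt0 (P - 1) Mgt0)).
  apply: le_trans; rewrite mulr_suml; apply: ler_sum => j _.
  have rhs0 : 0 <= Num.min (t j `^ (q / P - 1)) ((t j `^ (1 - P^-1))^-1) * M `^ (P - 1).
    by apply: mulr_ge0; rewrite ?powR_ge0// le_min powR_ge0 invr_ge0 powR_ge0.
  rewrite indicE; have [|_] := boolP (x \in E j); last by rewrite mul0r.
  rewrite inE /E/= -EM => hM; rewrite mul1r.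
  rewrite -ler_pdivrMr ?powR_gt0// le_min.
  have Sj := sg0 j x; have Sp := powR_ge0 (S G j sg x) (q / P - 1).
  apply/andP; split.
  - have -> : t j `^ (q / P - 1) = M `^ (q - P) * S G j sg x `^ (q / P - 1).
      rewrite /t powRM ?powR_ge0 ?(ltW Sj)// -powRrM mulrBr mulr1 mulrCA.
      by rewrite mulfV ?mulr1// gt_eqF.
    rewrite ler_pdivrMr ?powR_gt0// mulrAC -powRD; last by rewrite M0 implybT.
    have -> : q - P + (P - 1) = q - 1 by ring.
    apply: ler_wpM2r => //; apply: le_powR; [exact: ltW|exact: hj0|exact: ltW].
  - have -> : (t j `^ (1 - P^-1))^-1 = (M `^ (P - 1))^-1 * (S G j sg x `^ (1 - P^-1))^-1.
      rewrite /t powRM ?powR_ge0 ?(ltW Sj)// -powRrM mulrBr mulr1 mulfV ?invfM//.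
      by rewrite gt_eqF.
    rewrite mulrC; apply: ler_wpM2l; first by rewrite invr_ge0 powR_ge0.
    have h1 := le_powR (ltW q1) (hj0 j x) (hjle j x).
    apply: le_trans (ler_wpM2r Sp h1) _.
    rewrite -powRN -powRrM -powRD; last by rewrite (gt_eqF Sj) implybT.
    rewrite -powRN le_eqVlt; apply/orP; left; apply/eqP; congr (_ `^ _).
    by field; rewrite gt_eqF.
apply: (@le_trans _ _ (\int[m]_x ((2 * (C * 2 `^ (P - 1))) * (h x `^ P * sg x))%:E)%E).
  apply: ge0_le_integral => //.
  - move=> x _; apply: sume_ge0 => j _; rewrite lee_fin; apply: mulr_ge0 => //.
    by apply: mulr_ge0; [apply: mulr_ge0 => //; exact: ltW|exact: mulr_ge0].
  - by apply: emeasurable_sum => j.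
  - by mfun.
  - move=> x _; rewrite sumEFin lee_fin -mulr_sumr -mulr_sumr.
    have hs0 : 0 <= h x * sg x by apply: mulr_ge0 => //; exact: ltW.
    apply: le_trans (ler_wpM2l _ (ler_wpM2l hs0 (point x))) _ => //.
    rewrite powRM//.
    have hP : h x * h x `^ (P - 1) = h x `^ P.
      have [->|hx] := eqVneq (h x) 0; first by rewrite mul0r powR0// gt_eqF.
      have := @powRD R (h x) (P - 1) 1; rewrite hx implybT subrK powRr1// => /(_ isT) ->.
      exact: mulrC.
    by rewrite -hP le_eqVlt; apply/orP; left; apply/eqP; ring.
rewrite (eq_integral (fun x => (2 * (C * 2 `^ (P - 1)))%:E * (h x `^ P * sg x)%:E)%E); last by move=> x _; rewrite -EFinM.
rewrite ge0_integralZl//.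
- by rewrite -[leRHS]mule1; apply: lee_wpmul2l => //; rewrite lee_fin ltW.
- by mfun.
- by move=> x _; rewrite lee_fin.
- by rewrite lee_fin ltW.
Qed.

End uniform_embedding.

(** * The bilinear form on one grid *)

Section bilinear.
Context {d} {T : measurableType d} {R : realType}.
Context {m : {sigma_finite_measure set T -> \bar R}} {D : R}.
Variable G : dyadic m D.
Implicit Types (j i : nat) (x y : T) (b f g h u v mu lam : T -> R) (a t : R).
Local Notation Q := (cell G).
Local Notation kap := (kap G).
Local Notation lfin := (lfin G).
Local Notation labs := (labs G).
Local Notation mean := (mean G).
Local Notation S := (cell_int G).
Local Notation av := (cell_av G).
Hint Resolve measurable_cell : core.

Lemma lfin_cell_ind j x f : measurable_fun setT f -> (forall y, 0 <= f y) ->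
  (\int[m]_(y in Q j x) (f y)%:E < +oo)%E -> lfin (fun y => \1_(Q j x) y * f y).
Proof.
move=> mf f0 fi; have mi : measurable_fun setT (\1_(Q j x) : T -> R).
  exact: measurable_indic.
split=> [|y|z]; [by mfun|by rewrite mulr_ge0|].
apply: (@le_lt_trans _ _ (\int[m]_y (\1_(Q j x) y * f y)%:E)%E).
  apply: ge0_subset_integral => //; first by mfun.
  by move=> y _; rewrite lee_fin mulr_ge0.
rewrite (_ : (\int[m]_y (\1_(Q j x) y * f y)%:E)%E = (\int[m]_(y in Q j x) (f y)%:E)%E)//.
rewrite [RHS]integral_mkcond; apply: eq_integral => y _.
by rewrite epatch_indic/= -EFinM mulrC.
Qed.

Lemma S_cell_ind i j f x : (j <= i)%N -> S j (fun y => \1_(Q i x) y * f y) x = S i f x.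
Proof.
move=> ji; rewrite !S_def; congr fine.
rewrite integral_mkcond [RHS]integral_mkcond; apply: eq_integral => y _.
rewrite !epatch_indic/= -!EFinM; congr EFin; rewrite !indicE.
have [|_] := boolP (y \in Q i x); last by rewrite mul0r mul0r mulr0.
by rewrite inE => xy; rewrite mem_set ?mul1r ?mulr1//; exact: cell_le xy.
Qed.

Lemma inner_bound a1 r j b h sg x (k : nat) : (0 < k)%N -> 1 < a1 -> a1 < r ->
  labs b -> lfin sg -> (forall y, 0 < sg y) -> measurable_fun setT h -> (forall y, 0 <= h y) ->
  lfin (fun y => h y `^ (1 - r^-1)^-1 * sg y) ->
  (\int[m]_(y in Q j x) (`|b y - mean j b x| `^ (k%:R * r) * sg y)%:E < +oo)%E ->
  (\int[m]_(y in Q j x) (`|b y - mean j b x| ^+ k * (h y * sg y))%:E <=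
   (S j (fun y => `|b y - mean j b x| `^ (k%:R * r) * sg y) x `^ r^-1 *
    S j (fun y => h y `^ (1 - r^-1)^-1 * sg y) x `^ (1 - r^-1))%:E)%E.
Proof.
move=> k0 a11 ar fb fs s0 mh h0 fh X; have ms := lfin_meas fs; have [mb _] := fb.
have r1 : 1 < r by exact: lt_trans ar.
have r0 : 0 < r by exact: lt_trans r1.
have ri1 : r^-1 < 1 by rewrite invf_lt1.
have s'0 : 0 < (1 - r^-1)^-1 by rewrite invr_gt0 subr_gt0.
have conj : r^-1 + (1 - r^-1)^-1^-1 = 1 by rewrite invrK addrC subrK.
have mi : measurable_fun setT (\1_(Q j x) : T -> R) by exact: measurable_indic.
pose be := mean j b x.
(* The integral is only assumed finite on this cell, around whose mean the oscillation is taken; the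
   cutoff makes the function admissible on all cells. *)
pose f1 y := \1_(Q j x) y * (`|b y - be| ^+ k * sg y `^ r^-1).
pose f2 y := h y * sg y `^ (1 - r^-1).
have E1 y : f1 y `^ r = \1_(Q j x) y * (`|b y - be| `^ (k%:R * r) * sg y).
  rewrite /f1 indicE; case: (_ \in _); last by rewrite !mul0r powR0// gt_eqF.
  rewrite !mul1r powRM ?exprn_ge0 ?powR_ge0// powRVK ?(ltW (s0 y))//.
  by rewrite -powR_mulrn// -powRrM.
have E2 y : f2 y `^ (1 - r^-1)^-1 = h y `^ (1 - r^-1)^-1 * sg y.
  by rewrite /f2 powRM ?powR_ge0// powRKV ?subr_gt0// ltW.
have E3 y : f1 y * f2 y = \1_(Q j x) y * (`|b y - be| ^+ k * (h y * sg y)).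
  have := @powRD R (sg y) r^-1 (1 - r^-1); rewrite (gt_eqF (s0 y)) implybT => /(_ isT).
  rewrite addrC subrK powRr1 ?(ltW (s0 y))// => e.
  by rewrite /f1 /f2 [X in _ = _ * (_ * (_ * X))]e; ring.
have [] := @av_holder _ _ _ _ _ G r (1 - r^-1)^-1 j f1 f2 x r0 s'0 conj.
- by rewrite /f1; mfun.
- by rewrite /f2; mfun.
- by move=> y; rewrite /f1 !mulr_ge0// ?exprn_ge0 ?powR_ge0.
- by move=> y; rewrite /f2 !mulr_ge0// powR_ge0.
- have l : lfin (fun y => \1_(Q j x) y * (`|b y - be| `^ (k%:R * r) * sg y)).
    apply: lfin_cell_ind => //; first by mfun.
    by move=> y; rewrite mulr_ge0 ?powR_ge0// ltW.
  by apply: eq_lfin l => y; rewrite E1.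
- by apply: eq_lfin fh => y; rewrite E2.
move=> l3 le; rewrite invrK in le.
have Qx y : Q j x y -> \1_(Q j x) y = 1 :> R by move=> xy; rewrite indicE mem_set.
have A1 : av j (fun y => f1 y `^ r) x = av j (fun y => `|b y - be| `^ (k%:R * r) * sg y) x.
  by apply: eq_av => y xy; rewrite E1 Qx// mul1r.
have A2 : av j (fun y => f2 y `^ (1 - r^-1)^-1) x = av j (fun y => h y `^ (1 - r^-1)^-1 * sg y) x.
  by apply: eq_av => y xy; rewrite E2.
rewrite A1 A2 in le.
rewrite (eq_integral (fun y => (f1 y * f2 y)%:E)); last first.
  by move=> y; rewrite inE => xy; rewrite E3 Qx// mul1r.
rewrite -SE// lee_fin !S_av.
have k0' := kap_gt0 G j.
apply: le_trans (ler_wpM2l (ltW k0') le) _.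
have a10 : 0 <= av j (fun y => `|b y - be| `^ (k%:R * r) * sg y) x.
  by apply: av_ge0 => y; rewrite mulr_ge0 ?powR_ge0// ltW.
have a20 : 0 <= av j (fun y => h y `^ (1 - r^-1)^-1 * sg y) x.
  by apply: av_ge0 => y; rewrite mulr_ge0 ?powR_ge0// ltW.
rewrite [X in _ <= X * _](powRM _ (ltW k0') a10) [X in _ <= _ * X](powRM _ (ltW k0') a20).
have kE : kap j = kap j `^ r^-1 * kap j `^ (1 - r^-1).
  have := @powRD R (kap j) r^-1 (1 - r^-1); rewrite (gt_eqF k0') implybT => /(_ isT) <-.
  by rewrite addrC subrK powRr1// ltW.
by rewrite [X in _ <= X]mulrACA -kE.
Qed.

Lemma lfin_Lp P h sg : measurable_fun setT h -> (forall y, 0 <= h y) ->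
  lfin sg -> (forall y, 0 < sg y) ->
  (\int[m]_x (h x `^ P * sg x)%:E <= 1)%E -> lfin (fun x => h x `^ P * sg x).
Proof.
move=> mh h0 fs s0 hint; have ms := lfin_meas fs.
split=> [|y|x]; [by mfun|by rewrite mulr_ge0 ?powR_ge0// ltW|].
apply: le_lt_trans (le_lt_trans hint (ltry 1)).
apply: ge0_subset_integral => //; first by mfun.
by move=> y _; rewrite lee_fin mulr_ge0 ?powR_ge0// ltW.
Qed.

Lemma lfin_Ls P s h sg : 0 < s -> s < P -> measurable_fun setT h -> (forall y, 0 <= h y) ->
  lfin sg -> (forall y, 0 < sg y) -> lfin (fun x => h x `^ P * sg x) ->
  lfin (fun x => h x `^ s * sg x).
Proof.
move=> s0' sP mh h0 fs s0 fh.
have P1 : 1 < P / s by rewrite ltr_pdivlMr// mul1r.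
have mhs : measurable_fun setT (fun y => h y `^ s) by mfun.
have fh' : lfin (fun y => (h y `^ s) `^ (P / s) * sg y).
  by apply: eq_lfin fh => y; rewrite -powRrM (mulrC s) divfK// gt_eqF.
have ms := lfin_meas fs; split=> [|y|x]; [by mfun|by rewrite mulr_ge0 ?powR_ge0// ltW|].
have [l _] := S_holder_weight 0 x P1 mhs (fun y => powR_ge0 _ _) fs s0 fh'.
exact: lfin_int.
Qed.

End bilinear.

Section uniform_doubling.
Context {d} {T : measurableType d} {R : realType}.
Context {m : {sigma_finite_measure set T -> \bar R}} {D : R}.
Implicit Types (G : dyadic m D) (j i : nat) (x y : T) (b f g h u v mu lam : T -> R) (a t : R).
Local Notation Q := cell.
Local Notation S := cell_int.
Hint Resolve measurable_cell : core.

(** A child fills the fraction [D^-1], at most one half, of its parent, so [Ainf] applies with [E]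
    the child. *)
Lemma Aw_doubling a1 a2 K : 2 <= D -> 1 < a1 -> 1 < a2 -> a1^-1 + a2^-1 < 1 -> 1 <= K ->
  exists th, 0 < th < 1 /\ forall G mu, dyadic_Apq G a1 a2 K mu -> forall j x,
   S G j.+1 (fun y => (mu y)^-1 `^ a1) x <= th * S G j (fun y => (mu y)^-1 `^ a1) x.
Proof.
move=> D2 a11 a21 a12 K1.
have a10 : 0 < a1 by exact: lt_trans a11.
have K20 : 0 < (2 * K)^-1 by rewrite invr_gt0; lra.
have K21 : (2 * K)^-1 < 1 by rewrite invf_lt1; lra.
exists (1 - ((2 * K)^-1) `^ a1); split.
  rewrite subr_gt0 ltrBlDr ltrDl powR_gt0// andbT.
  have := @gt0_ltr_powR R a1 a10 (2 * K)^-1 1; rewrite !nnegrE (ltW K20) ler01 powR1.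
  by apply.
move=> G mu Amu j x; have jS := leqnSn j.
rewrite -(S_cell_ind G _ _ jS); apply: (Aw_Ainf a11 a21 a12 K1 Amu) => //.
have E1 : S G j (\1_(Q G j.+1 x) : T -> R) x = kap G j.+1.
  have := S_cell_ind G (fun=> 1) x jS; rewrite S_cst mul1r => <-.
  by apply: eq_S => y _; rewrite mulr1.
by rewrite E1 [in leRHS]kapS ler_pM2r// kap_gt0.
Qed.

End uniform_doubling.

Lemma young_pow (R : realType) (u z p q : R) : 1 < p -> 0 <= u -> 0 <= z ->
  p^-1 + q^-1 = 1 -> u * z <= u `^ p + z `^ q.
Proof.
move=> p1 u0 z0 pq.
have p0 : 0 < p by exact: lt_trans p1.
have pi1 : p^-1 < 1 by rewrite invf_lt1.
have pi0 : 0 < p^-1 by rewrite invr_gt0.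
have qi0 : 0 < q^-1 by move: pq pi1; lra.
have q0 : 0 < q by rewrite -invr_gt0.
have qi1 : q^-1 < 1 by move: pq pi0; lra.
apply: le_trans (conjugate_powR u0 z0 p0 q0 pq) _.
by apply: lerD; rewrite -[leRHS]mulr1; apply: ler_wpM2l; rewrite ?powR_ge0// ltW.
Qed.

Lemma powR_ratio_split (R : realType) (H c s p e : R) : 0 <= H -> 0 < c -> e = s - p ->
  H `^ s = (H / c) `^ s * c `^ p * c `^ e.
Proof.
move=> H0 c0 ->; have := @powRD R c p (s - p); rewrite (gt_eqF c0) implybT => /(_ isT) E.
rewrite -mulrA -E addrC subrK -powRM ?divfK ?gt_eqF ?(ltW c0)//.
by rewrite divr_ge0// ltW.
Qed.

Lemma mul_div_le (R : realType) (X A W u c k : R) : 0 < W -> 0 <= u ->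
  X * A * W <= c * k -> X * (u * A) <= c * (k * (u * W^-1)).
Proof.
move=> W0 u0 le; rewrite (_ : c * (k * (u * W^-1)) = c * k * u / W); last by ring.
rewrite ler_pdivlMr// (_ : X * (u * A) * W = X * A * W * u); last by ring.
exact: ler_wpM2r.
Qed.

Section bilinear.
Context {d} {T : measurableType d} {R : realType}.
Context {m : {sigma_finite_measure set T -> \bar R}} {D : R}.
Variable G : dyadic m D.
Implicit Types (j i : nat) (x y : T) (b f g h u v mu lam : T -> R) (a t : R).
Local Notation Q := (cell G).
Local Notation kap := (kap G).
Local Notation lfin := (lfin G).
Local Notation labs := (labs G).
Local Notation mean := (mean G).
Local Notation S := (cell_int G).
Hint Resolve measurable_cell : core.

(** The bound for [I j] is constant on cells, so [g * w] may be replaced by its cell integral. What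
    remains is a product of one factor in [h] and one in [g]; Young's inequality with [r1] and [r2]
    separates them, and each power is an integrand of an embedding sum. *)
Lemma bilinear_core (s p q' r1 r2 al CB C2 C3 : R) (c : nat -> R) sg w h g
    (I : nat -> T -> \bar R) n :
  1 < r1 -> r1^-1 + r2^-1 = 1 -> q'^-1 = 1 - al -> 0 <= CB -> (forall j, 0 < c j) ->
  lfin sg -> lfin w -> (forall y, 0 < sg y) -> (forall y, 0 < w y) ->
  measurable_fun setT h -> (forall y, 0 <= h y) ->
  measurable_fun setT g -> (forall y, 0 <= g y) ->
  lfin (fun y => h y `^ s * sg y) -> lfin (fun y => g y * w y) ->
  (forall j, measurable_fun setT (I j)) -> (forall j x, 0 <= I j x)%E ->
  (forall j x, I j x <= (CB * (c j *
    ((S j (fun y => h y `^ s * sg y) x / S j sg x) `^ s^-1 * S j sg x `^ p^-1 *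
     (S j w x `^ al)^-1)))%:E)%E ->
  (\sum_(j < n) \int[m]_x ((S j (fun y => h y `^ s * sg y) x / S j sg x) `^ (r1 / s) *
     S j sg x `^ (r1 / p - 1) * sg x)%:E <= C2%:E)%E ->
  (\sum_(j < n) \int[m]_x ((S j (fun y => g y * w y) x / S j w x) `^ r2 *
     S j w x `^ (r2 / q' - 1) * w x)%:E <= C3%:E)%E ->
  (\sum_(j < n) (c j)^-1%:E * \int[m]_x ((g x * w x)%:E * I j x) <= (CB * (C2 + C3))%:E)%E.
Proof.
move=> r11 r12 qE CB0 c0 fs fw sg0 w0 mh h0 mg g0 fhs fg mI I0 inner emb1 emb2.
have msg := lfin_meas fs; have mw := lfin_meas fw.
have Ss0 j x : 0 < S j sg x by exact: S_gt0.
have Sw0 j x : 0 < S j w x by exact: S_gt0.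
have Sh0 j x : 0 <= S j (fun y => h y `^ s * sg y) x.
  by apply: S_ge0 => y; rewrite mulr_ge0 ?powR_ge0// ltW.
have Sg0 j x : 0 <= S j (fun y => g y * w y) x.
  by apply: S_ge0 => y; rewrite mulr_ge0// ltW.
pose u j x := (S j (fun y => h y `^ s * sg y) x / S j sg x) `^ s^-1 * S j sg x `^ p^-1.
pose F j x := u j x * (S j w x `^ al)^-1.
have u0 j x : 0 <= u j x by rewrite mulr_ge0 ?powR_ge0.
have F0 j x : 0 <= F j x by rewrite mulr_ge0// invr_ge0 powR_ge0.
have mu' j : measurable_fun setT (u j).
  have ? := measurable_S j fhs; have ? := measurable_S j fs.
  have ? : measurable_fun setT (fun x => (S j sg x)^-1) by exact: measurable_inv.
  by rewrite /u; mfun.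
have mF j : measurable_fun setT (F j).
  have ? := mu' j; have ? := measurable_S j fw.
  have ? : measurable_fun setT (fun x => (S j w x `^ al)^-1).
    by apply: measurable_inv; [mfun|move=> x; rewrite powR_gt0].
  by rewrite /F; mfun.
have Fc j x y : Q j x y -> F j y = F j x by move=> xy; rewrite /F /u !(S_cell _ xy).
pose U j x := (S j (fun y => h y `^ s * sg y) x / S j sg x) `^ (r1 / s) * S j sg x `^ (r1 / p - 1) * sg x.
pose V j x := (S j (fun y => g y * w y) x / S j w x) `^ r2 * S j w x `^ (r2 / q' - 1) * w x.
have U0 j x : 0 <= U j x by apply: mulr_ge0; [rewrite mulr_ge0 ?powR_ge0|exact: ltW].
have V0 j x : 0 <= V j x by apply: mulr_ge0; [rewrite mulr_ge0 ?powR_ge0|exact: ltW].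
have mUV j : measurable_fun setT (U j) /\ measurable_fun setT (V j).
  have ? := measurable_S j fhs; have ? := measurable_S j fs; have ? := measurable_S j fg; have ? := measurable_S j fw.
  have ? : measurable_fun setT (fun x => (S j sg x)^-1) by exact: measurable_inv.
  have ? : measurable_fun setT (fun x => (S j w x)^-1) by exact: measurable_inv.
  by rewrite /U /V; split; mfun.
have term j : ((c j)^-1%:E * \int[m]_x ((g x * w x)%:E * I j x) <=
   CB%:E * (\int[m]_x (U j x)%:E + \int[m]_x (V j x)%:E))%E.
  have kp0 := c0 j.
  apply: (@le_trans _ _ ((c j)^-1%:E * \int[m]_x (CB * c j * (F j x * (g x * w x)))%:E)%E).
    apply: lee_wpmul2l; first by rewrite lee_fin invr_ge0 ltW.
    apply: ge0_le_integral => //.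
    - by move=> x _; apply: mule_ge0 => //; rewrite lee_fin; apply: mulr_ge0 => //; exact: ltW.
    - by apply: emeasurable_funM => //; mfun.
    - by have ? := mF j; mfun.
    - move=> x _; have gw0 : (0 <= (g x * w x)%:E)%E by rewrite lee_fin mulr_ge0// ltW.
      apply: le_trans (lee_wpmul2l gw0 (inner j x)) _.
      by rewrite -EFinM lee_fin le_eqVlt; apply/orP; left; apply/eqP; rewrite /F /u; ring.
  rewrite (eq_integral (fun x => (CB * c j)%:E * (F j x * (g x * w x))%:E)%E); last first.
    by move=> x _; rewrite -EFinM.
  rewrite ge0_integralZl//; last 3 first.
  - by have ? := mF j; mfun.
  - move=> x _; rewrite lee_fin; apply: mulr_ge0 => //; apply: mulr_ge0 => //.
    exact: ltW.
  - by rewrite lee_fin mulr_ge0// ltW.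
  rewrite muleA -EFinM mulrCA mulVf ?gt_eqF// mulr1.
  apply: lee_wpmul2l; first by rewrite lee_fin.
  (* [WU] and [WV] are [U] and [V] without their last factors. They are constant on cells, which
     allows a pointwise comparison after averaging. *)
  pose WU x := (S j (fun y => h y `^ s * sg y) x / S j sg x) `^ (r1 / s) * S j sg x `^ (r1 / p - 1).
  pose WV x := (S j (fun y => g y * w y) x / S j w x) `^ r2 * S j w x `^ (r2 / q' - 1).
  have WU0 x : 0 <= WU x by rewrite mulr_ge0 ?powR_ge0.
  have WV0 x : 0 <= WV x by rewrite mulr_ge0 ?powR_ge0.
  have mS1 := measurable_S j fhs; have mS2 := measurable_S j fs.
  have mS3 := measurable_S j fg; have mS4 := measurable_S j fw.
  have mi1 : measurable_fun setT (fun x => (S j sg x)^-1) by exact: measurable_inv.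
  have mi2 : measurable_fun setT (fun x => (S j w x)^-1) by exact: measurable_inv.
  have mWU : measurable_fun setT WU.
    apply: measurable_funM.
      exact: (measurableT_comp (@measurable_powR R (r1 / s)) (measurable_funM mS1 mi1)).
    exact: (measurableT_comp (@measurable_powR R (r1 / p - 1)) mS2).
  have mWV : measurable_fun setT WV.
    apply: measurable_funM.
      exact: (measurableT_comp (@measurable_powR R r2) (measurable_funM mS3 mi2)).
    exact: (measurableT_comp (@measurable_powR R (r2 / q' - 1)) mS4).
  have WUc x y : Q j x y -> WU y = WU x by move=> xy; rewrite /WU !(S_cell _ xy).
  have WVc x y : Q j x y -> WV y = WV x by move=> xy; rewrite /WV !(S_cell _ xy).
  have mFj := mF j.
  rewrite (integral_cell_cst mFj (F0 j) (Fc j) fg).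
  have EU : (\int[m]_x (U j x)%:E = \int[m]_x (WU x * (S j sg x / kap j))%:E)%E.
    exact: (integral_cell_cst mWU WU0 WUc fs).
  have EV : (\int[m]_x (V j x)%:E = \int[m]_x (WV x * (S j w x / kap j))%:E)%E.
    exact: (integral_cell_cst mWV WV0 WVc fw).
  have k0' := kap_gt0 G j.
  rewrite EU EV -ge0_integralD//; last 4 first.
  - by move=> x _; rewrite lee_fin mulr_ge0// divr_ge0// ltW.
  - by mfun.
  - by move=> x _; rewrite lee_fin mulr_ge0// divr_ge0// ltW.
  - by mfun.
  apply: ge0_le_integral => //.
  - by move=> x _; rewrite lee_fin; apply: mulr_ge0 => //; rewrite divr_ge0// ltW.
  - by mfun.
  - by apply: emeasurable_funD; mfun.
  move=> x _; rewrite -EFinD lee_fin !mulrA -mulrDl; apply: ler_wpM2r.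
    by rewrite invr_ge0 ltW.
  (* Because [q'^-1 = 1 - al], this regroups the cell integral of [g * w] and the negative power of
     the mass of [w]. *)
  pose z := S j (fun y => g y * w y) x / S j w x * S j w x `^ q'^-1.
  have z0 : 0 <= z by rewrite mulr_ge0 ?powR_ge0// divr_ge0// ltW.
  have FE : F j x * S j (fun y => g y * w y) x = u j x * z.
    rewrite /F /z -mulrA; congr (_ * _).
    have -> : S j w x `^ q'^-1 = S j w x * (S j w x `^ al)^-1.
      have := @powRD R (S j w x) 1 (- al); rewrite (gt_eqF (Sw0 _ _)) implybT => /(_ isT).
      by rewrite powRr1 ?(ltW (Sw0 _ _))// -qE powRN.
    have Swn : S j w x != 0 by rewrite gt_eqF.
    by rewrite [RHS]mulrA divfK// mulrC.
  rewrite FE; apply: le_trans (young_pow r11 (u0 j x) z0 r12) _.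
  have pow1 (v : R) : 0 < v -> forall e : R, v `^ (e - 1) * v = v `^ e.
    move=> v0 e; have := @powRD R v (e - 1) 1; rewrite (gt_eqF v0) implybT => /(_ isT).
    by rewrite subrK powRr1 ?(ltW v0)// => ->.
  rewrite le_eqVlt; apply/orP; left; apply/eqP; congr (_ + _).
  - rewrite /u powRM ?powR_ge0// -!powRrM (mulrC s^-1) (mulrC p^-1) /WU -mulrA.
    by rewrite (pow1 _ (Ss0 j x)).
  - rewrite /z powRM ?powR_ge0 ?divr_ge0 ?(ltW (Sw0 _ _))// -powRrM (mulrC q'^-1) /WV -mulrA.
    by rewrite (pow1 _ (Sw0 j x)).
apply: (@le_trans _ _ (\sum_(j < n) CB%:E * (\int[m]_x (U j x)%:E + \int[m]_x (V j x)%:E))%E).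
  by apply: lee_sum => j _; exact: term.
have IU0 j : (0 <= \int[m]_x (U j x)%:E)%E by apply: integral_ge0 => x _; rewrite lee_fin.
have IV0 j : (0 <= \int[m]_x (V j x)%:E)%E by apply: integral_ge0 => x _; rewrite lee_fin.
rewrite -ge0_sume_distrr; last by move=> j _; exact: adde_ge0.
rewrite [leRHS]EFinM; apply: lee_wpmul2l; first by rewrite lee_fin.
by rewrite big_split/= EFinD; apply: leeD.
Qed.

Lemma exprD_le (u v : R) (k : nat) : 0 <= u -> 0 <= v ->
  (u + v) ^+ k <= 2 ^+ k * (u ^+ k + v ^+ k).
Proof.
move=> u0 v0; have := powRD_le (ler0n R k) u0 v0.
by rewrite !powR_mulrn// addr_ge0.
Qed.

Lemma exprB_dist (u v z : R) (k : nat) :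
  `|u - v| ^+ k <= 2 ^+ k * (`|v - z| ^+ k + `|u - z| ^+ k).
Proof.
apply: le_trans (exprD_le k (normr_ge0 _) (normr_ge0 _)).
apply: lerXn2r; [exact: normr_ge0|exact: addr_ge0|].
by rewrite (addrC `|_ - _|) (distrC v z); exact: ler_distD.
Qed.

Lemma measurable_kernel_cell j (F : T * T -> \bar R) : (forall z, 0 <= F z)%E ->
  measurable_fun setT F ->
  measurable_fun setT (fun x => \int[m]_(y in Q j x) F (x, y))%E.
Proof.
move=> F0 mF; pose I (z : T * T) : \bar R := (\1_[set z : T * T | Q j z.1 z.2] z)%:E.
have mI : measurable_fun setT (fun z => F z * I z)%E.
  apply: emeasurable_funM => //; rewrite /I; apply/measurable_EFinP; apply: measurable_indic.
  exact: measurable_cell_rel.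
have := @measurable_fun_fubini_tonelli_F _ _ _ _ _ m (fun z => F z * I z)%E mI.
have I0 z : (0 <= F z * I z)%E by rewrite mule_ge0// lee_fin.
move/(_ I0); apply: eq_measurable_fun => x _; rewrite /fubini_F.
rewrite [RHS]integral_mkcond; apply: eq_integral => y _.
by rewrite epatch_indic; congr (_ * _%:E)%E.
Qed.

Lemma integralZD (A : set T) (c : R) (f g : T -> \bar R) : measurable A -> 0 <= c ->
  (forall x, 0 <= f x)%E -> (forall x, 0 <= g x)%E ->
  measurable_fun A f -> measurable_fun A g ->
  (\int[m]_(x in A) (c%:E * (f x + g x)) = c%:E * (\int[m]_(x in A) f x + \int[m]_(x in A) g x))%E.
Proof.
move=> mA c0 f0 g0 mf mg.
rewrite (ge0_integralZl m mA (emeasurable_funD mf mg)) ?lee_fin//; last first.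
  by move=> x _; apply: adde_ge0.
by rewrite (ge0_integralD m mA _ mf _ mg).
Qed.

(** [|b x - b y|] is split at the mean over the common cell. The mean is the same for both points,
    so the part with [b x] becomes an inner integral after a Tonelli swap and has the same shape as
    the other part. *)
Lemma commutator_split j b (k : nat) (F H : T -> R) : labs b ->
  measurable_fun setT F -> (forall x, 0 <= F x) ->
  measurable_fun setT H -> (forall x, 0 <= H x) ->
  (\int[m]_x ((F x)%:E * \int[m]_(y in Q j x) (`|b x - b y| ^+ k * H y)%:E) <=
   (2 ^+ k)%:E * (\int[m]_x ((F x)%:E * \int[m]_(y in Q j x) (`|b y - mean j b x| ^+ k * H y)%:E)
      + \int[m]_x ((H x)%:E * \int[m]_(y in Q j x) (`|b y - mean j b x| ^+ k * F y)%:E)))%E.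
Proof.
move=> fb mF F0 mH H0; have [mb _] := fb; have mm := measurable_mean j fb.
pose dv y := `|b y - mean j b y| ^+ k.
have dv0 y : 0 <= dv y by exact: exprn_ge0.
have mdv : measurable_fun setT dv by rewrite /dv; mfun.
have EI (K : T -> R) x : (\int[m]_(y in Q j x) (`|b y - mean j b x| ^+ k * K y)%:E =
    \int[m]_(y in Q j x) (dv y * K y)%:E)%E.
  by apply: eq_integral => y; rewrite inE => xy; rewrite /dv (mean_cell _ xy).
have mdF : measurable_fun setT (fun y => (dv y * F y)%:E) by mfun.
have mdH : measurable_fun setT (fun y => (dv y * H y)%:E) by mfun.
have dF0 y : (0 <= (dv y * F y)%:E)%E by rewrite lee_fin mulr_ge0.
have dH0 y : (0 <= (dv y * H y)%:E)%E by rewrite lee_fin mulr_ge0.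
have eF0 y : (0 <= (F y)%:E)%E by rewrite lee_fin.
have eH0 y : (0 <= (H y)%:E)%E by rewrite lee_fin.
have meH : measurable_fun setT (fun y => (H y)%:E) by mfun.
have meF : measurable_fun setT (fun y => (F y)%:E) by mfun.
have E1 : (\int[m]_x ((F x)%:E * \int[m]_(y in Q j x) (`|b y - mean j b x| ^+ k * H y)%:E) =
    \int[m]_x ((F x)%:E * \int[m]_(y in Q j x) (dv y * H y)%:E))%E.
  by apply: eq_integral => x _; congr (_ * _)%E; exact: EI.
have E2 : (\int[m]_x ((H x)%:E * \int[m]_(y in Q j x) (`|b y - mean j b x| ^+ k * F y)%:E) =
    \int[m]_x ((dv x * F x)%:E * \int[m]_(y in Q j x) (H y)%:E))%E.
  rewrite -(integral_cell_swap G j eH0 dF0 meH mdF).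
  by apply: eq_integral => x _; congr (_ * _)%E; exact: EI.
have J0 x : (0 <= \int[m]_(y in Q j x) (H y)%:E)%E by exact: integral_ge0.
have J10 x : (0 <= \int[m]_(y in Q j x) (dv y * H y)%:E)%E by exact: integral_ge0.
have mJ : measurable_fun setT (fun x => \int[m]_(y in Q j x) (H y)%:E)%E.
  exact: measurable_integral_cell.
have mJ1 : measurable_fun setT (fun x => \int[m]_(y in Q j x) (dv y * H y)%:E)%E.
  exact: measurable_integral_cell.
have m1 : measurable_fun setT (fun x => (F x)%:E * \int[m]_(y in Q j x) (dv y * H y)%:E)%E.
  exact: emeasurable_funM.
have m2 : measurable_fun setT (fun x => (dv x * F x)%:E * \int[m]_(y in Q j x) (H y)%:E)%E.
  exact: emeasurable_funM.
have p1 x : (0 <= (F x)%:E * \int[m]_(y in Q j x) (dv y * H y)%:E)%E by exact: mule_ge0.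
have p2 x : (0 <= (dv x * F x)%:E * \int[m]_(y in Q j x) (H y)%:E)%E by exact: mule_ge0.
have mA := measurable_cell G j.
have [c Ec] : exists c : R, c = 2 ^+ k by eexists.
have c0 : 0 <= c by rewrite Ec exprn_ge0.
have cP x y : `|b x - b y| ^+ k <= c * (`|b y - mean j b x| ^+ k + `|b x - mean j b x| ^+ k).
  by rewrite Ec; exact: exprB_dist.
rewrite E1 E2 -Ec -(integralZD measurableT c0 p1 p2 m1 m2).
clear Ec E1 E2 EI.
have q0 x y : (0 <= (`|b x - b y| ^+ k * H y)%:E)%E.
  by rewrite lee_fin mulr_ge0// exprn_ge0.
have mq : measurable_fun setT (fun z : T * T => (`|b z.1 - b z.2| ^+ k * H z.2)%:E).
  have ? := measurableT_comp mb (@measurable_fst _ _ T T).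
  have ? := measurableT_comp mb (@measurable_snd _ _ T T).
  have ? := measurableT_comp mH (@measurable_snd _ _ T T).
  by mfun.
have mq1 x : measurable_fun setT (fun y => (`|b x - b y| ^+ k * H y)%:E).
  by clear -mb mH; mfun.
have mqi := measurable_kernel_cell j (fun z => q0 z.1 z.2) mq.
apply: ge0_le_integral; [exact: measurableT| | | |].
- by move=> x _; apply: (mule_ge0 (eF0 x)); apply: integral_ge0 => y _; exact: q0.
- exact: emeasurable_funM meF mqi.
- apply: emeasurable_funM; [exact: measurable_cst|exact: emeasurable_funD m1 m2].
move=> x _.
have kxy : (\int[m]_(y in Q j x) (`|b x - b y| ^+ k * H y)%:E <=
    c%:E * (\int[m]_(y in Q j x) (dv y * H y)%:E + (dv x)%:E * \int[m]_(y in Q j x) (H y)%:E))%E.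
  have dx0 : (0 <= (dv x)%:E)%E by rewrite lee_fin.
  have p3 y : (0 <= (dv x)%:E * (H y)%:E)%E by exact: mule_ge0.
  have m3 : measurable_fun setT (fun y => (dv x)%:E * (H y)%:E)%E.
    by apply: emeasurable_funM meH; exact: measurable_cst.
  rewrite -(ge0_integralZl m (mA x) (measurable_funTS meH) (fun y _ => eH0 y) dx0).
  rewrite -(integralZD (mA x) c0 dH0 p3 (measurable_funTS mdH) (measurable_funTS m3)).
  apply: ge0_le_integral; [exact: mA| | | |].
  - by move=> y _; exact: q0.
  - exact: measurable_funTS (mq1 x).
  - apply/measurable_funTS; apply: emeasurable_funM; [exact: measurable_cst|exact: emeasurable_funD mdH m3].
  move=> y xy; rewrite (_ : _ * (_ + _) = (c * (dv y + dv x) * H y)%:E)%E; last first.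
    by rewrite -mulrA mulrDl; apply: EFinM.
  rewrite lee_fin; apply: ler_wpM2r; first exact: H0.
  by rewrite /dv (mean_cell _ xy); exact: cP.
apply: le_trans (lee_wpmul2l (eF0 x) kxy) _.
have c0' : (0 <= c%:E)%E by rewrite lee_fin.
have dJ : (0 <= (dv x)%:E * \int[m]_(y in Q j x) (H y)%:E)%E.
  by apply: mule_ge0 (J0 x); rewrite lee_fin.
rewrite muleCA; apply: (lee_wpmul2l c0').
by rewrite (ge0_muleDr _ (J10 x) dJ) muleA -EFinM (mulrC (F x)).
Qed.

End bilinear.

Section uniform_bilinear.
Context {d} {T : measurableType d} {R : realType}.
Context {m : {sigma_finite_measure set T -> \bar R}} {D : R}.
Implicit Types (G : dyadic m D) (j i : nat) (x y : T) (b f g h u v mu lam : T -> R) (a t : R).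
Local Notation Q := cell.
Local Notation S := cell_int.
Hint Resolve measurable_cell : core.

(** The embedding is used for [h ^ s] with exponents [p / s < r1 / s], where [s] is dual to [r], and
    for [g] with [q' < r2]. The powers of cell masses left by [inner_bound] and [single_cube] are
    those that [bilinear_core] expects. *)
Lemma bilinear_half a1 a2 K (k : nat) : 2 <= D -> 1 < a1 -> 1 < a2 ->
  a1^-1 + a2^-1 < 1 -> 1 <= K -> (0 < k)%N -> exists C, 0 < C /\
  forall G mu lam b B1 B2 h g, dyadic_Apq G a1 a2 K mu -> dyadic_Apq G a1 a2 K lam -> dyadic_bmo G mu lam b B1 B2 ->
  measurable_fun setT h -> (forall y, 0 <= h y) ->
  measurable_fun setT g -> (forall y, 0 <= g y) ->
  (\int[m]_x (h x `^ (1 - a1^-1)^-1 * (mu x)^-1 `^ a1)%:E <= 1)%E ->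
  (\int[m]_x (g x `^ (1 - a2^-1)^-1 * lam x `^ a2)%:E <= 1)%E -> forall n,
  (\sum_(j < n) (kap G j `^ (a1^-1 + a2^-1))^-1%:E *
    \int[m]_x ((g x * lam x `^ a2)%:E *
      \int[m]_(y in Q G j x) (`|b y - mean G j b x| ^+ k * (h y * (mu y)^-1 `^ a1))%:E)
   <= (C * (B1 * B2 ^+ k.-1))%:E)%E.
Proof.
move=> D2 a11 a21 a12 K1 k0.
have D1 : 1 <= D by apply: le_trans D2; lra.
have a10 : 0 < a1 by exact: lt_trans a11.
have a20 : 0 < a2 by exact: lt_trans a21.
have [r [C1 [ar C10 sc]]] := single_cube (m := m) D1 a11 a21 a12 K1 k0.
have r0 : 0 < r by exact: lt_trans ar.
have rgt1 : 1 < r by exact: lt_trans ar.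
have a12' : a2^-1 + a1^-1 < 1 by rewrite addrC.
have [th1 [th101 dbl1]] := Aw_doubling (m := m) D2 a11 a21 a12 K1.
have [th2 [th201 dbl2]] := Aw_doubling (m := m) D2 a21 a11 a12' K1.
have [p [Ep p0]] : exists p, p = (1 - a1^-1)^-1 /\ 0 < p.
  by exists (1 - a1^-1)^-1; rewrite invr_gt0 subr_gt0 invf_lt1.
have [q' [Eq' q'0]] : exists q', q' = (1 - a2^-1)^-1 /\ 0 < q'.
  by exists (1 - a2^-1)^-1; rewrite invr_gt0 subr_gt0 invf_lt1.
have [s [Es s0]] : exists s, s = (1 - r^-1)^-1 /\ 0 < s.
  by exists (1 - r^-1)^-1; rewrite invr_gt0 subr_gt0 invf_lt1.
rewrite -Ep -Eq'.
have pE : p^-1 = 1 - a1^-1 by rewrite Ep invrK.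
have qE : q'^-1 = 1 - a2^-1 by rewrite Eq' invrK.
have sE : s^-1 = 1 - r^-1 by rewrite Es invrK.
have ra : r^-1 < a1^-1 by rewrite ltf_pV2.
have ri0 : 0 < r^-1 by rewrite invr_gt0.
have ai0 : 0 < a1^-1 by rewrite invr_gt0.
have ai20 : 0 < a2^-1 by rewrite invr_gt0.
have ai21 : a2^-1 < 1 by rewrite invf_lt1.
have ai11 : a1^-1 < 1 by rewrite invf_lt1.
have sp : s < p by rewrite -ltf_pV2// sE pE; lra.
have q'1 : 1 < q' by rewrite -invf_lt1// qE; lra.
(* [a2^-1 < p^-1] is the hypothesis on [a1] and [a2]; the midpoint makes both [p < r1] and [q' < r2]
   strict. *)
have [r1 [Er1 r10]] : exists r1, r1^-1 = (p^-1 + a2^-1) / 2 /\ 0 < r1.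
  exists ((p^-1 + a2^-1) / 2)^-1; rewrite invrK; split=> //.
  by rewrite invr_gt0 pE; lra.
have pr1 : p < r1 by rewrite -ltf_pV2// Er1 pE; lra.
have r11 : 1 < r1 by rewrite -invf_lt1// Er1 pE; lra.
have [r2 [Er2 r20]] : exists r2, r2^-1 = 1 - r1^-1 /\ 0 < r2.
  by exists (1 - r1^-1)^-1; rewrite invrK invr_gt0 subr_gt0 invf_lt1.
have qr2 : q' < r2 by rewrite -ltf_pV2// Er2 Er1 pE qE; lra.
have P1 : 1 < p / s by rewrite ltr_pdivlMr// mul1r.
have PR : p / s < r1 / s by rewrite ltr_pM2r// invr_gt0.
have [C2 [C20 emb1]] := embedding (m := m) (D := D) P1 PR th101.
have [C3 [C30 emb2]] := embedding (m := m) (D := D) q'1 qr2 th201.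
have ex : r1 / s / (p / s) - 1 = r1 / p - 1 by congr (_ - 1); field; rewrite !gt_eqF.
rewrite ex in emb1.
exists (C1 * (C2 + C3)); split; first by rewrite mulr_gt0// addr_gt0.
move=> G mu lam b B1 B2 h g Amu Alam bb mh h0 mg g0 hh hg n.
have [fb B10 B20 _ _] := bb; have [mb _] := fb.
have [mm m0 fm2 fm1 Hm] := Amu; have [ml l0 fl2 fl1 Hl] := Alam.
pose sg y := (mu y)^-1 `^ a1; pose w y := lam y `^ a2.
have sg0 y : 0 < sg y by rewrite powR_gt0// invr_gt0.
have w0 y : 0 < w y by rewrite powR_gt0.
have fs : lfin G sg := fm1; have fw : lfin G w := fl2.
have msg := lfin_meas fs; have mw := lfin_meas fw.
(* The weight [lam ^ a2] plays for [lam^-1], with exponents exchanged, the role that [mu^-a1] plays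
   for [mu]. *)
have dblw j x : S G j.+1 w x <= th2 * S G j w x.
  have := dbl2 G _ (Aw_inv Alam) j x.
  have wE i : S G i (fun y => ((lam y)^-1)^-1 `^ a2) x = S G i w x.
    by apply: eq_S => y _; rewrite invrK.
  by rewrite !wE.
have fhp := lfin_Lp mh h0 fs sg0 hh.
have fhs : lfin G (fun y => h y `^ s * sg y) := lfin_Ls s0 sp mh h0 fs sg0 fhp.
have fgq := lfin_Lp mg g0 fw w0 hg.
have fg : lfin G (fun y => g y * w y).
  have l := lfin_Ls ltr01 q'1 mg g0 fw w0 fgq.
  by apply: eq_lfin l => y; rewrite powRr1.
have B0 : 0 <= B1 * B2 ^+ k.-1 by rewrite ltW// mulr_gt0// exprn_gt0.
pose CB := C1 * (B1 * B2 ^+ k.-1).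
have CB0 : 0 <= CB by rewrite mulr_ge0 ?(ltW C10).
have Ss0 j x : 0 < S G j sg x by exact: S_gt0.
have Sw0 j x : 0 < S G j w x by exact: S_gt0.
have Sh0 j x : 0 <= S G j (fun y => h y `^ s * sg y) x.
  by apply: S_ge0 => y; rewrite mulr_ge0 ?powR_ge0// ltW.
pose u j x := (S G j (fun y => h y `^ s * sg y) x / S G j sg x) `^ s^-1 * S G j sg x `^ p^-1.
have u0 j x : 0 <= u j x by rewrite mulr_ge0 ?powR_ge0.
have inner j x : (\int[m]_(y in Q G j x) (`|b y - mean G j b x| ^+ k * (h y * sg y))%:E <=
    (CB * (kap G j `^ (a1^-1 + a2^-1) * (u j x * (S G j w x `^ a2^-1)^-1)))%:E)%E.
  have [X le'] := sc G mu lam b B1 B2 Amu Alam bb j x.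
  have le : S G j (fun y => `|b y - mean G j b x| `^ (k%:R * r) * sg y) x `^ r^-1 *
    S G j sg x `^ (a1^-1 - r^-1) * S G j w x `^ a2^-1 <=
    C1 * (B1 * B2 ^+ k.-1) * kap G j `^ (a1^-1 + a2^-1) := le'.
  have fhs' : lfin G (fun y => h y `^ (1 - r^-1)^-1 * sg y) by rewrite -Es.
  have ib := inner_bound k0 a11 ar fb fs sg0 mh h0 fhs' X.
  rewrite -Es -sE in ib.
  apply: le_trans ib _; rewrite lee_fin; move: le.
  generalize (S G j (fun y => `|b y - mean G j b x| `^ (k%:R * r) * sg y) x `^ r^-1).
  move=> X1 le.
  have uE : S G j (fun y => h y `^ s * sg y) x `^ s^-1 = u j x * S G j sg x `^ (a1^-1 - r^-1).
    apply: powR_ratio_split; [exact: Sh0|exact: Ss0|].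
    by rewrite sE pE; ring.
  have W0 : 0 < S G j w x `^ a2^-1 by rewrite powR_gt0.
  by rewrite uE; exact: (mul_div_le W0 (u0 j x) le).
have mI j : measurable_fun setT (fun x => \int[m]_(y in Q G j x) (`|b y - mean G j b x| ^+ k * (h y * sg y))%:E)%E.
  have E x : (\int[m]_(y in Q G j x) (`|b y - mean G j b x| ^+ k * (h y * sg y))%:E =
     \int[m]_(y in Q G j x) (`|b y - mean G j b y| ^+ k * (h y * sg y))%:E)%E.
    by apply: eq_integral => y; rewrite inE => xy; rewrite (mean_cell _ xy).
  under eq_fun do rewrite E.
  apply: measurable_integral_cell.
    by move=> y; rewrite lee_fin !mulr_ge0 ?exprn_ge0// ltW.
  by have ? := measurable_mean j fb; mfun.
have I0 j x : (0 <= \int[m]_(y in Q G j x) (`|b y - mean G j b x| ^+ k * (h y * sg y))%:E)%E.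
  by apply: integral_ge0 => y _; rewrite lee_fin !mulr_ge0 ?exprn_ge0// ltW.
have mhs : measurable_fun setT (fun y => h y `^ s) by mfun.
have hhs : (\int[m]_x ((h x `^ s) `^ (p / s) * sg x)%:E <= 1)%E.
  apply: le_trans hh; rewrite le_eqVlt; apply/orP; left; apply/eqP.
  have ps : s * (p / s) = p by rewrite (mulrC s) divfK// gt_eqF.
  by apply: eq_integral => x _; rewrite -powRrM ps.
have e1 := emb1 G sg (fun y => h y `^ s) fs sg0 (dbl1 G _ Amu) mhs (fun y => powR_ge0 _ _) hhs n.
have e2 := emb2 G w g fw w0 dblw mg g0 hg n.
have r12 : r1^-1 + r2^-1 = 1 by rewrite Er2 addrC subrK.
have c0 j : 0 < kap G j `^ (a1^-1 + a2^-1) by rewrite powR_gt0// kap_gt0.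
have := bilinear_core r11 r12 qE CB0 c0 fs fw sg0 w0 mh h0 mg g0 fhs fg mI I0 inner e1 e2.
by rewrite (_ : C1 * (C2 + C3) * (B1 * B2 ^+ k.-1) = CB * (C2 + C3)); last by rewrite /CB; ring.
Qed.

(** The second term of [commutator_split] is the first one for [lam^-1], [mu^-1] and exchanged
    exponents. The quotient [mu / lam] is invariant under this exchange, hence so are the
    oscillation hypotheses. *)
Theorem dyadic_bilinear a1 a2 K (k : nat) : 2 <= D -> 1 < a1 -> 1 < a2 ->
  a1^-1 + a2^-1 < 1 -> 1 <= K -> (0 < k)%N -> exists C, 0 < C /\ 
  forall G mu lam b B1 B2 h g, dyadic_Apq G a1 a2 K mu -> dyadic_Apq G a1 a2 K lam -> dyadic_bmo G mu lam b B1 B2 ->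
  measurable_fun setT h -> (forall y, 0 <= h y) ->
  measurable_fun setT g -> (forall y, 0 <= g y) ->
  (\int[m]_x (h x `^ (1 - a1^-1)^-1 * (mu x)^-1 `^ a1)%:E <= 1)%E ->
  (\int[m]_x (g x `^ (1 - a2^-1)^-1 * lam x `^ a2)%:E <= 1)%E -> forall n,
  (\sum_(j < n) (kap G j `^ (a1^-1 + a2^-1))^-1%:E *
    \int[m]_x ((g x * lam x `^ a2)%:E *
      \int[m]_(y in Q G j x) (`|b x - b y| ^+ k * (h y * (mu y)^-1 `^ a1))%:E)
   <= (C * (B1 * B2 ^+ k.-1))%:E)%E.
Proof.
move=> D2 a11 a21 a12 K1 k0.
have a12' : a2^-1 + a1^-1 < 1 by rewrite addrC.
have [C1 [C10 H1]] := bilinear_half D2 a11 a21 a12 K1 k0.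
have [C2 [C20 H2]] := bilinear_half D2 a21 a11 a12' K1 k0.
exists (2 ^+ k * (C1 + C2)); split; first by rewrite mulr_gt0 ?addr_gt0// exprn_gt0.
move=> G mu lam b B1 B2 h g Amu Alam bb mh h0 mg g0 hh hg n.
have [fb B10 B20 bB1 bB2] := bb.
have [mm m0 fm2 fm1 Hm] := Amu; have [ml l0 fl2 fl1 Hl] := Alam.
have bb' : dyadic_bmo G (fun y => (lam y)^-1) (fun y => (mu y)^-1) b B1 B2.
  split=> //; move=> j x; apply: le_trans (bB1 j x) _; rewrite le_eqVlt; apply/orP; left; apply/eqP.
  by congr (_ * _); apply: eq_av => y _; rewrite invrK mulrC.
have hg' : (\int[m]_x (g x `^ (1 - a2^-1)^-1 * ((lam x)^-1)^-1 `^ a2)%:E <= 1)%E.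
  by apply: le_trans hg; rewrite le_eqVlt; apply/orP; left; apply/eqP; apply: eq_integral => x _; rewrite invrK.
have A1 := H1 G mu lam b B1 B2 h g Amu Alam bb mh h0 mg g0 hh hg n.
have A2 := H2 G _ _ b B1 B2 g h (Aw_inv Alam) (Aw_inv Amu) bb' mg g0 mh h0 hg' hh n.
pose F y := g y * lam y `^ a2; pose H y := h y * (mu y)^-1 `^ a1.
have F0 y : 0 <= F y by rewrite mulr_ge0 ?powR_ge0.
have H0 y : 0 <= H y by rewrite mulr_ge0 ?powR_ge0.
have mF : measurable_fun setT F by apply: measurable_funM => //; exact: lfin_meas fl2.
have mH : measurable_fun setT H by apply: measurable_funM => //; exact: lfin_meas fm1.
have kp j : 0 <= (kap G j `^ (a1^-1 + a2^-1))^-1 by rewrite invr_ge0 powR_ge0.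
have {}A2 : (\sum_(j < n) (kap G j `^ (a1^-1 + a2^-1))^-1%:E *
    \int[m]_x ((H x)%:E * \int[m]_(y in Q G j x) (`|b y - mean G j b x| ^+ k * F y)%:E)
   <= (C2 * (B1 * B2 ^+ k.-1))%:E)%E.
  apply: le_trans A2; rewrite le_eqVlt; apply/orP; left; apply/eqP.
  apply: eq_bigr => j _; rewrite (addrC a2^-1); apply: (congr2 mule (erefl _)).
  apply: eq_integral => x _; apply: (congr2 mule (erefl _)).
  by apply: eq_integral => y _; rewrite /F invrK.
apply: (@le_trans _ _ (\sum_(j < n) (2 ^+ k)%:E *
   ((kap G j `^ (a1^-1 + a2^-1))^-1%:E *
      \int[m]_x ((F x)%:E * \int[m]_(y in Q G j x) (`|b y - mean G j b x| ^+ k * H y)%:E) +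
    (kap G j `^ (a1^-1 + a2^-1))^-1%:E *
      \int[m]_x ((H x)%:E * \int[m]_(y in Q G j x) (`|b y - mean G j b x| ^+ k * F y)%:E)))%E).
  apply: lee_sum => j _.
  have k1 : (0 <= (kap G j `^ (a1^-1 + a2^-1))^-1%:E)%E by rewrite lee_fin.
  apply: le_trans (lee_wpmul2l k1 (commutator_split j k fb mF F0 mH H0)) _.
  rewrite muleCA ge0_muleDr//.
  - apply: integral_ge0 => x _; apply: mule_ge0; first by rewrite lee_fin.
    by apply: integral_ge0 => y _; rewrite lee_fin mulr_ge0// exprn_ge0.
  - apply: integral_ge0 => x _; apply: mule_ge0; first by rewrite lee_fin.
    by apply: integral_ge0 => y _; rewrite lee_fin mulr_ge0// exprn_ge0.
have pos (F' H' : T -> R) j : (forall x, 0 <= F' x) -> (forall x, 0 <= H' x) ->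
    (0 <= (kap G j `^ (a1^-1 + a2^-1))^-1%:E *
      \int[m]_x ((F' x)%:E * \int[m]_(y in Q G j x) (`|b y - mean G j b x| ^+ k * H' y)%:E))%E.
  move=> F0' H0'; apply: mule_ge0; first by rewrite lee_fin.
  apply: integral_ge0 => x _; apply: mule_ge0; first by rewrite lee_fin.
  by apply: integral_ge0 => y _; rewrite lee_fin mulr_ge0// exprn_ge0.
rewrite -ge0_sume_distrr; last by move=> j _; apply: adde_ge0; exact: pos.
rewrite -mulrA [leRHS]EFinM; apply: lee_wpmul2l; first by rewrite lee_fin exprn_ge0.
by rewrite big_split/= mulrDl EFinD; apply: leeD.
Qed.

End uniform_bilinear.

(** * Duality in weighted Lebesgue spaces *)

Section duality.
Context {d} {T : measurableType d} {R : realType}.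
Context {m : {measure set T -> \bar R}}.

Lemma cvg_integral_nd (g_ : nat -> T -> \bar R) (g : T -> \bar R) :
  (forall n, measurable_fun setT (g_ n)) -> (forall n x, 0 <= g_ n x)%E ->
  (forall x, {homo g_^~ x : n k / (n <= k)%N >-> (n <= k)%E}) ->
  (forall x, g_ n x @[n --> \oo] --> g x) ->
  (\int[m]_x g_ n x)%E @[n --> \oo] --> (\int[m]_x g x)%E.
Proof.
move=> mg g0 nd cv.
have := @cvg_monotone_convergence _ _ _ m _ measurableT g_ mg (fun n x _ => g0 n x) (fun x _ => nd x).
by rewrite (eq_integral g)// => x _; exact: (cvg_lim _ (cv x)).
Qed.

Lemma integral_nd_le (g_ : nat -> T -> \bar R) (g : T -> \bar R) (C : \bar R) :
  (forall n, measurable_fun setT (g_ n)) -> (forall n x, 0 <= g_ n x)%E ->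
  (forall x, {homo g_^~ x : n k / (n <= k)%N >-> (n <= k)%E}) ->
  (forall x, g_ n x @[n --> \oo] --> g x) ->
  (forall n, \int[m]_x g_ n x <= C)%E -> (\int[m]_x g x <= C)%E.
Proof.
move=> mg g0 nd cv gC; have c := cvg_integral_nd mg g0 nd cv.
rewrite -(cvg_lim _ c)//; apply: lime_le; first by apply/cvg_ex; eexists; exact: c.
exact: nearW.
Qed.

(** Testing with the normalized power [F ^ (q - 1)] presupposes a finite norm. [F] may even be
    infinite, so it is truncated in height and support, and monotone convergence removes the
    truncation. *)
Lemma duality (F : T -> \bar R) (w : T -> R) (q C : R) (E : nat -> set T) :
  1 < q -> 0 <= C -> measurable_fun setT F -> (forall x, 0 <= F x)%E ->
  measurable_fun setT w -> (forall x, 0 < w x) ->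
  (forall n, measurable (E n)) -> (forall n k, (n <= k)%N -> E n `<=` E k) ->
  (forall x, exists n, E n x) -> (forall n, \int[m]_(x in E n) (w x)%:E < +oo)%E ->
  (forall g : T -> R, measurable_fun setT g -> (forall x, 0 <= g x) ->
    (\int[m]_x (g x `^ (1 - q^-1)^-1 * w x)%:E <= 1)%E ->
    (\int[m]_x (F x * (g x * w x)%:E) <= C%:E)%E) ->
  (\int[m]_x (F x `^ q * (w x)%:E) <= (C `^ q)%:E)%E.
Proof.
move=> q1 C0 mF F0 mw w0 mE ndE coverE fE H.
have q0 : 0 < q by exact: lt_trans q1.
pose Fn n x : R := fine (mine (F x) n%:R%:E) * \1_(E n) x.
have fin n x : (mine (F x) n%:R%:E) \is a fin_num.
  rewrite ge0_fin_numE; last by rewrite le_min F0 lee_fin ler0n.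
  by apply: (@le_lt_trans _ _ n%:R%:E); rewrite ?ltry// ge_min lexx orbT.
have mn_ge0 : forall (n : nat) (x : T), 0 <= fine (mine (F x) n%:R%:E) :> R.
  by move=> n x; apply: fine_ge0; rewrite le_min F0 lee_fin ler0n.
have Fn0 n x : 0 <= Fn n x by rewrite mulr_ge0.
have ind1 (A : set T) x : \1_A x <= 1 :> R by rewrite indicE; case: (_ \in _).
have Fnn n x : Fn n x <= n%:R * \1_(E n) x.
  by rewrite ler_wpM2r// -lee_fin fineK// ge_min lexx orbT.
have FnF n x : ((Fn n x)%:E <= F x)%E.
  apply: (@le_trans _ _ (fine (mine (F x) n%:R%:E))%:E).
    by rewrite lee_fin ler_piMr.
  by rewrite fineK// ge_min lexx.
have mFn n : measurable_fun setT (Fn n).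
  rewrite /Fn; apply: measurable_funM; last exact: measurable_indic.
  apply: (measurableT_comp (@fine_measurable R _ measurableT)).
  exact: measurable_mine.
have ndFn x (n k : nat) : (n <= k)%N -> Fn n x <= Fn k x.
  move=> nk; apply: ler_pM => //.
    rewrite -lee_fin !fineK// le_min ge_min lexx/= ge_min.
    by rewrite [X in _ || X]lee_fin ler_nat nk orbT.
  rewrite !indicE; have [|] := boolP (x \in E n); last by rewrite ler0n.
  by rewrite inE => /(ndE _ _ nk) Ek; rewrite mem_set.
have mU n : measurable_fun setT (fun x => (Fn n x `^ q * w x)%:E).
  by have ? := mFn n; mfun.
have U0 n x : (0 <= (Fn n x `^ q * w x)%:E)%E.
  by rewrite lee_fin mulr_ge0 ?powR_ge0// ltW.
apply: (integral_nd_le mU U0) => [x n k nk|x|n].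
- rewrite lee_fin ler_wpM2r ?(ltW (w0 x))//; apply: le_powR; [exact: ltW|exact: Fn0|exact: ndFn].
- have [n0 En0] := coverE x.
  have ind n : (n0 <= n)%N -> \1_(E n) x = 1 :> R.
    by move=> n0n; rewrite indicE mem_set//; exact: ndE En0.
  move: (F0 x) (fun n => mn_ge0 n x); case FE : (F x) => [r| |//] r0 mn0; last first.
    rewrite poweRyr ?gt_eqF// gt0_mulye ?lte_fin//.
    apply/cvgeryP/cvgryPge => A.
    near=> n.
    rewrite /Fn FE ind ?mulr1; last by near: n; exact: nbhs_infty_ge.
    rewrite (_ : fine _ = n%:R); last by rewrite minye.
    have n1 : 1 <= n%:R :> R by rewrite ler1n; near: n; exact: nbhs_infty_ge.
    have An : A / w x <= n%:R by near: n; exact: nbhs_infty_ger.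
    rewrite -ler_pdivrMr//; apply: le_trans An _.
    rewrite -[leLHS]powRr1//; apply: ler_powR => //; exact: ltW.
  rewrite poweR_EFin -EFinM; apply: cvg_near_cst; near=> n.
  rewrite /Fn FE ind ?mulr1; last by near: n; exact: nbhs_infty_ge.
  rewrite (_ : fine _ = r)//.
  have rn : r <= n%:R by near: n; exact: nbhs_infty_ger.
  by rewrite (_ : mine _ _ = r%:E)//; apply/min_idPl; rewrite lee_fin.
have nE : (\int[m]_x (Fn n x `^ q * w x)%:E < +oo)%E.
  apply: (@le_lt_trans _ _ (\int[m]_(x in E n) ((n%:R `^ q)%:E * (w x)%:E))%E); last first.
    have nq0 : (0 <= (n%:R `^ q)%:E :> \bar R)%E by rewrite lee_fin powR_ge0.
    have mwE : measurable_fun (E n) (fun x => (w x)%:E) by apply/measurable_funTS; mfun.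
    rewrite (ge0_integralZl m (mE n) mwE (fun x _ => ltW (w0 x)) nq0).
    by rewrite lte_mul_pinfty.
  rewrite [leRHS]integral_mkcond; apply: ge0_le_integral => //.
  - apply/(measurable_restrictT _ _).1 => //.
    by apply/measurable_funTS; mfun.
  - move=> x _; rewrite patchE; case: ifPn => xE; rewrite -?EFinM lee_fin.
      apply: ler_wpM2r; first exact: ltW.
      apply: le_powR; [exact: ltW|exact: Fn0|].
      by apply: le_trans (Fnn n x) _; rewrite ler_piMr.
    rewrite /Fn indicE (negbTE xE) mulr0 powR0 ?mul0r// gt_eqF//.
have Ifin : (\int[m]_x (Fn n x `^ q * w x)%:E)%E \is a fin_num.
  by rewrite ge0_fin_numE// integral_ge0.
have [I EI] : exists I : R, (\int[m]_x (Fn n x `^ q * w x)%:E)%E = I%:E.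
  by exists (fine (\int[m]_x (Fn n x `^ q * w x)%:E)%E); rewrite fineK.
have I0 : 0 <= I by rewrite -lee_fin -EI; apply: integral_ge0.
rewrite EI lee_fin; have [->|In0] := eqVneq I 0; first exact: powR_ge0.
have Igt0 : 0 < I by rewrite lt_neqAle eq_sym In0.
have qi1 : q^-1 < 1 by rewrite invf_lt1.
have q'0 : 0 < (1 - q^-1)^-1 by rewrite invr_gt0 subr_gt0.
(* The extremal function: its conjugate norm is 1, and pairing it with [Fn n] gives [I ^ q^-1]. *)
pose g x := I `^ (q^-1 - 1) * Fn n x `^ (q - 1).
have g0 x : 0 <= g x by rewrite mulr_ge0 ?powR_ge0.
have mFn' := mFn n.
have mg : measurable_fun setT g by rewrite /g; mfun.
have gq x : g x `^ (1 - q^-1)^-1 * w x = I^-1 * (Fn n x `^ q * w x).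
  rewrite /g powRM ?powR_ge0// -!powRrM mulrA; congr (_ * _ * _).
    rewrite -(opprB 1 q^-1) mulNr mulfV ?gt_eqF ?subr_gt0// powR_inv1//.
  have qn1 : q - 1 != 0 by rewrite gt_eqF// subr_gt0.
  by congr (_ `^ _); field; rewrite qn1 gt_eqF.
have h1 : (\int[m]_x (g x `^ (1 - q^-1)^-1 * w x)%:E <= 1)%E.
  rewrite (eq_integral (fun x => I^-1%:E * (Fn n x `^ q * w x)%:E)%E); last first.
    by move=> x _; rewrite gq EFinM.
  rewrite ge0_integralZl//; last by rewrite lee_fin invr_ge0.
  by rewrite EI -EFinM mulVf.
have := H g mg g0 h1.
have Fg x : Fn n x * (g x * w x) = I `^ (q^-1 - 1) * (Fn n x `^ q * w x).
  rewrite /g; have [->|fn0] := eqVneq (Fn n x) 0.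
    by rewrite !powR0 ?gt_eqF ?subr_gt0// !(mulr0, mul0r).
  have := @powRD R (Fn n x) (q - 1) 1; rewrite fn0 implybT subrK powRr1// => /(_ isT) ->.
  by ring.
have h2 : ((I `^ (q^-1 - 1) * I)%:E <= \int[m]_x (F x * (g x * w x)%:E))%E.
  have -> : ((I `^ (q^-1 - 1) * I)%:E = \int[m]_x (Fn n x * (g x * w x))%:E)%E.
    rewrite EFinM -EI -ge0_integralZl// ?lee_fin ?powR_ge0//.
    by apply: eq_integral => x _; rewrite Fg -EFinM.
  apply: ge0_le_integral => //.
  - by move=> x _; rewrite lee_fin; apply: mulr_ge0 => //; apply: mulr_ge0 => //; exact: ltW.
  - by mfun.
  - by mfun.
  - move=> x _; rewrite EFinM; apply: lee_wpmul2r => //.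
    by rewrite lee_fin mulr_ge0// ltW.
move=> /(le_trans h2); rewrite lee_fin.
have -> : I `^ (q^-1 - 1) * I = I `^ q^-1.
  by rewrite -{2}(powRr1 I0) -powRD ?subrK// In0 implybT.
by move/(le_powR (ltW q0) (powR_ge0 _ _)); rewrite powRVK.
Unshelve. all: by end_near. Qed.

End duality.

(** * Shifted grids *)

Section grid_line.
Context {R : realType}.
Implicit Types (l s t u : R).

Definition gidx l s t : int := Num.floor ((t - s) / l).

Lemma gidxP l s t (c : int) : 0 < l ->
  (gidx l s t == c) = (c%:~R * l + s <= t < (c + 1)%:~R * l + s).
Proof.
by move=> l0; rewrite /gidx floor_eq ler_pdivlMr// ltr_pdivrMr// lerBrDr ltrBlDr.
Qed.

Lemma gidx_itv l s t : 0 < l ->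
  (gidx l s t)%:~R * l + s <= t < (gidx l s t + 1)%:~R * l + s.
Proof. by move=> l0; rewrite -gidxP. Qed.

Lemma gidx_lebesgue l s (c : int) : 0 < l ->
  measurable [set t : measurableTypeR R | gidx l s t = c] /\
  lebesgue_measure [set t : measurableTypeR R | gidx l s t = c] = l%:E.
Proof.
move=> l0; have -> : [set t : measurableTypeR R | gidx l s t = c] =
    `[c%:~R * l + s, (c + 1)%:~R * l + s[%classic.
  apply/seteqP; split => t /=; rewrite in_itv/= -gidxP//; first by move=> ->.
  by move/eqP.
split; first exact: measurable_itv.
rewrite lebesgue_measure_itv/= lte_fin ltrD2r ltr_pM2r// ltr_int ltzD1 lexx.
by rewrite -EFinB; congr EFin; rewrite intrD; ring.
Qed.

(** If [c] and [e] are the indices of [t] at lengths [l / 2] and [l], comparing endpoints gives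
    strict inequalities between integers; sharpened by integrality they say that [c] is [2 * e] or
    [2 * e + 1], which places the whole half interval in its parent. *)
Lemma gidx_nest l s t u : 0 < l -> gidx (l / 2) s t = gidx (l / 2) s u ->
  gidx l s t = gidx l s u.
Proof.
move=> l0 tu; have l20 : 0 < l / 2 by rewrite divr_gt0.
have /andP[t1 t2] := gidx_itv s t l20; have /andP[u1 u2] := gidx_itv s u l20.
have /andP[T1 T2] := gidx_itv s t l0.
rewrite -tu in u1 u2; apply/eqP; rewrite eq_sym gidxP//; move: t1 t2 u1 u2 T1 T2.
set c := gidx (l / 2) s t; set e := gidx l s t; move=> t1 t2 u1 u2 T1 T2.
have h1 : (2 * e < c + 1)%R.
  rewrite -(ltr_int R) !intrD intrM -(ltr_pM2r l20).
  by move: T1 t2; rewrite intrD => T1 t2; lra.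
have h2 : (c < 2 * (e + 1))%R.
  rewrite -(ltr_int R) intrM !intrD -(ltr_pM2r l20).
  by move: T2 t1; rewrite intrD => T2 t1; lra.
have h3 : (2 * e <= c)%R by rewrite -ltzD1.
have h4 : (c + 1 <= 2 * (e + 1))%R by rewrite -ltzD1 ltrD2r.
have {}h3 : 2 * e%:~R * (l / 2) <= c%:~R * (l / 2).
  by rewrite (ler_pM2r l20) -(intrM _ 2) ler_int.
have {}h4 : (c%:~R + 1) * (l / 2) <= 2 * (e%:~R + 1) * (l / 2).
  by rewrite (ler_pM2r l20) -(intrD _ c 1) -(intrD _ e 1) -(intrM _ 2) ler_int.
clear h1 h2; move: u1 u2; rewrite !intrD => u1 u2.
by apply/andP; split; lra.
Qed.

Lemma gidx_lt l s t u : 0 < l -> t < u -> gidx l s t != gidx l s u ->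
  t < (gidx l s u)%:~R * l + s <= u.
Proof.
move=> l0 tu ne; have /andP[t1 t2] := gidx_itv s t l0; have /andP[u1 u2] := gidx_itv s u l0.
rewrite u1 andbT ltNge; apply/negP => h; move/negP: ne; apply.
by rewrite gidxP// h (lt_trans tu u2).
Qed.

(* At scale [l] the endpoints of the two grids differ by at least [l / 3],
   because [2 ^ j] is not a multiple of [3]. *)
Lemma one_third l (j : nat) t u : 0 < l -> `|t - u| < l / 3 ->
  gidx l 0 t = gidx l 0 u \/
  gidx l (2 ^+ j * l / 3) t = gidx l (2 ^+ j * l / 3) u.
Proof.
move=> l0; wlog tu : t u / t < u.
  move=> H; have [tu|tu|->] := ltgtP t u; [|rewrite distrC|]; last by left.
    exact: H.
  by move=> /(H _ _ tu)[] ->; [left|right].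
move=> d; have [e1|n1] := eqVneq (gidx l 0 t) (gidx l 0 u); first by left.
have [e2|n2] := eqVneq (gidx l (2 ^+ j * l / 3) t) (gidx l (2 ^+ j * l / 3) u); first by right.
exfalso; have /andP[a1 a2] := gidx_lt l0 tu n1; have /andP[b1 b2] := gidx_lt l0 tu n2.
move: a1 a2 b1 b2; set c := gidx l 0 u; set e := gidx _ _ u; move=> a1 a2 b1 b2.
rewrite distrC gtr0_norm ?subr_gt0// in d.
(* If both grids separate [t] and [u], an endpoint of each lies in []t, u]]. Their difference, in
   units of [l / 3], is this integer, and it has absolute value below 1. *)
have [z Ez] : exists z : int, z = 3 * (c - e) - 2 ^+ j by eexists.
have zR : z%:~R = 3 * (c%:~R - e%:~R) - 2 ^+ j :> R.
  by rewrite Ez intrB intrM intrB rmorphXn.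
have z1 : (z < 1)%R.
  rewrite -(ltr_int R) -(ltr_pM2r l0) zR.
  by move: (2 ^+ j : R) a1 a2 b1 b2 d => k a1 a2 b1 b2 d; lra.
have z2 : (-1 < z)%R.
  rewrite -(ltr_int R) -(ltr_pM2r l0) zR intrN.
  by move: (2 ^+ j : R) a1 a2 b1 b2 d => k a1 a2 b1 b2 d; lra.
have z0 : z = 0 by lia.
have : (3 %| (2 ^ j)%N)%N.
  have : (3 %| (2 ^+ j : int))%Z by rewrite (_ : 2 ^+ j = (c - e) * 3) ?dvdz_mull//; lia.
  by rewrite dvdzE abszX.
by rewrite Euclid_dvdX.
Qed.

End grid_line.

Section grid.
Context {R : realType} {n : nat}.
Variables (l : R) (s : 'I_n -> R).
Hypothesis l0 : 0 < l.
Local Notation T := (Rn R n).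

Definition grid_cell (j : nat) (x : T) : set T :=
  [set y | forall i, gidx (l / 2 ^+ j) (s i) (tnth y i) = gidx (l / 2 ^+ j) (s i) (tnth x i)].

Let lj0 j : 0 < l / 2 ^+ j. Proof. by rewrite divr_gt0// exprn_gt0. Qed.

Let grid_refl j x : grid_cell j x x. Proof. by []. Qed.

Let grid_eq j x y : grid_cell j x y -> grid_cell j y = grid_cell j x.
Proof. by move=> xy; apply/seteqP; split => z zx i; rewrite zx xy. Qed.

Let grid_nest j x : grid_cell j.+1 x `<=` grid_cell j x.
Proof.
move=> y xy i; apply: gidx_nest => //; have := xy i.
by rewrite exprSr invfM mulrA.
Qed.

Let measurable_coord_idx j i (c : int) :
  measurable [set y : T | gidx (l / 2 ^+ j) (s i) (tnth y i) = c].
Proof.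
have [mc _] := gidx_lebesgue (s i) c (lj0 j).
rewrite -[X in measurable X]setTI.
exact: (@measurable_tnth _ (measurableTypeR R) n i measurableT _ mc).
Qed.

Let measurable_grid_rel j : measurable [set z : T * T | grid_cell j z.1 z.2].
Proof.
pose e i (z : T) := gidx (l / 2 ^+ j) (s i) (tnth z i).
rewrite (_ : mkset _ = \bigcap_(i in [set: 'I_n]) \bigcup_(c in [set: int])
   ([set z : T | e i z = c] `*` [set z : T | e i z = c])); last first.
  apply/seteqP; split => [z zz i _|z zz i]; first by exists (e i z.1) => //; split => //=; exact: zz.
  by have [c _ []] := zz i I; rewrite /e/= => -> ->.
apply: fin_bigcap_measurable => // i _; apply: countable_bigcupT_measurable => // c.
by apply: measurableX; exact: measurable_coord_idx.
Qed.

Let grid_kap j x : lebesgue_Rn n (grid_cell j x) = ((l / 2 ^+ j) ^+ n)%:E.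
Proof.
rewrite (lebesgue_Rn_box (A := fun i => [set t : measurableTypeR R |
  gidx (l / 2 ^+ j) (s i) t = gidx (l / 2 ^+ j) (s i) (tnth x i)])); last first.
  by move=> i; have [] := gidx_lebesgue (s i) (gidx (l / 2 ^+ j) (s i) (tnth x i)) (lj0 j).
rewrite (eq_bigr (fun=> (l / 2 ^+ j)%:E)) => [|i _]; last first.
  by have [] := gidx_lebesgue (s i) (gidx (l / 2 ^+ j) (s i) (tnth x i)) (lj0 j).
by rewrite prodEFin prodr_const card_ord.
Qed.

Let grid_gen : @measurable _ T `<=` <<s [set A : set T | measurable A /\
  exists j, forall x y, A x -> grid_cell j x y -> A y] >>.
Proof.
set gen := [set A | _].
(* The inclusion of sigma-algebras is measurability of the identity, which can be checked on
   coordinates and open half-lines. *)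
have mid : measurable_fun [set: g_sigma_algebraType gen] (id : g_sigma_algebraType gen -> T).
  apply/measurable_fun_tnthP => i.
  apply: (@measurability _ _ (g_sigma_algebraType gen) (measurableTypeR R) setT
    (fun x : T => tnth x i) (@RGenInftyO.G R)).
    exact: RGenInftyO.measurableE.
  move=> _ [_ [a ->] <-]; rewrite setTI.
  (* The cells of generation [j] lying entirely to the left of [a]; they exhaust the half-line as
     [j] grows. *)
  pose B j := [set x : T | (gidx (l / 2 ^+ j) (s i) (tnth x i) + 1)%:~R * (l / 2 ^+ j) + s i <= a].
  rewrite (_ : _ @^-1` _ = \bigcup_j B j).
    apply: bigcupT_measurable => j; apply: sub_sigma_algebra; split; last first.
      by exists j => x y + xy; rewrite /B/= (xy i).
    rewrite (_ : B j = \bigcup_(c in [set: int])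
       ([set y : T | gidx (l / 2 ^+ j) (s i) (tnth y i) = c] `&`
        [set y : T | (c + 1)%:~R * (l / 2 ^+ j) + s i <= a])); last first.
      apply/seteqP; split => [x Bx|x [c _ [/= <-]]//].
      by exists (gidx (l / 2 ^+ j) (s i) (tnth x i)).
    apply: countable_bigcupT_measurable => // c; apply: measurableI => //.
    have [h|h] := boolP ((c + 1)%:~R * (l / 2 ^+ j) + s i <= a).
      by rewrite (_ : mkset _ = setT)//; apply/seteqP; split.
    by rewrite (_ : mkset _ = set0)//; apply/seteqP; split => // x /=; rewrite (negbTE h).
  apply/seteqP; split => [x /=|x [j _] /=]; rewrite in_itv/=; last first.
    by apply: lt_le_trans; have /andP[] := gidx_itv (s i) (tnth x i) (lj0 j).
  move=> xa; have ax0 : 0 < a - tnth x i by rewrite subr_gt0.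
  (* Then [2 ^ j > j > l / (a - x i)], so the cell is too short to reach [a]. *)
  pose j := (Num.truncn (l / (a - tnth x i))).+1; exists j => //; rewrite /B/=.
  have jl : l / 2 ^+ j <= a - tnth x i.
    rewrite ler_pdivrMr ?exprn_gt0// mulrC -ler_pdivrMr//.
    apply: le_trans (ltW (truncnS_gt _)) _; rewrite -natrX ler_nat ltnW//.
    exact: ltn_expl.
  have /andP[h1 h2] := gidx_itv (s i) (tnth x i) (lj0 j).
  move: h1; rewrite intrD; move: jl; set c := _%:~R => jl h1.
  by rewrite mulrDl mul1r; lra.
by move=> A mA; have := mid measurableT A mA; rewrite setTI.
Qed.

Let grid_kapS j : (l / 2 ^+ j) ^+ n = 2 ^+ n * (l / 2 ^+ j.+1) ^+ n.
Proof. by rewrite -exprMn; congr (_ ^+ _); rewrite exprS; field; rewrite gt_eqF// exprn_gt0. Qed.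

Definition grid : dyadic (@lebesgue_Rn R n) (2 ^+ n) :=
  Dyadic grid_refl grid_eq grid_nest measurable_grid_rel
    (fun j => exprn_gt0 n (lj0 j)) grid_kapS grid_kap grid_gen.

End grid.

(** * From the kernel to sums over grids *)

Section kernel_sum.
Context {d} {T : measurableType d} {R : realType}.
Context {m : {sigma_finite_measure set T -> \bar R}} {D : R}.
Variables (I : finType) (G : I -> dyadic m D).

Lemma kernel_sum (J : nat) (c : nat -> R) (V W : T * T -> R) (F : T -> R) :
  (forall j, 0 <= c j) -> measurable_fun setT V -> (forall z, 0 <= V z) ->
  measurable_fun setT W -> (forall z, 0 <= W z) ->
  measurable_fun setT F -> (forall x, 0 <= F x) ->
  (forall x y, V (x, y) <= \sum_i \sum_(j < J) c j * (\1_(cell (G i) j x) y * W (x, y))) ->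
  (\int[m]_x ((F x)%:E * \int[m]_y (V (x, y))%:E) <=
   \sum_i \sum_(j < J) (c j)%:E * \int[m]_x ((F x)%:E * \int[m]_(y in cell (G i) j x) (W (x, y))%:E))%E.
Proof.
move=> c0 mV V0 mW W0 mF F0 VW.
have eF0 x : (0 <= (F x)%:E)%E by rewrite lee_fin.
have eW0 z : (0 <= (W z)%:E)%E by rewrite lee_fin.
have meF : measurable_fun setT (fun x => (F x)%:E) by mfun.
have meW : measurable_fun setT (fun x => (W x)%:E) by mfun.
have mWx x : measurable_fun setT (fun y => W (x, y)).
  exact: (measurableT_comp mW (@measurable_pair1 _ _ T T x)).
have mVx x : measurable_fun setT (fun y => (V (x, y))%:E).
  by apply/measurable_EFinP; exact: (measurableT_comp mV (@measurable_pair1 _ _ T T x)).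
pose P i (j : nat) x := (\int[m]_(y in cell (G i) j x) (W (x, y))%:E)%E.
have P0 i j x : (0 <= P i j x)%E by apply: integral_ge0 => y _; exact: eW0.
have mP i j : measurable_fun setT (P i j).
  exact: (@measurable_kernel_cell _ _ _ _ _ (G i) j (fun z => (W z)%:E)).
have ec0 j : (0 <= (c j)%:E)%E by rewrite lee_fin.
have mt i j x : measurable_fun setT (fun y => (c j * (\1_(cell (G i) j x) y * W (x, y)))%:E).
  have ? := mWx x.
  have ? : measurable_fun setT (\1_(cell (G i) j x) : T -> R).
    by apply: measurable_indic; exact: measurable_cell.
  by mfun.
have inner x : (\int[m]_y (V (x, y))%:E <= \sum_i \sum_(j < J) (c j)%:E * P i j x)%E.
  apply: (@le_trans _ _ (\int[m]_y \sum_i \sum_(j < J) (c j * (\1_(cell (G i) j x) y * W (x, y)))%:E)%E).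
    apply: ge0_le_integral => //.
    - by move=> y _; rewrite lee_fin.
    - by apply: emeasurable_sum => i; apply: emeasurable_sum => j; exact: mt.
    - move=> y _; under eq_bigr do rewrite sumEFin.
      by rewrite sumEFin lee_fin.
  have t0 i j y : (0 <= (c j * (\1_(cell (G i) j x) y * W (x, y)))%:E)%E.
    by rewrite lee_fin mulr_ge0// mulr_ge0.
  rewrite (@ge0_integral_sum _ _ _ m _ measurableT _ (fun i y => \sum_(j < J) (c j * (\1_(cell (G i) j x) y * W (x, y)))%:E)%E); last 2 first.
  - by move=> i; apply: emeasurable_sum => j; exact: mt.
  - by move=> i y _; apply: sume_ge0 => j _; exact: t0.
  apply: lee_sum => i _.
  rewrite (@ge0_integral_sum _ _ _ m _ measurableT _ (fun (j : 'I_J) y => (c j * (\1_(cell (G i) j x) y * W (x, y)))%:E)%E); last 2 first.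
  - by move=> j; exact: mt.
  - by move=> j y _; exact: t0.
  apply: lee_sum => j _; rewrite le_eqVlt; apply/orP; left; apply/eqP.
  rewrite /P -ge0_integralZl//; last 2 first.
  - exact: measurable_cell.
  - by apply/measurable_funTS; apply/measurable_EFinP; exact: mWx.
  rewrite [RHS]integral_mkcond.
  apply: eq_integral => y _; rewrite epatch_indic/= -!EFinM; congr EFin; ring.
have mS : measurable_fun setT (fun x => \sum_i \sum_(j < J) (c j)%:E * P i j x)%E.
  apply: emeasurable_sum => i; apply: emeasurable_sum => j.
  by apply: emeasurable_funM => //; exact: measurable_cst.
apply: (@le_trans _ _ (\int[m]_x ((F x)%:E * \sum_i \sum_(j < J) (c j)%:E * P i j x))%E).
  apply: ge0_le_integral; [exact: measurableT| | | |].
  - by move=> x _; apply: mule_ge0 => //; apply: integral_ge0 => y _; rewrite lee_fin.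
  - apply: emeasurable_funM => //.
    apply: (@measurable_fun_fubini_tonelli_F _ _ _ _ _ m (fun z => (V z)%:E)).
      by apply/measurable_EFinP.
    by move=> z; rewrite lee_fin.
  - exact: emeasurable_funM.
  - by move=> x _; apply: lee_wpmul2l => //; exact: inner.
have mFP i j : measurable_fun setT (fun x => (F x)%:E * P i j x)%E by exact: emeasurable_funM.
have mcFP i j : measurable_fun setT (fun x => (c j)%:E * ((F x)%:E * P i j x))%E.
  by apply: emeasurable_funM => //; exact: measurable_cst.
rewrite (eq_integral (fun x => \sum_i \sum_(j < J) (c j)%:E * ((F x)%:E * P i j x))%E); last first.
  move=> x _; rewrite ge0_sume_distrr; last first.
    by move=> i _; apply: sume_ge0 => j _; exact: mule_ge0.
  apply: eq_bigr => i _; rewrite ge0_sume_distrr; last by move=> j _; exact: mule_ge0.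
  by apply: eq_bigr => j _; rewrite muleCA.
rewrite (@ge0_integral_sum _ _ _ m _ measurableT _ (fun i x => \sum_(j < J) (c j)%:E * ((F x)%:E * P i j x))%E); last 2 first.
- by move=> i; apply: emeasurable_sum => j; exact: mcFP.
- by move=> i x _; apply: sume_ge0 => j _; apply: mule_ge0 => //; exact: mule_ge0.
apply: lee_sum => i _.
rewrite (@ge0_integral_sum _ _ _ m _ measurableT _ (fun (j : 'I_J) x => (c j)%:E * ((F x)%:E * P i j x))%E); last 2 first.
- by move=> j; exact: mcFP.
- by move=> j x _; apply: mule_ge0 => //; exact: mule_ge0.
apply: lee_sum => j _; rewrite ge0_integralZl//.
by move=> x _; exact: mule_ge0.
Qed.

End kernel_sum.

Lemma ler_sum_term2 (R : numDomainType) (I J : finType) (f : I -> J -> R) i j :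
  (forall i j, 0 <= f i j) -> f i j <= \sum_i' \sum_j' f i' j'.
Proof.
move=> f0; rewrite (bigD1 i)//= (bigD1 j)//= -addrA lerDl addr_ge0//.
  by apply: sumr_ge0 => j' _.
by apply: sumr_ge0 => i' _; apply: sumr_ge0 => j' _.
Qed.

Section cover.
Context {R : realType} {n : nat}.
Implicit Types (x y : Rn R n).

Definition grid_shift (l : R) (e : {ffun 'I_n -> bool}) (i : 'I_n) : R := if e i then l / 3 else 0.

Lemma coord_dist x y i : `|tnth x i - tnth y i| <= euclidean_dist x y.
Proof.
rewrite /euclidean_dist -sqrtr_sqr; apply: ler_wsqrtr.
by rewrite (bigD1 i)//= lerDl; apply: sumr_ge0 => j _; exact: sqr_ge0.
Qed.

Lemma dyadic_scale (l t : R) (J : nat) : l / 2 ^+ J <= t -> t < l ->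
  exists2 j : 'I_J, l / 2 ^+ j / 2 <= t & t < l / 2 ^+ j.
Proof.
elim: J => [|J IH]; first by rewrite divr1 => h /(le_lt_trans h); rewrite ltxx.
move=> h tl; have [h2|h2] := leP (l / 2 ^+ J) t.
  have [j j1 j2] := IH h2 tl; exists (widen_ord (leqnSn J) j) => //.
by exists ord_max => //; move: h; rewrite exprSr invfM mulrA.
Qed.

(** Choose the generation with [dist] between one sixth and one third of the side length: the upper
    bound lets [one_third] put both points in a common cell, the lower one compares the kernel with
    the side and yields [6 ^ r]. *)
Lemma kernel_cover (l r : R) (l0 : 0 < l) (J : nat) x y : 0 <= r ->
  l / 3 / 2 ^+ J <= euclidean_dist x y -> euclidean_dist x y < l / 3 ->
  (euclidean_dist x y `^ r)^-1 <=
  \sum_(e : {ffun 'I_n -> bool}) \sum_(j < J)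
     6 `^ r * ((l / 2 ^+ j) `^ r)^-1 * \1_(cell (grid (grid_shift l e) l0) j x) y.
Proof.
move=> r0 h1 h2; have [j j1 j2] := dyadic_scale h1 h2.
have lj0 : 0 < l / 2 ^+ j by rewrite divr_gt0// exprn_gt0.
(* Exactly those coordinates are shifted in which the unshifted grid separates the points at this
   generation. *)
pose e := [ffun i => gidx (l / 2 ^+ j) 0 (tnth x i) != gidx (l / 2 ^+ j) 0 (tnth y i)].
have ce : cell (grid (grid_shift l e) l0) j x y.
  move=> i; rewrite /grid_shift ffunE.
  have d : `|tnth x i - tnth y i| < l / 2 ^+ j / 3.
    apply: le_lt_trans (coord_dist x y i) _; apply: lt_le_trans j2 _.
    by rewrite mulrAC.
  have [->//|ne] := eqVneq (gidx (l / 2 ^+ j) 0 (tnth x i)) (gidx (l / 2 ^+ j) 0 (tnth y i)).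
  (* In terms of the top length the shift is the same at all generations, so one grid serves them
     all. *)
  have E : 2 ^+ j * (l / 2 ^+ j) / 3 = l / 3 by rewrite mulrCA mulfV ?mulr1// gt_eqF// exprn_gt0.
  by have [/eqP|] := one_third j lj0 d; rewrite ?(negbTE ne)//= E => ->.
have p0 (e' : {ffun 'I_n -> bool}) (i : 'I_J) : 0 <= 6 `^ r * ((l / 2 ^+ i) `^ r)^-1 *
    \1_(cell (grid (grid_shift l e') l0) i x) y :> R.
  by rewrite mulr_ge0// mulr_ge0 ?powR_ge0// invr_ge0 powR_ge0.
apply: le_trans (ler_sum_term2 e j p0); rewrite indicE mem_set// mulr1.
have l6 : 0 < l / 2 ^+ j / 6 by rewrite divr_gt0.
have -> : 6 `^ r * ((l / 2 ^+ j) `^ r)^-1 = ((l / 2 ^+ j / 6) `^ r)^-1.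
  rewrite [in RHS]powRM ?invr_ge0 ?(ltW lj0)// invfM mulrC; congr (_ * _).
  have s0 : 6^-1 `^ r != 0 :> R by rewrite gt_eqF// powR_gt0.
  by apply: (mulfI s0); rewrite mulfV// -powRM// mulVf// powR1.
have j1' : l / 2 ^+ j / 6 <= euclidean_dist x y.
  apply: le_trans j1; rewrite le_eqVlt; apply/orP; left; apply/eqP; field.
  by rewrite gt_eqF// exprn_gt0.
rewrite lef_pV2 ?posrE ?powR_gt0//; first exact: (le_powR r0 (ltW l6) j1').
exact: lt_le_trans j1'.
Qed.

End cover.

(** Monotone convergence in the inner and then in the outer integral. *)
Lemma kernel_exhaustion d (T : measurableType d) (R : realType)
    (m : {sigma_finite_measure set T -> \bar R}) (V_ : nat -> T * T -> R) (V : T * T -> R)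
    (F : T -> R) (C : \bar R) :
  (forall n, measurable_fun setT (V_ n)) -> (forall n z, 0 <= V_ n z) ->
  (forall z n k, (n <= k)%N -> V_ n z <= V_ k z) ->
  (forall z, \forall n \near \oo, V_ n z = V z) ->
  measurable_fun setT F -> (forall x, 0 <= F x) ->
  (forall n, \int[m]_x ((F x)%:E * \int[m]_y (V_ n (x, y))%:E) <= C)%E ->
  (\int[m]_x ((F x)%:E * \int[m]_y (V (x, y))%:E) <= C)%E.
Proof.
move=> mV V0 ndV cV mF F0.
have mVx n x : measurable_fun setT (fun y => (V_ n (x, y))%:E).
  by apply/measurable_EFinP; exact: (measurableT_comp (mV n) (@measurable_pair1 _ _ T T x)).
have eV0 n z : (0 <= (V_ n z)%:E)%E by rewrite lee_fin.
have mI n : measurable_fun setT (fun x => \int[m]_y (V_ n (x, y))%:E)%E.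
  apply: (@measurable_fun_fubini_tonelli_F _ _ _ _ _ m (fun z => (V_ n z)%:E)) => //.
  by apply/measurable_EFinP.
have I0 n x : (0 <= \int[m]_y (V_ n (x, y))%:E)%E by exact: integral_ge0.
apply: integral_nd_le.
- move=> n; apply: emeasurable_funM => //; exact/measurable_EFinP.
- by move=> n x; apply: mule_ge0 => //; rewrite lee_fin.
- move=> x n k nk; apply: lee_wpmul2l; first by rewrite lee_fin.
  by apply: ge0_le_integral => // y _; rewrite lee_fin; exact: ndV.
- move=> x; apply: cvgeZl => //; apply: cvg_integral_nd => //.
    by move=> y n k nk; rewrite lee_fin; exact: ndV.
  move=> y; apply: cvg_near_cst.
  by near=> n; congr EFin; near: n; exact: cV.
Unshelve. all: by end_near. Qed.

Section core.
Context {R : realType} {n : nat}.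
Implicit Types (x y : Rn R n) (mu lam b g h : Rn R n -> R).
Local Notation leb := (@lebesgue_Rn R n).

Lemma measurable_euclidean_dist :
  measurable_fun setT (fun z : Rn R n * Rn R n => euclidean_dist z.1 z.2).
Proof.
have mc1 i : measurable_fun setT (fun z : Rn R n * Rn R n => tnth z.1 i : R).
  exact: (measurableT_comp (@measurable_tnth _ (measurableTypeR R) n i) (@measurable_fst _ _ _ _)).
have mc2 i : measurable_fun setT (fun z : Rn R n * Rn R n => tnth z.2 i : R).
  exact: (measurableT_comp (@measurable_tnth _ (measurableTypeR R) n i) (@measurable_snd _ _ _ _)).
have -> : (fun z : Rn R n * Rn R n => euclidean_dist z.1 z.2) =
    (fun z => (\sum_(i < n) (tnth z.1 i - tnth z.2 i) ^+ 2) `^ 2^-1).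
  apply/funext => z; rewrite powR12_sqrt//; apply: sumr_ge0 => i _; exact: sqr_ge0.
apply: (measurableT_comp (@measurable_powR _ _)); apply: measurable_sum => i.
by have ? := mc1 i; have ? := mc2 i; mfun.
Qed.

Definition riesz (r : R) b (k : nat) h (z : Rn R n * Rn R n) : R :=
  `|b z.1 - b z.2| ^+ k * h z.2 / euclidean_dist z.1 z.2 `^ r.

Lemma measurable_riesz r b k h : measurable_fun setT b -> measurable_fun setT h ->
  measurable_fun setT (riesz r b k h).
Proof.
move=> mb mh; have md := measurable_euclidean_dist.
have ? := measurableT_comp mb (@measurable_fst _ _ (Rn R n) (Rn R n)).
have ? := measurableT_comp mb (@measurable_snd _ _ (Rn R n) (Rn R n)).
have ? := measurableT_comp mh (@measurable_snd _ _ (Rn R n) (Rn R n)).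
have -> : riesz r b k h = fun z => `|b z.1 - b z.2| ^+ k * h z.2 * euclidean_dist z.1 z.2 `^ (- r).
  by apply/funext => z; rewrite /riesz powRN.
by mfun.
Qed.

Lemma riesz_ge0 r b k h z : (forall x, 0 <= h x) -> 0 <= riesz r b k h z.
Proof. by move=> h0; rewrite divr_ge0 ?powR_ge0// mulr_ge0// exprn_ge0. Qed.

(** For the truncated kernel finitely many generations of the shifted grids suffice, and the bound
    on each grid depends neither on the grid nor on the number of generations. The constant is the
    number of grids times [6 ^ r] times the dyadic one. *)
Theorem riesz_bilinear a1 a2 K (k : nat) : (0 < n)%N -> 1 < a1 -> 1 < a2 ->
  a1^-1 + a2^-1 < 1 -> 1 <= K -> (0 < k)%N -> exists C, 0 < C /\
  forall mu lam b B1 B2 h g,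
  (forall l (l0 : 0 < l) s, [/\ dyadic_Apq (grid s l0) a1 a2 K mu, dyadic_Apq (grid s l0) a1 a2 K lam &
     dyadic_bmo (grid s l0) mu lam b B1 B2]) ->
  measurable_fun setT h -> (forall y, 0 <= h y) ->
  measurable_fun setT g -> (forall y, 0 <= g y) ->
  (\int[leb]_x (h x `^ (1 - a1^-1)^-1 * (mu x)^-1 `^ a1)%:E <= 1)%E ->
  (\int[leb]_x (g x `^ (1 - a2^-1)^-1 * lam x `^ a2)%:E <= 1)%E ->
  (\int[leb]_x ((g x * lam x `^ a2)%:E *
     \int[leb]_y (riesz (n%:R * (a1^-1 + a2^-1)) b k (fun y => h y * (mu y)^-1 `^ a1) (x, y))%:E)
   <= (C * (B1 * B2 ^+ k.-1))%:E)%E.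
Proof.
move=> n0 a11 a21 a12 K1 k0.
have D2 : 2 <= 2 ^+ n :> R by rewrite -[leLHS]expr1; apply: ler_weXn2l => //; lra.
have [C [C0 HC]] := dyadic_bilinear (m := leb) D2 a11 a21 a12 K1 k0.
have [r Er] : exists r, r = n%:R * (a1^-1 + a2^-1) by eexists.
have r0 : 0 < r.
  by rewrite Er mulr_gt0 ?ltr0n// addr_gt0 ?invr_gt0//; lra.
exists (#|{: {ffun 'I_n -> bool}}|%:R * (6 `^ r * C)); split.
  rewrite mulr_gt0 ?mulr_gt0 ?powR_gt0// ltr0n; apply/card_gt0P.
  by exists [ffun=> true].
move=> mu lam b B1 B2 h g Hgrid mh h0 mg g0 hh hg.
have [Amu Alam bb] := Hgrid 1 ltr01 (fun=> 0).
have [[mb _] B10 B20 _ _] := bb.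
have [mm m0 fm2 fm1 Hm] := Amu; have [ml l0 fl2 fl1 Hl] := Alam.
pose F y := g y * lam y `^ a2; pose H y := h y * (mu y)^-1 `^ a1.
have F0 y : 0 <= F y by rewrite mulr_ge0 ?powR_ge0.
have H0 y : 0 <= H y by rewrite mulr_ge0 ?powR_ge0.
have mF : measurable_fun setT F by apply: measurable_funM => //; exact: lfin_meas fl2.
have mH : measurable_fun setT H by apply: measurable_funM => //; exact: lfin_meas fm1.
rewrite -Er -/(F _) -/(H _).
pose A_ (M : nat) := [set z : Rn R n * Rn R n | (2 ^+ M)^-1 <= euclidean_dist z.1 z.2] `&`
   [set z | euclidean_dist z.1 z.2 < 2 ^+ M].
have mA M : measurable (A_ M).
  have md := measurable_euclidean_dist.
  apply: measurableI; rewrite -[X in measurable X]setTI.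
    by apply: measurable_fun_le.
  rewrite setTI (_ : mkset _ = ~` [set z | 2 ^+ M <= euclidean_dist z.1 z.2]).
    by apply: measurableC; rewrite -[X in measurable X]setTI; exact: measurable_fun_le.
  by apply/seteqP; split => z /=; rewrite ltNge => /negP.
pose V := riesz r b k H.
have mV : measurable_fun setT V by exact: measurable_riesz.
have V0 z : 0 <= V z by exact: riesz_ge0.
apply: (@kernel_exhaustion _ _ _ _ (fun M z => \1_(A_ M) z * V z) V) => //.
- move=> M; have ? := mA M; by mfun.
- by move=> M z; rewrite mulr_ge0.
- move=> z N M NM; apply: ler_wpM2r => //; rewrite !indicE.
  have [|] := boolP (z \in A_ N); last by rewrite ler0n.
  rewrite inE => -[/= h1 h2]; rewrite mem_set//; split => /=.
    apply: le_trans h1; rewrite lef_pV2 ?posrE ?exprn_gt0//.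
    by apply: ler_weXn2l => //; lra.
  apply: lt_le_trans h2 _; apply: ler_weXn2l => //; lra.
(* On the diagonal the kernel is 0 by convention, since division by 0 gives 0, so the truncations
   agree with it there too. *)
- move=> z; have [d0|d0] := eqVneq (euclidean_dist z.1 z.2) 0.
    by near=> M; rewrite /V /riesz d0 powR0 ?gt_eqF// invr0 mulr0 mulr0.
  have dp : 0 < euclidean_dist z.1 z.2 by rewrite lt_neqAle eq_sym d0 sqrtr_ge0.
  near=> M; rewrite indicE mem_set ?mul1r//; split => /=.
    rewrite invf_ple ?posrE ?exprn_gt0//.
    have h1 : (euclidean_dist z.1 z.2)^-1 <= M%:R by near: M; exact: nbhs_infty_ger.
    apply: le_trans h1 _; rewrite -natrX ler_nat ltnW//; exact: ltn_expl.
  have h1 : euclidean_dist z.1 z.2 <= M%:R by near: M; exact: nbhs_infty_ger.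
  apply: le_lt_trans h1 _; rewrite -natrX ltr_nat; exact: ltn_expl.
(* With [2 * M] generations below this length, [kernel_cover] applies to distances from [2 ^- M] up
   to [2 ^ M]. *)
- move=> M; pose l : R := 3 * 2 ^+ M.
  have lp : 0 < l by rewrite mulr_gt0// exprn_gt0.
  pose c (j : nat) := 6 `^ r * ((l / 2 ^+ j) `^ r)^-1.
  have c0 j : 0 <= c j by rewrite mulr_ge0 ?powR_ge0// invr_ge0 powR_ge0.
  pose W (z : Rn R n * Rn R n) := `|b z.1 - b z.2| ^+ k * H z.2.
  have W0 z : 0 <= W z by rewrite mulr_ge0// exprn_ge0.
  have mW : measurable_fun setT W.
    have ? := measurableT_comp mb (@measurable_fst _ _ (Rn R n) (Rn R n)).
    have ? := measurableT_comp mb (@measurable_snd _ _ (Rn R n) (Rn R n)).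
    have ? := measurableT_comp mH (@measurable_snd _ _ (Rn R n) (Rn R n)).
    by rewrite /W; mfun.
  have mAV : measurable_fun setT (fun z => \1_(A_ M) z * V z).
    by have ? := mA M; mfun.
  have AV0 z : 0 <= \1_(A_ M) z * V z by rewrite mulr_ge0.
  pose GG (e : {ffun 'I_n -> bool}) := @grid R n l (grid_shift l e) lp.
  have dom x y : \1_(A_ M) (x, y) * V (x, y) <= \sum_(e : {ffun 'I_n -> bool}) \sum_(j < M + M) c j * (\1_(cell (GG e) j x) y * W (x, y)).
    rewrite indicE; have [|_] := boolP ((x, y) \in A_ M); last first.
      rewrite mul0r; apply: sumr_ge0 => e _; apply: sumr_ge0 => j _.
      by rewrite mulr_ge0// mulr_ge0.
    rewrite inE => -[/= d1 d2]; rewrite mul1r.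
    have l3 : l / 3 = 2 ^+ M by rewrite /l mulrAC mulfV ?mul1r.
    have d1' : l / 3 / 2 ^+ (M + M) <= euclidean_dist x y.
      by rewrite l3 exprD invfM mulrA mulfV ?mul1r// gt_eqF// exprn_gt0.
    rewrite -l3 in d2.
    have := ler_wpM2l (W0 (x, y)) (kernel_cover lp (ltW r0) d1' d2).
    move=> le1; apply: le_trans le1 _.
    rewrite mulr_sumr; apply: ler_sum => e _; rewrite mulr_sumr; apply: ler_sum => j _.
    by rewrite le_eqVlt; apply/orP; left; apply/eqP; rewrite /c; ring.
  apply: le_trans (kernel_sum c0 mAV AV0 mW W0 mF F0 dom) _.
  apply: (@le_trans _ _ (\sum_(e : {ffun 'I_n -> bool}) (6 `^ r * (C * (B1 * B2 ^+ k.-1)))%:E)%E); last first.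
    rewrite sumEFin lee_fin sumr_const -mulr_natl le_eqVlt; apply/orP; left; apply/eqP; ring.
  apply: lee_sum => e _.
  have [Amu' Alam' bb'] := Hgrid l lp (grid_shift l e).
  have := HC _ mu lam b B1 B2 h g Amu' Alam' bb' mh h0 mg g0 hh hg (M + M)%N.
  have r6 : (0 <= (6 `^ r)%:E :> \bar R)%E by rewrite lee_fin powR_ge0.
  move/(lee_wpmul2l r6); rewrite -EFinM; apply: le_trans.
  rewrite ge0_sume_distrr; last first.
    move=> j _; apply: mule_ge0; first by rewrite lee_fin invr_ge0 powR_ge0.
    apply: integral_ge0 => x _; apply: mule_ge0; first by rewrite lee_fin; exact: F0.
    by apply: integral_ge0 => y _; rewrite lee_fin; exact: (W0 (x, y)).
  apply: lee_sum => j _; rewrite muleA -EFinM.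
  (* A cell has measure the [n]-th power of its side, and [r = n * (a1^-1 + a2^-1)]: the dyadic
     coefficient is the kernel at the scale of the cell. *)
  have -> : kap (GG e) j `^ (a1^-1 + a2^-1) = (l / 2 ^+ j) `^ r.
    by rewrite /= -powR_mulrn ?divr_ge0 ?exprn_ge0 ?(ltW lp)// -powRrM Er.
  exact: lexx.
Unshelve. all: by end_near. Qed.

End core.

Local Notation coord := Defs.coord.

(** * Closed cubes and half-open cells *)

Section cubes.
Context {R : realType} {n : nat}.
Implicit Types (x y : Rn R n) (Q D : set (Rn R n)) (f w b : Rn R n -> R).
Local Notation leb := (@lebesgue_Rn R n).

Lemma measurable_box (A : 'I_n -> set (measurableTypeR R)) : (forall i, measurable (A i)) ->
  measurable [set x : Rn R n | forall i, A i (tnth x i)].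
Proof.
move=> mA; rewrite (_ : mkset _ = \bigcap_(i in [set: 'I_n]) ((fun x : Rn R n => tnth x i) @^-1` A i)).
  apply: fin_bigcap_measurable => // i _; rewrite -[X in measurable X]setTI.
  exact: (@measurable_tnth _ (measurableTypeR R) n i measurableT).
by apply/seteqP; split => [x xA i _|x xA i]; exact: xA.
Qed.

Let seg x (l : R) (i : 'I_n) : set (measurableTypeR R) := `[coord x i, coord x i + l]%classic.

Let cube_seg x (l : R) : cube x l = [set y | forall i, seg x l i (tnth y i)].
Proof. by apply/seteqP; split => y xy i; have := xy i; rewrite /seg/= in_itv. Qed.

Lemma measurable_cube x (l : R) : measurable (cube x l).
Proof. by rewrite cube_seg; apply: measurable_box => i; exact: measurable_itv. Qed.

Lemma lebesgue_cube x (l : R) : 0 < l -> leb (cube x l) = (l ^+ n)%:E.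
Proof.
move=> l0; rewrite cube_seg lebesgue_Rn_box; last by move=> i; exact: measurable_itv.
rewrite (eq_bigr (fun=> l%:E)) => [|i _]; first by rewrite prodEFin prodr_const card_ord.
rewrite /seg lebesgue_measure_itv/= lte_fin ltrDl l0 -EFinB; congr EFin; ring.
Qed.

Lemma compact_cube x (l : R) : compact_Rn (cube x l).
Proof.
rewrite /compact_Rn (_ : _ @` _ = [set v : 'rV[R]_n | forall i, `[coord x i, coord x i + l]%classic (v ord0 i)]).
  by apply: (@rV_compact R n (fun i => `[coord x i, coord x i + l]%classic)) => i; exact: segment_compact.
apply/seteqP; split => [_ [y xy <-] i|v xv] /=.
  by rewrite mxE in_itv/=; exact: xy.
exists [tuple v ord0 i | i < n].
  by move=> i; rewrite /coord tnth_mktuple; have := xv i; rewrite /= in_itv.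
by apply/rowP => i; rewrite mxE /coord tnth_mktuple.
Qed.

Lemma integral_full_measure (A Q : set (Rn R n)) (F : Rn R n -> \bar R) :
  measurable A -> measurable Q -> A `<=` Q -> leb (Q `\` A) = 0%E ->
  measurable_fun setT F -> (\int[leb]_(x in Q) F x = \int[leb]_(x in A) F x)%E.
Proof.
move=> mA mQ AQ QA mF; rewrite integral_mkcond [RHS]integral_mkcond.
apply: ae_eq_integral => //.
- by apply/(measurable_restrictT F mQ); exact: measurable_funTS.
- by apply/(measurable_restrictT F mA); exact: measurable_funTS.
exists (Q `\` A); split => //; first exact: measurableD.
move=> x /=; apply: contra_notP => xn _; rewrite !patchE.
have [xA|xA] := pselect (A x); first by rewrite !mem_set//; exact: AQ.
rewrite (memNset xA); case: ifPn => //; rewrite inE => xQ.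
by exfalso; apply: xn.
Qed.

(** A half-open cell lies in its closed cube and has the same finite measure, so the difference is
    null. *)
Lemma cell_cube (l : R) (l0 : 0 < l) s j x : exists Q, [/\ cubes Q, measurable Q,
  cell (grid s l0) j x `<=` Q, leb Q = (kap (grid s l0) j)%:E &
  forall F : Rn R n -> \bar R, measurable_fun setT F ->
    (\int[leb]_(y in Q) F y = \int[leb]_(y in cell (grid s l0) j x) F y)%E].
Proof.
have lj0 : 0 < l / 2 ^+ j by rewrite divr_gt0// exprn_gt0.
pose c := [tuple (gidx (l / 2 ^+ j) (s i) (tnth x i))%:~R * (l / 2 ^+ j) + s i | i < n] : Rn R n.
have sub : cell (grid s l0) j x `<=` cube c (l / 2 ^+ j).
  move=> y xy i; rewrite /coord tnth_mktuple.
  have /andP[h1 h2] := gidx_itv (s i) (tnth y i) lj0.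
  have xyi : gidx (l / 2 ^+ j) (s i) (tnth y i) = gidx (l / 2 ^+ j) (s i) (tnth x i) := xy i.
  rewrite xyi in h1 h2; rewrite h1/=; apply/ltW/(lt_le_trans h2).
  by rewrite intrD mulrDl mul1r addrAC.
have mc := measurable_cell (grid s l0) j x.
have mQ := measurable_cube c (l / 2 ^+ j).
exists (cube c (l / 2 ^+ j)); split => //; first by exists c, (l / 2 ^+ j).
  by rewrite lebesgue_cube.
move=> F mF; apply: integral_full_measure => //.
have kE : leb (cell (grid s l0) j x) = ((l / 2 ^+ j) ^+ n)%:E by exact: (cell_kap (grid s l0)).
have fQ : (leb (cube c (l / 2 ^+ j)) < +oo)%E by rewrite lebesgue_cube ?ltry.
have := measureD mQ mc fQ; rewrite (setIidr sub) => E.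
apply: (etrans E); apply: (etrans (congr2 (fun a b : \bar R => (a - b)%E) (lebesgue_cube c lj0) kE)).
by rewrite -EFinB subrr.
Qed.

Definition big_cube (N : nat) : set (Rn R n) := cube [tuple - N.+1%:R | i < n] (2 * N.+1%:R).

Lemma big_cube_cubes N : cubes (big_cube N).
Proof. by exists [tuple - N.+1%:R | i < n], (2 * N.+1%:R); split => //; rewrite mulr_gt0. Qed.

Lemma big_cubeP N x : big_cube N x <-> forall i, `|coord x i| <= N.+1%:R.
Proof.
have E i : (coord [tuple - N.+1%:R | i < n] i <= coord x i <=
    coord [tuple - N.+1%:R | i < n] i + 2 * N.+1%:R) = (`|coord x i| <= N.+1%:R :> R).
  have -> : coord ([tuple - N.+1%:R | i < n] : Rn R n) i = - N.+1%:R :> R.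
    by rewrite /coord tnth_mktuple.
  have -> : - N.+1%:R + 2 * N.+1%:R = N.+1%:R :> R by ring.
  by rewrite ler_norml.
by split => h i; [rewrite -E|rewrite E]; exact: h.
Qed.

Lemma big_cube_le N M : (N <= M)%N -> big_cube N `<=` big_cube M.
Proof.
move=> NM x /big_cubeP xN; apply/big_cubeP => i; apply: le_trans (xN i) _.
by rewrite ler_nat.
Qed.

Lemma big_cube_cover (l : R) : exists N, forall x, (forall i, `|coord x i| <= l) -> big_cube N x.
Proof.
exists (Num.truncn l) => x xl; apply/big_cubeP => i.
by apply: le_trans (xl i) _; rewrite ltW// truncnS_gt.
Qed.

Lemma big_cube_point x : exists N, big_cube N x.
Proof.
have [N HN] := big_cube_cover (\sum_i `|coord x i|); exists N; apply: HN => i.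
by rewrite (bigD1 i)//= lerDl sumr_ge0.
Qed.

Lemma cube_big_cube Q : cubes Q -> exists N, Q `<=` big_cube N.
Proof.
move=> [x [l [l0 ->]]]; have [N HN] := big_cube_cover (\sum_i `|coord x i| + l).
exists N => y xy; apply: HN => i.
have h : `|coord x i| <= \sum_i `|coord x i| by rewrite (bigD1 i)//= lerDl sumr_ge0.
have /andP[h1 h2] := xy i.
rewrite -[coord y i](subrK (coord x i)) addrC; apply: le_trans (ler_normD _ _) _.
by apply: lerD => //; rewrite ger0_norm ?subr_ge0//; lra.
Qed.

Lemma cubes_measurable Q : cubes Q -> measurable Q.
Proof. by move=> [x [l [_ ->]]]; exact: measurable_cube. Qed.

Lemma cubes_lebesgue Q : cubes Q -> exists2 v, 0 < v & leb Q = v%:E.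
Proof. by move=> [x [l [l0 ->]]]; exists (l ^+ n); [exact: exprn_gt0|exact: lebesgue_cube]. Qed.

Lemma cubes_loc_integrable f Q : loc_integrable f -> cubes Q ->
  (\int[leb]_(x in Q) `|f x|%:E < +oo)%E.
Proof. by move=> [_ H] [x [l [_ ->]]]; apply: H; exact: compact_cube. Qed.

Lemma measurable_big_cube N : measurable (big_cube N).
Proof. exact: cubes_measurable (big_cube_cubes N). Qed.

End cubes.

(** * Weights and mean oscillation on cubes *)

Lemma integral_eq0_null d (T : measurableType d) (R : realType) (m : {measure set T -> \bar R})
    (D : set T) (F : T -> \bar R) : measurable D -> measurable_fun setT F ->
  (forall x, 0 <= F x)%E -> (\int[m]_(x in D) F x = 0)%E ->
  m (D `&` [set x | F x != 0%E]) = 0%E.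
Proof.
move=> mD mF F0 I0; have mFD : measurable_fun D F := measurable_funTS mF.
have /(ae_eq_integral_abs m mD mFD) H : (\int[m]_(x in D) `|F x| = 0)%E.
  by rewrite -[RHS]I0; apply: eq_integral => x _; rewrite gee0_abs.
have mS : measurable (D `&` [set x | F x != 0%E]).
  by exact: emeasurable_neq mD mFD 0%E.
apply: measure_negligible => //; apply: negligibleS H => x /= [Dx Fx] H.
by move: Fx; rewrite (H Dx) eqxx.
Qed.

Section weights.
Context {R : realType} {n : nat}.
Implicit Types (x y : Rn R n) (Q D : set (Rn R n)) (f w b : Rn R n -> R).
Local Notation leb := (@lebesgue_Rn R n).

Lemma null_of_big_cubes (A : set (Rn R n)) : measurable A ->
  (forall N, leb (big_cube N `&` A) = 0%E) -> leb A = 0%E.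
Proof.
move=> mA H; apply: measure_negligible => //.
have -> : A = \bigcup_N (big_cube N `&` A).
  apply/seteqP; split => [x Ax|x [N _ []]//].
  by have [N xN] := big_cube_point x; exists N.
apply: negligible_bigcup => N.
have mNA := measurableI _ _ (measurable_big_cube N) mA.
by apply/(negligibleP _ mNA); exact: H.
Qed.

(* Off a null set an A_(p,q) weight that is not almost everywhere zero does not
   vanish; the dyadic theory assumes positivity everywhere. *)
Definition zero_to_one w x : R := if w x == 0 then 1 else w x.

Lemma zero_to_one_gt0 w x : (forall x, 0 <= w x) -> 0 < zero_to_one w x.
Proof. by move=> w0; rewrite /zero_to_one; case: eqVneq => // h; rewrite lt_neqAle eq_sym h w0. Qed.

Let mzero w : measurable_fun setT w -> measurable_fun setT (fun x => w x == 0).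
Proof.
by move=> mw; apply: (measurable_fun_eqr mw); exact: measurable_cst.
Qed.

Lemma measurable_zero_to_one w : measurable_fun setT w -> measurable_fun setT (zero_to_one w).
Proof.
move=> mw; apply: measurable_fun_ifT; [exact: mzero|exact: measurable_cst|exact: mw].
Qed.

Lemma measurable_eq0 w : measurable_fun setT w -> measurable [set x | w x = 0].
Proof.
move=> mw; have := mw measurableT [set 0] (measurable_set1 0).
by rewrite setTI.
Qed.

Section Apq.
Variables (p q : R).
Hypotheses (p1 : 1 < p) (pq : p < q).
Let p' := conjugate_exponent p.
Let p0 : 0 < p. Proof. exact: lt_trans p1. Qed.
Let q0 : 0 < q. Proof. exact: lt_trans pq. Qed.
Let p'0 : 0 < p'. Proof. by rewrite divr_gt0// subr_gt0. Qed.

Let Xw w Q := (\int[leb]_(x in Q) (w x `^ q)%:E)%E.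
Let Yw w Q := (\int[leb]_(x in Q) ((w x)%:E^-1 `^ p'))%E.

(** A zero of [w] makes the extended power infinite; this is how the weight condition detects a
    large zero set. *)
Let invE w x : ((w x)%:E^-1 `^ p')%E = if w x == 0 then +oo%E else ((zero_to_one w x)^-1 `^ p')%:E.
Proof.
rewrite inver /zero_to_one; case: eqVneq => _; first by rewrite poweRyr// gt_eqF.
by rewrite poweR_EFin.
Qed.

Variable w : Rn R n -> R.
Hypothesis Apq_w : Apq p q w.

Let w0 x : 0 <= w x. Proof. by have [[]] := Apq_w. Qed.
Let mw : measurable_fun setT w. Proof. by have [[_ []]] := Apq_w. Qed.
Let mp := measurable_zero_to_one mw.
Let pp0 x := zero_to_one_gt0 x w0.

Let mpi : measurable_fun setT (fun x => ((zero_to_one w x)^-1 `^ p')).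
Proof.
by have ? := measurable_inv mp pp0; mfun.
Qed.

Let minv : measurable_fun setT (fun x => ((w x)%:E^-1 `^ p')%E).
Proof.
under eq_fun do rewrite invE.
apply: measurable_fun_ifT; [exact: mzero|exact: measurable_cst|].
by apply/measurable_EFinP.
Qed.

Let mq : measurable_fun setT (fun x => (w x `^ q)%:E). Proof. by mfun. Qed.

Let inv0 x : (0 <= (w x)%:E^-1 `^ p')%E. Proof. exact: poweR_ge0. Qed.
Let wq0 x : (0 <= (w x `^ q)%:E)%E. Proof. by rewrite lee_fin powR_ge0. Qed.

Let X0 Q : (0 <= Xw w Q)%E. Proof. exact: integral_ge0. Qed.

Let Y0 Q : cubes Q -> (0 < Yw w Q)%E.
Proof.
move=> cQ; have mQ := cubes_measurable cQ.
rewrite lt_neqAle integral_ge0// andbT eq_sym; apply/eqP => Y0.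
have := integral_eq0_null mQ minv inv0 Y0.
rewrite (_ : Q `&` _ = Q).
  have [v v0 vE] := cubes_lebesgue cQ; move=> /(etrans (esym vE))[] /eqP.
  by rewrite gt_eqF.
apply/seteqP; split => [x []//|x Qx]; split => //=.
rewrite invE; case: ifP => // _; rewrite eqe gt_eqF// powR_gt0// invr_gt0.
exact: pp0.
Qed.

Let bound Q v : cubes Q -> leb Q = v%:E -> 0 < v ->
  ((Xw w Q * v^-1%:E) * (Yw w Q * v^-1%:E) `^ (q / p') <= Apq_const p q w)%E.
Proof.
move=> cQ vE v0; apply: ereal_sup_ubound; exists Q => //.
by rewrite /average vE inver gt_eqF.
Qed.

(** A finite product of two positive extended numbers has finite factors. The second factor is
    always positive, since [w] takes finite values. *)
Let finite_XY Q : cubes Q -> Xw w Q != 0%E -> (Xw w Q < +oo)%E /\ (Yw w Q < +oo)%E.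
Proof.
move=> cQ Xn0; have [v v0 vE] := cubes_lebesgue cQ.
have := bound cQ vE v0; have Yp := Y0 cQ.
have Xp : (0 < Xw w Q)%E by rewrite lt_neqAle eq_sym Xn0 X0.
have vi : (0 < v^-1%:E :> \bar R)%E by rewrite lte_fin invr_gt0.
have Xv : (0 < Xw w Q * v^-1%:E)%E by exact: mule_gt0.
have Yv : (0 < (Yw w Q * v^-1%:E) `^ (q / p'))%E by apply/poweR_gt0/mule_gt0.
have [_ Mfin] := Apq_w.
move=> /le_lt_trans /(_ Mfin) H; split; rewrite ltey; apply/eqP => E; move: H.
  by rewrite E gt0_mulye// gt0_mulye// ltxx.
rewrite E gt0_mulye// poweRyr ?gt0_muley ?ltxx//.
by rewrite mulf_neq0 ?invr_neq0// gt_eqF.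
Qed.

Hypothesis wn0 : leb [set x | w x != 0] <> 0%E.

(** [w] may vanish on [Q] itself, so [Q] is enclosed in a large cube on which [w] is not null;
    finiteness there is inherited. *)
Let finite_cubes Q : cubes Q -> (Xw w Q < +oo)%E /\ (Yw w Q < +oo)%E.
Proof.
move=> cQ.
have [N0 XN0] : exists N, Xw w (big_cube N) != 0%E.
  apply: contrapT => H; apply: wn0; apply: null_of_big_cubes.
    rewrite (_ : mkset _ = ~` [set x | w x = 0]); first by apply: measurableC; exact: measurable_eq0.
    by apply/seteqP; split => x /= /eqP.
  move=> N; have XN : Xw w (big_cube N) = 0%E.
    by apply/eqP/negP => /negP h; apply: H; exists N.
  have mN := @measurable_big_cube R n N.
  have := integral_eq0_null mN mq wq0 XN; congr (leb _ = _); congr (_ `&` _).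
  by apply/seteqP; split => x /=; rewrite eqe powR_eq0 negb_and negbK (gt_eqF q0) orbF.
have [N1 QN1] := cube_big_cube cQ.
have QN : Q `<=` big_cube (maxn N0 N1).
  by apply: subset_trans QN1 _; apply: big_cube_le; rewrite leq_maxr.
have mQ := cubes_measurable cQ.
have mN := @measurable_big_cube R n (maxn N0 N1).
have [] := @finite_XY (big_cube (maxn N0 N1)) (big_cube_cubes _) _.
  rewrite gt_eqF//; apply: (@lt_le_trans _ _ (Xw w (big_cube N0))).
    by rewrite lt_neqAle eq_sym XN0 X0.
  apply: ge0_subset_integral => //.
  - exact: measurable_big_cube _.
  - exact: measurable_funTS.
  - by apply: big_cube_le; rewrite leq_maxl.
move=> hX hY; split.
  by apply: le_lt_trans hX; apply: ge0_subset_integral => //; exact: measurable_funTS.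
by apply: le_lt_trans hY; apply: ge0_subset_integral => //; exact: measurable_funTS.
Qed.

(** [w ^ - p'] is integrable on every large cube, hence finite almost everywhere, and it is infinite
    at the zeros of [w]. *)
Lemma Apq_null : leb [set x | w x = 0] = 0%E.
Proof.
apply: null_of_big_cubes; first exact: measurable_eq0.
move=> N; have mN := @measurable_big_cube R n N.
have [_ YN] := finite_cubes (big_cube_cubes N).
have iN : leb.-integrable (big_cube N) (fun x => (w x)%:E^-1 `^ p')%E.
  apply/integrableP; split; first exact: measurable_funTS.
  by rewrite (eq_integral (fun x => (w x)%:E^-1 `^ p')%E)// => x _; rewrite gee0_abs.
have H := integrable_ae mN iN.
apply: measure_negligible; first by apply: measurableI => //; exact: measurable_eq0.
apply: negligibleS H => x /= [xN wx] H; have := H xN.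
by rewrite invE wx eqxx.
Qed.

Lemma eq_integral_null (D : set (Rn R n)) (F H : Rn R n -> \bar R) : measurable D ->
  measurable_fun setT F -> measurable_fun setT H ->
  (forall x, w x != 0 -> F x = H x) -> (\int[leb]_(x in D) F x = \int[leb]_(x in D) H x)%E.
Proof.
move=> mD mF mH FH; apply: ae_eq_integral => //; [exact: measurable_funTS|exact: measurable_funTS|].
exists [set x | w x = 0]; split; [exact: measurable_eq0|exact: Apq_null|].
move=> x /=; apply: contra_notP => /eqP wx _; exact: FH.
Qed.

Let XE Q : cubes Q -> (\int[leb]_(x in Q) (zero_to_one w x `^ q)%:E = Xw w Q)%E.
Proof.
move=> cQ; apply: eq_integral_null => //; first exact: cubes_measurable.
  by mfun.
by move=> x; rewrite /zero_to_one; case: eqP.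
Qed.

Let YE Q : cubes Q -> (\int[leb]_(x in Q) ((zero_to_one w x)^-1 `^ p')%:E = Yw w Q)%E.
Proof.
move=> cQ; apply: eq_integral_null => //; first exact: cubes_measurable.
  by apply/measurable_EFinP.
by move=> x w0'; rewrite invE (negbTE w0').
Qed.

Lemma Apq_cubes Q : cubes Q -> (\int[leb]_(x in Q) (zero_to_one w x `^ q)%:E < +oo)%E /\
  (\int[leb]_(x in Q) ((zero_to_one w x)^-1 `^ p')%:E < +oo)%E.
Proof. by move=> cQ; rewrite XE// YE//; exact: finite_cubes. Qed.

Lemma Apq_Aw K (l : R) (l0 : 0 < l) s : 1 <= K -> fine (Apq_const p q w) <= K ->
  dyadic_Apq (grid s l0) p' q K (zero_to_one w).
Proof.
move=> K1 cK; have pp_pos x : 0 < zero_to_one w x := pp0 x.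
have lf f : measurable_fun setT f -> (forall x, 0 <= f x) ->
    (forall Q, cubes Q -> \int[leb]_(x in Q) (f x)%:E < +oo)%E -> lfin (grid s l0) f.
  move=> mf f0 fQ; split=> // x.
  have [Q [cQ mQ sub vQ QE]] := cell_cube l0 s 0 x.
  by rewrite -QE; [exact: fQ|exact/measurable_EFinP].
have f1 : lfin (grid s l0) (fun y => zero_to_one w y `^ q).
  apply: lf; [by mfun|by move=> x; exact: powR_ge0|].
  by move=> Q cQ; have [h1 h2] := Apq_cubes cQ; exact: h1.
have f2 : lfin (grid s l0) (fun y => (zero_to_one w y)^-1 `^ p').
  apply: lf; [exact: mpi|by move=> x; exact: powR_ge0|].
  by move=> Q cQ; have [h1 h2] := Apq_cubes cQ; exact: h2.
split; [exact: mp|exact: pp_pos|exact: f1|exact: f2|].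
move=> j x; rewrite !Nm_def.
have [Q [cQ mQ sub vQ QE]] := cell_cube l0 s j x.
have k0 := kap_gt0 (grid s l0) j.
have := bound cQ vQ k0; rewrite -(XE cQ) -(YE cQ) !QE; last 2 first.
- by apply/measurable_EFinP; exact: mpi.
- by mfun.
rewrite -(SE _ _ f1) -(SE _ _ f2) -!EFinM -!av_def.
have [_ Mfin] := Apq_w.
have M0 : (0 <= Apq_const p q w)%E.
  apply: (@le_trans _ _ (average Q (fun x => (w x `^ q)%:E) *
      average Q (fun x => (w x)%:E^-1 `^ p') `^ (q / p'))%E); last first.
    by apply: ereal_sup_ubound; exists Q.
  apply: mule_ge0; last exact: poweR_ge0.
  rewrite /average vQ; apply: mule_ge0; first by apply: integral_ge0 => y _; exact: wq0.
  by rewrite inver (gt_eqF k0) lee_fin invr_ge0 ltW.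
have Mf : Apq_const p q w \is a fin_num by rewrite ge0_fin_numE.
rewrite -(fineK Mf) lee_fin => /le_trans /(_ cK).
set X := cell_av _ _ (fun y => _ `^ q) _; set Y := cell_av _ _ (fun y => (_)^-1 `^ _) _.
have X0' : 0 <= X by apply: av_ge0 => y; exact: powR_ge0.
have Y0' : 0 <= Y by apply: av_ge0 => y; exact: powR_ge0.
move=> le; have qi0 : 0 <= q^-1 by rewrite invr_ge0 ltW.
have := le_powR qi0 (mulr_ge0 X0' (powR_ge0 _ _)) le.
rewrite powRM ?powR_ge0// -powRrM (mulrAC q) mulfV ?gt_eqF// mul1r => /le_trans; apply.
(* The [q]-th root of the weight constant appears; it is at most [K] because [K >= 1] and
   [q > 1]. *)
rewrite -[leRHS]powRr1 ?(le_trans ler01)//; apply: ler_powR => //.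
by rewrite invf_le1// ltW// (lt_trans p1).
Qed.

End Apq.
End weights.

Section bmo.
Context {R : realType} {n : nat}.
Implicit Types (x y : Rn R n) (Q D : set (Rn R n)) (f w b mu lam : Rn R n -> R).
Local Notation leb := (@lebesgue_Rn R n).

Definition osc b Q : \bar R :=
  (\int[leb]_(x in Q) `|b x - fine (average Q (EFin \o b))|%:E)%E.

Lemma osc_ge0 b Q : (0 <= osc b Q)%E.
Proof. by apply: integral_ge0 => x _; rewrite lee_fin. Qed.

Lemma bmo_norm_ge0 w b : (forall x, 0 <= w x) -> (0 <= bmo_norm w b)%E.
Proof.
move=> w0; apply: (@le_trans _ _ (osc b (big_cube 0) / \int[leb]_(x in big_cube 0) (w x)%:E)%E).
  apply: mule_ge0; first exact: osc_ge0.
  by rewrite inve_ge0; apply: integral_ge0 => x _; rewrite lee_fin.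
by apply: ereal_sup_ubound; exists (big_cube 0) => //; exact: big_cube_cubes.
Qed.

Lemma osc_le w b Q : (forall x, 0 <= w x) -> cubes Q -> (bmo_norm w b < +oo)%E ->
  (\int[leb]_(x in Q) (w x)%:E < +oo)%E ->
  (osc b Q <= bmo_norm w b * \int[leb]_(x in Q) (w x)%:E)%E.
Proof.
move=> w0 cQ Mfin; have N0 : (0 <= \int[leb]_(x in Q) (w x)%:E)%E.
  by apply: integral_ge0 => x _; rewrite lee_fin.
have : (osc b Q / \int[leb]_(x in Q) (w x)%:E <= bmo_norm w b)%E.
  by apply: ereal_sup_ubound; exists Q.
move: N0; case: (\int[leb]_(x in Q) (w x)%:E)%E => [r| |]//.
rewrite lee_fin le_eqVlt => /predU1P[<-|r0] + _.
  (* Division by a null mass gives [+oo] unless the oscillation vanishes, so a finite norm forces it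
     to vanish. *)
  rewrite inver eqxx mule0 => H; have [->//|o0] := eqVneq (osc b Q) 0%E.
  have op : (0 < osc b Q)%E by rewrite lt_neqAle eq_sym o0 osc_ge0.
  by move: H; rewrite gt0_muley// => /le_lt_trans /(_ Mfin); rewrite ltxx.
by rewrite inver gt_eqF// lee_pdivrMr.
Qed.

Section cell.
Variables (l : R) (l0 : 0 < l) (s : 'I_n -> R).
Local Notation G := (grid s l0).

Lemma labs_loc_integrable b : loc_integrable b -> labs G b.
Proof.
move=> bL; have [mb _] := bL; split=> //; split=> [|x|x]; [by mfun|exact: normr_ge0|].
have [Q [cQ mQ sub vQ QE]] := cell_cube l0 s 0 x.
by rewrite -QE; [exact: cubes_loc_integrable|mfun].
Qed.

Lemma mean_average b j x Q : loc_integrable b -> leb Q = (kap G j)%:E ->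
  (forall F : Rn R n -> \bar R, measurable_fun setT F ->
    (\int[leb]_(y in Q) F y = \int[leb]_(y in cell G j x) F y)%E) ->
  fine (average Q (EFin \o b)) = mean G j b x.
Proof.
move=> bL vQ QE; have fb := labs_loc_integrable bL; have [mb _] := fb.
rewrite /average vQ inver gt_eqF ?kap_gt0// QE; last by mfun.
rewrite integralE.
have -> : (\int[leb]_(y in cell G j x) (EFin \o b)^\+ y = (cell_int G j (fun y => Num.max (b y) 0) x)%:E)%E.
  rewrite SE; last exact: labs_pos.
  by apply: eq_integral => y _; rewrite funepos.unlock/= EFin_max.
have -> : (\int[leb]_(y in cell G j x) (EFin \o b)^\- y = (cell_int G j (fun y => Num.max (- b y) 0) x)%:E)%E.
  rewrite SE; last exact: labs_neg.
  by apply: eq_integral => y _; rewrite funeneg.unlock/= EFin_max.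
by rewrite -EFinB -EFinM /= /mean !av_def mulrBl.
Qed.

Lemma av_osc b j x B nu : loc_integrable b -> lfin G nu -> 0 <= B ->
  (forall Q, cubes Q -> osc b Q <= B%:E * \int[leb]_(y in Q) (nu y)%:E)%E ->
  cell_av G j (fun y => `|b y - mean G j b x|) x <= B * cell_av G j nu x.
Proof.
move=> bL fnu B0 H; have [mb _] := bL.
have [Q [cQ mQ sub vQ QE]] := cell_cube l0 s j x.
have := H Q cQ; rewrite /osc (mean_average bL vQ QE).
rewrite QE; last by mfun.
rewrite QE; last by have := lfin_meas fnu => ?; mfun.
have [_ fb] := labsB (mean G j b x) (labs_loc_integrable bL).
rewrite -(SE _ _ fnu) -(SE _ _ fb) -EFinM lee_fin => le.
by rewrite !av_def mulrA ler_pM2r// invr_gt0 kap_gt0.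
Qed.

End cell.

(** Young bounds [mu / lam] by [mu ^ q + lam ^ - q']. Since [p < q] gives [q' <= p'], the second
    term is at most [1 + lam ^ - p'], which is integrable on cubes. *)
Lemma nu_cubes p q mu lam Q : 1 < p -> p < q -> Apq p q mu -> Apq p q lam ->
  leb [set x | mu x != 0] <> 0%E -> leb [set x | lam x != 0] <> 0%E -> cubes Q ->
  (\int[leb]_(x in Q) (zero_to_one mu x * (zero_to_one lam x)^-1)%:E < +oo)%E.
Proof.
move=> p1 pq Amu Alam mun0 lamn0 cQ.
have q1 : 1 < q by exact: lt_trans pq.
have [q' [q'E q'1]] : exists q', q^-1 + q'^-1 = 1 /\ 1 < q'.
  have qi1 : q^-1 < 1 by rewrite invf_lt1 ?(lt_trans ltr01).
  have qi0 : 0 < q^-1 by rewrite invr_gt0 (lt_trans ltr01).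
  exists (1 - q^-1)^-1; rewrite invrK addrC subrK; split => //.
  by rewrite invf_gt1 ?subr_gt0// ltrBlDr ltrDl.
have [[m0 [mm _]] _] := Amu; have [[l0 [ml _]] _] := Alam.
have mpm := measurable_zero_to_one mm; have mpl := measurable_zero_to_one ml.
have pm0 x := zero_to_one_gt0 x m0; have pl0 x := zero_to_one_gt0 x l0.
have mi := measurable_inv mpl pl0.
have [h1 _] := Apq_cubes p1 pq Amu mun0 cQ.
have [_ h2] := Apq_cubes p1 pq Alam lamn0 cQ.
have mQ := cubes_measurable cQ.
have qp' : q' <= conjugate_exponent p.
  have p0 : 0 < p by exact: lt_trans p1.
  have ci : (conjugate_exponent p)^-1 = 1 - p^-1.
    by rewrite /conjugate_exponent; field; rewrite ?gt_eqF ?subr_gt0.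
  have c0 : 0 < conjugate_exponent p by rewrite divr_gt0// subr_gt0.
  rewrite -lef_pV2 ?posrE// ?(lt_trans ltr01)// ci.
  have : q^-1 <= p^-1 by rewrite lef_pV2 ?posrE ?(ltW pq)// (lt_trans p0).
  by move: q'E; lra.
have mA : measurable_fun Q (fun x => (zero_to_one mu x `^ q)%:E).
  by apply/measurable_funTS; mfun.
have mB : measurable_fun Q (fun x => ((zero_to_one lam x)^-1 `^ conjugate_exponent p)%:E).
  by apply/measurable_funTS; mfun.
have mC : measurable_fun Q (fun x => 1 + ((zero_to_one lam x)^-1 `^ conjugate_exponent p)%:E)%E.
  by apply: emeasurable_funD => //; exact: measurable_cst.
apply: (@le_lt_trans _ _ (\int[leb]_(x in Q) ((zero_to_one mu x `^ q)%:E +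
    (1 + ((zero_to_one lam x)^-1 `^ conjugate_exponent p)%:E)))%E).
  apply: ge0_le_integral => //.
  - by move=> x _; rewrite lee_fin mulr_ge0// ?invr_ge0 ltW.
  - by apply/measurable_funTS; mfun.
  - exact: emeasurable_funD.
  - move=> x _; rewrite -!EFinD lee_fin.
    apply: le_trans (young_pow q1 (ltW (pm0 x)) _ q'E) _; first by rewrite invr_ge0 ltW.
    rewrite lerD2l; set t := (zero_to_one lam x)^-1.
    have t0 : 0 <= t by rewrite invr_ge0 ltW.
    have [t1|t1] := leP t 1.
      have := le_powR (ltW (lt_trans ltr01 q'1)) t0 t1; rewrite powR1.
      by have := powR_ge0 t (conjugate_exponent p); lra.
    have := ler_powR (ltW t1) qp'; lra.
rewrite ge0_integralD//; last 2 first.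
- by move=> x _; rewrite lee_fin powR_ge0.
- by move=> x _; rewrite -EFinD lee_fin addr_ge0 ?powR_ge0.
apply: lte_add_pinfty; first exact: h1.
have B0 x : Q x -> (0 <= ((zero_to_one lam x)^-1 `^ conjugate_exponent p)%:E)%E.
  by move=> _; rewrite lee_fin powR_ge0.
rewrite (ge0_integralD leb mQ (fun x _ => lee01) (measurable_cst _) B0 mB).
apply: lte_add_pinfty; last exact: h2.
rewrite integral_cst//.
have [v v0 vE] := cubes_lebesgue cQ.
by rewrite mul1e; apply: (@le_lt_trans _ _ v%:E); [rewrite -vE|rewrite ltry].
Qed.

End bmo.

(** * The commutator *)

Section commutator.
Context {R : realType} {n : nat}.
Implicit Types (x y : Rn R n) (Q D : set (Rn R n)) (f w b mu lam : Rn R n -> R).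
Local Notation leb := (@lebesgue_Rn R n).

Definition abs_commutator (r : R) (k : nat) b f x : \bar R :=
  (\int[leb]_y (riesz r b k (fun y => `|f y|) (x, y))%:E)%E.

Lemma measurable_abs_commutator r k b f : measurable_fun setT b -> measurable_fun setT f ->
  measurable_fun setT (abs_commutator r k b f).
Proof.
move=> mb mf; apply: (@measurable_fun_fubini_tonelli_F _ _ _ _ _ leb
  (fun z => (riesz r b k (fun y => `|f y|) z)%:E)).
  by apply/measurable_EFinP; apply: measurable_riesz => //; mfun.
by move=> z; rewrite lee_fin; apply: riesz_ge0.
Qed.

Lemma abs_commutator_ge0 r k b f x : (0 <= abs_commutator r k b f x)%E.
Proof. by apply: integral_ge0 => y _; rewrite lee_fin; apply: riesz_ge0. Qed.

Let kern (alpha : R) (k : nat) b f (z : Rn R n * Rn R n) : R :=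
  (b z.1 - b z.2) ^+ k * f z.2 / euclidean_dist z.1 z.2 `^ (n%:R - alpha).

Let mkern alpha k b f : measurable_fun setT b -> measurable_fun setT f ->
  measurable_fun setT (kern alpha k b f).
Proof.
move=> mb mf; have md := @measurable_euclidean_dist R n.
have ? := measurableT_comp mb (@measurable_fst _ _ (Rn R n) (Rn R n)).
have ? := measurableT_comp mb (@measurable_snd _ _ (Rn R n) (Rn R n)).
have ? := measurableT_comp mf (@measurable_snd _ _ (Rn R n) (Rn R n)).
have -> : kern alpha k b f = fun z => (b z.1 - b z.2) ^+ k * f z.2 *
    euclidean_dist z.1 z.2 `^ (- (n%:R - alpha)).
  by apply/funext => z; rewrite /kern powRN.
by mfun.
Qed.

Let mkern1 alpha k b f x : measurable_fun setT b -> measurable_fun setT f ->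
  measurable_fun setT (fun y => kern alpha k b f (x, y)).
Proof.
move=> mb mf.
exact: (measurableT_comp (mkern alpha k mb mf) (@measurable_pair1 _ _ (Rn R n) (Rn R n) x)).
Qed.

Lemma commutator_le alpha k b f x : measurable_fun setT b -> measurable_fun setT f ->
  (`|commutator_frac_integral alpha k b f x| <= abs_commutator (n%:R - alpha) k b f x)%E.
Proof.
move=> mb mf; apply: le_trans (le_abse_integral _ measurableT _) _.
  by apply/measurable_EFinP; exact: (mkern1 alpha k x mb mf).
rewrite le_eqVlt; apply/orP; left; apply/eqP; apply: eq_integral => y _.
by rewrite /= /riesz/= !normrM normrX normfV (ger0_norm (powR_ge0 _ _)).
Qed.

Lemma measurable_commutator alpha k b f : measurable_fun setT b -> measurable_fun setT f ->
  measurable_fun setT (commutator_frac_integral alpha k b f).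
Proof.
move=> mb mf; have mk : measurable_fun setT (fun z => (kern alpha k b f z)%:E).
  by apply/measurable_EFinP; exact: mkern.
have -> : commutator_frac_integral alpha k b f = (fun x =>
    \int[leb]_y ((fun y => (kern alpha k b f (x, y))%:E)^\+ y) -
    \int[leb]_y ((fun y => (kern alpha k b f (x, y))%:E)^\- y))%E.
  by apply/funext => x; rewrite /commutator_frac_integral integralE.
have pm (g : Rn R n * Rn R n -> \bar R) x :
    ((fun y => g (x, y))^\+ = (fun y => g^\+ (x, y)))%E /\
    ((fun y => g (x, y))^\- = (fun y => g^\- (x, y)))%E.
  by split; apply/funext => y; rewrite ?funepos.unlock ?funeneg.unlock.
apply: emeasurable_funB.
  under eq_fun do rewrite (pm (fun z => (kern alpha k b f z)%:E) _).1.
  apply: (@measurable_fun_fubini_tonelli_F _ _ _ _ _ leb (fun z => (kern alpha k b f z)%:E)^\+%E).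
    exact: measurable_funepos.
  by move=> z; exact: funepos_ge0.
under eq_fun do rewrite (pm (fun z => (kern alpha k b f z)%:E) _).2.
apply: (@measurable_fun_fubini_tonelli_F _ _ _ _ _ leb (fun z => (kern alpha k b f z)%:E)^\-%E).
  exact: measurable_funeneg.
by move=> z; exact: funeneg_ge0.
Qed.

(** On each large cube [b] equals its mean almost everywhere. The cubes are nested, so all the means
    agree on the smallest one, which has positive measure. *)
Lemma osc_eq0_cst b : loc_integrable b -> (forall Q, cubes Q -> osc b Q = 0%E) ->
  exists c, leb [set x | b x != c] = 0%E.
Proof.
move=> [mb _] H.
have mne c : measurable [set x | b x != c].
  rewrite (_ : mkset _ = ~` [set x | b x = c]).
    apply: measurableC; have := mb measurableT [set c] (measurable_set1 c).
    by rewrite setTI.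
  by apply/seteqP; split => x /= /eqP.
pose c N := fine (average (big_cube N) (EFin \o b)).
have nul N : leb (big_cube N `&` [set x | b x != c N]) = 0%E.
  have mF : measurable_fun setT (fun x => `|b x - c N|%:E) by mfun.
  have F0 x : (0 <= `|b x - c N|%:E)%E by rewrite lee_fin.
  have := integral_eq0_null (measurable_big_cube N) mF F0 (H _ (big_cube_cubes N)).
  congr (leb _ = _); congr (_ `&` _); apply/seteqP.
  by split => x /=; rewrite eqe normr_eq0 subr_eq0.
exists (c 0%N); apply: null_of_big_cubes => // N.
suff -> : c 0%N = c N by exact: nul.
apply: contrapT => /eqP cne; have [v v0 vE] := cubes_lebesgue (@big_cube_cubes R n 0).
have n0 : leb.-negligible (big_cube 0 `&` [set x | b x != c 0%N]).
  by apply/negligibleP; [exact: measurableI (measurable_big_cube _) (mne _)|exact: nul].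
have nN : leb.-negligible (big_cube N `&` [set x | b x != c N]).
  by apply/negligibleP; [exact: measurableI (measurable_big_cube _) (mne _)|exact: nul].
have : leb (big_cube 0) = 0%E.
  apply: measure_negligible; first exact: measurable_big_cube.
  apply: negligibleS (negligibleU n0 nN) => x x0.
  have xN : big_cube N x by apply: big_cube_le x0.
  have [bx|bx] := eqVneq (b x) (c 0%N); [right|left]; split => //=.
  by rewrite bx.
by move/(etrans (esym vE)) => -[] /eqP; rewrite gt_eqF.
Qed.

(* This covers the weights vanishing almost everywhere, for which [nu] is null and
   [b] in BMO(nu) is constant. *)
Lemma commutator_cst alpha k b f (q : R) w : (0 < k)%N -> 0 < q -> loc_integrable b ->
  (forall Q, cubes Q -> osc b Q = 0%E) -> measurable_fun setT f -> measurable_fun setT w ->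
  wLnorm q w (commutator_frac_integral alpha k b f) = 0%E.
Proof.
move=> k0 q0 bL H mf mw; have [mb _] := bL.
have [c nc] := osc_eq0_cst bL H.
have mne : measurable [set x | b x != c].
  rewrite (_ : mkset _ = ~` [set x | b x = c]).
    apply: measurableC; have := mb measurableT [set c] (measurable_set1 c).
    by rewrite setTI.
  by apply/seteqP; split => x /= /eqP.
have T0 x : b x = c -> commutator_frac_integral alpha k b f x = 0%E.
  move=> bx; rewrite /commutator_frac_integral.
  rewrite (ae_eq_integral (cst 0%E)) ?integral0//.
    by apply/measurable_EFinP; exact: (mkern1 alpha k x mb mf).
  exists [set x | b x != c]; split => // y /=; apply: contra_notP => /negP.
  by rewrite negbK => /eqP by_ _; rewrite bx by_ subrr expr0n gtn_eqF// !mul0r.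
rewrite /wLnorm (ae_eq_integral (cst 0%E)) ?integral0//.
- by rewrite poweR0r// invr_eq0 gt_eqF.
- apply: emeasurable_funM; last by apply/measurable_EFinP.
  apply: (measurableT_comp (@measurable_poweR _ _)).
  exact: (measurableT_comp (@abse_measurable _ _) (measurable_commutator alpha k mb mf)).
exists [set x | b x != c]; split => // x /=; apply: contra_notP => /negP.
by rewrite negbK => /eqP bx _; rewrite T0// abse0 poweR0r ?gt_eqF// mul0e.
Qed.

End commutator.

(** * The strong-type bound for nondegenerate weights *)

Section strong.
Context {R : realType} {n : nat}.
Implicit Types (x y : Rn R n) (Q D : set (Rn R n)) (f w b mu lam : Rn R n -> R).
Local Notation leb := (@lebesgue_Rn R n).

(** Duality reduces the norm to [riesz_bilinear] with [a1 = p'] and [a2 = q]. The condition on [a1]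
    and [a2] is [p < q], and [alpha] enters only through the kernel exponent, which these two
    determine. *)
Lemma abs_commutator_strong (p q K : R) (k : nat) : (0 < n)%N -> 1 < p -> p < q ->
  1 <= K -> (0 < k)%N -> exists C, 0 < C /\
  forall (alpha : R) mu lam b (B1 B2 : R) f, q^-1 = p^-1 - alpha / n%:R ->
  Apq p q mu -> Apq p q lam ->
  fine (Apq_const p q mu) <= K -> fine (Apq_const p q lam) <= K ->
  leb [set x | mu x != 0] <> 0%E -> leb [set x | lam x != 0] <> 0%E ->
  loc_integrable b -> 0 < B1 -> 0 < B2 ->
  (forall Q, cubes Q -> osc b Q <=
    B1%:E * \int[leb]_(y in Q) (zero_to_one mu y * (zero_to_one lam y)^-1)%:E)%E ->
  (forall Q, cubes Q -> osc b Q <= B2%:E * \int[leb]_(y in Q) 1%:E)%E ->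
  measurable_fun setT f ->
  (\int[leb]_x (`|f x| `^ p * zero_to_one mu x `^ p)%:E <= 1)%E ->
  (\int[leb]_x (abs_commutator (n%:R - alpha) k b f x `^ q * (zero_to_one lam x `^ q)%:E)
    <= ((C * (B1 * B2 ^+ k.-1)) `^ q)%:E)%E.
Proof.
move=> n0 p1 pq K1 k0.
have p0 : 0 < p by exact: lt_trans p1.
have q1 : 1 < q by exact: lt_trans pq.
have q0 : 0 < q by exact: lt_trans q1.
have [a1 Ea1] : exists a1, a1 = conjugate_exponent p by eexists.
have a1E : a1^-1 = 1 - p^-1.
  by rewrite Ea1 /conjugate_exponent; field; rewrite ?gt_eqF ?subr_gt0.
have pi1 : p^-1 < 1 by rewrite invf_lt1.
have pi0 : 0 < p^-1 by rewrite invr_gt0.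
have a10 : 0 < a1 by rewrite -invr_gt0 a1E subr_gt0.
have a11 : 1 < a1 by rewrite -invf_lt1// a1E; lra.
have a12 : a1^-1 + q^-1 < 1.
  have : q^-1 < p^-1 by rewrite ltf_pV2.
  by rewrite a1E; lra.
have [C [C0 HC]] := riesz_bilinear (R := R) n0 a11 q1 a12 K1 k0.
exists C; split => // alpha mu lam b B1 B2 f alphaE Amu Alam cmu clam mun0 lamn0 bL B10 B20 o1 o2 mf hf.
have [[m0 [mm _]] _] := Amu; have [[l0 [ml _]] _] := Alam.
have mpm := measurable_zero_to_one mm; have mpl := measurable_zero_to_one ml.
have pm0 x := zero_to_one_gt0 x m0; have pl0 x := zero_to_one_gt0 x l0.
have mi := measurable_inv mpl pl0; have mim := measurable_inv mpm pm0.
have [mb _] := bL.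
(* The relation between the exponents, in the form [p'^-1 + q^-1 = 1 - alpha / n]. *)
have rE : n%:R * (a1^-1 + q^-1) = n%:R - alpha.
  have nn : n%:R != 0 :> R by rewrite pnatr_eq0 -lt0n.
  by rewrite a1E alphaE; field; rewrite nn gt_eqF.
have B0 : 0 < B1 * B2 ^+ k.-1 by rewrite mulr_gt0// exprn_gt0.
have pq' : (1 - a1^-1)^-1 = p by rewrite a1E opprB addrC subrK invrK.
have good l (lp : 0 < l) s : [/\ dyadic_Apq (grid s lp) a1 q K (zero_to_one mu),
    dyadic_Apq (grid s lp) a1 q K (zero_to_one lam) &
    dyadic_bmo (grid s lp) (zero_to_one mu) (zero_to_one lam) b B1 B2].
  have A1 := Apq_Aw p1 pq Amu mun0 lp s K1 cmu.
  have A2 := Apq_Aw p1 pq Alam lamn0 lp s K1 clam.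
  rewrite -Ea1 in A1 A2; split => //.
  have fnu : lfin (grid s lp) (fun y => zero_to_one mu y * (zero_to_one lam y)^-1).
    split=> [|x|x]; [by mfun|by rewrite mulr_ge0 ?invr_ge0 ?ltW|].
    have [Q [cQ mQ sub vQ QE]] := cell_cube lp s 0 x.
    rewrite -QE; last by mfun.
    exact: (nu_cubes p1 pq Amu Alam mun0 lamn0 cQ).
  split => //; first exact: labs_loc_integrable.
    by move=> j x; exact: (av_osc j x bL fnu (ltW B10) o1).
  move=> j x; have := av_osc j x bL (lfin_cst (grid s lp) ler01) (ltW B20) o2.
  by rewrite av_cst mulr1.
(* Then [h * mu ^ - a1 = |f|], and [p' * (p - 1) = p] turns the norm of [f] in [L ^ p (mu ^ p)] into
   that of [h] for the measure [mu ^ - a1]. *)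
pose h y := `|f y| * zero_to_one mu y `^ a1.
have hE y : h y * (zero_to_one mu y)^-1 `^ a1 = `|f y|.
  rewrite /h -mulrA -powRM ?invr_ge0 ?(ltW (pm0 y))// mulfV ?gt_eqF// powR1 mulr1//.
have h0 y : 0 <= h y by rewrite mulr_ge0 ?powR_ge0.
have mh : measurable_fun setT h by rewrite /h; mfun.
have hh : (\int[leb]_x (h x `^ (1 - a1^-1)^-1 * (zero_to_one mu x)^-1 `^ a1)%:E <= 1)%E.
  apply: le_trans hf; rewrite le_eqVlt; apply/orP; left; apply/eqP.
  apply: eq_integral => x _; congr EFin; rewrite pq' /h powRM ?powR_ge0// -mulrA; congr (_ * _).
  have t0 := pm0 x; move: (zero_to_one mu x) t0 => t t0.
  rewrite -powRrM -{2}[t](powRr1 (ltW t0)).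
  rewrite -powRN -powRrM -powRD; last by rewrite (gt_eqF t0) implybT.
  congr (_ `^ _).
  by rewrite mulN1r -{2}[a1]mulr1 -mulrBr Ea1 divfK// gt_eqF// subr_gt0.
apply: (@duality _ _ _ leb _ (fun x => zero_to_one lam x `^ q) q _ (fun N => @big_cube R n N)) => //.
- by rewrite mulr_ge0 ?ltW.
- exact: measurable_abs_commutator.
- by move=> x; exact: abs_commutator_ge0.
- by mfun.
- by move=> x; rewrite powR_gt0.
- by move=> N; exact: measurable_big_cube.
- by move=> N M; exact: big_cube_le.
- exact: big_cube_point.
- by move=> N; have [h1 _] := Apq_cubes p1 pq Alam lamn0 (@big_cube_cubes R n N).
move=> g mg g0 hg.
have := HC _ _ b B1 B2 h g good mh h0 mg g0 hh hg; rewrite rE.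
rewrite (funext hE); congr (_ <= _)%E; apply: eq_integral => x _.
by rewrite muleC.
Qed.

End strong.

(** Beyond the strong bound there remain a monotone choice of the constant, the degenerate cases,
    and the replacement of the weights by everywhere positive ones off null sets. *)
Theorem theorem1p1 (R : realType) (n k : nat) (p q : R) :
  1 < p -> p < q -> (1 <= k)%N ->
  exists C : R -> R -> R,
    (forall s s' t t' : R, s <= s' -> t <= t' -> C s t <= C s' t') /\
    forall (alpha : R) (mu lambda b : Rn R n -> R),
      0 < alpha -> alpha < n%:R -> q^-1 = p^-1 - alpha / n%:R ->
      Apq p q mu -> Apq p q lambda ->
      let nu := fun x => mu x * (lambda x)^-1 in
      BMO (fun=> 1) b -> BMO nu b ->
      (operator_norm p q (fun x => (mu x `^ p)%R) (fun x => (lambda x `^ q)%R)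
         (commutator_frac_integral alpha k b)
       <= (C (fine (Apq_const p q mu)) (fine (Apq_const p q lambda)))%:E
          * bmo_norm nu b * bmo_norm (fun=> 1%R) b ^+ k.-1)%E.
Proof.
move=> p1 pq k0.
(* In dimension 0 no [alpha] satisfies [0 < alpha < n]. *)
have [n0|n0] := posnP n.
  exists (fun _ _ => 0); split => // alpha mu lam b al0 aln.
  by exfalso; move: al0; rewrite ltNge => /negP; apply; have := ltW aln; rewrite n0.
(* [C i] serves weight constants at most [i + 1]; partial sums make it monotone. *)
have K1 (i : nat) : 1 <= i.+1%:R :> R by rewrite ler1n.
have [C HC] := choice (fun i => abs_commutator_strong n0 p1 pq (K1 i) k0).
have C0 i : 0 <= C i by have [/ltW] := HC i.
pose N s t := maxn (Num.truncn (s : R)) (Num.truncn (t : R)).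
have NP s t : s <= (N s t).+1%:R /\ t <= (N s t).+1%:R.
  by split; apply: le_trans (ltW (truncnS_gt _)) _; rewrite ler_nat ltnS ?leq_maxl ?leq_maxr.
exists (fun s t => \sum_(i < (N s t).+1) C i); split.
  move=> s s' t t' ss' tt'; have NN : ((N s t).+1 <= (N s' t').+1)%N.
    rewrite ltnS geq_max; apply/andP; split.
      exact: leq_trans (le_truncn ss') (leq_maxl _ _).
    exact: leq_trans (le_truncn tt') (leq_maxr _ _).
  rewrite -(subnKC NN) big_split_ord/= lerDl; exact: sumr_ge0.
move=> alpha mu lam b al0 aln alphaE Amu Alam nu bmo1 bmonu.
have [bL b1fin] := bmo1; have [_ bnfin] := bmonu.
have [[m0 [mm _]] _] := Amu; have [[l0 [ml _]] _] := Alam.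
have nu0 x : 0 <= nu x by rewrite mulr_ge0 ?invr_ge0.
have [mb _] := bL.
have q0 : 0 < q by exact: lt_trans (lt_trans ltr01 p1) pq.
have p0 : 0 < p by exact: lt_trans p1.
have N0 := bmo_norm_ge0 b nu0.
have N1 := bmo_norm_ge0 b (fun=> ler01) : (0 <= bmo_norm (fun=> 1%R : R) b)%E.
apply: ge_ereal_sup => _ [f [mf hf] <-].
have mlq : measurable_fun setT (fun x => lam x `^ q) by mfun.
(* If no cube sees an oscillation, [b] is constant almost everywhere and the commutator vanishes.
   Otherwise [Q0] witnesses that both norms of [b] are positive and that neither weight is null. *)
have [osc0|/existsNP[Q0 /not_implyP[cQ0 osc0]]] := pselect (forall Q, cubes Q -> osc b Q = 0%E).
  rewrite commutator_cst//; apply: mule_ge0; last by rewrite expe_ge0.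
  by apply: mule_ge0 => //; rewrite lee_fin; apply: sumr_ge0.
have op : (0 < osc b Q0)%E by rewrite lt_neqAle osc_ge0 andbT eq_sym; apply/eqP.
have mQ0 := cubes_measurable cQ0.
have mpm := measurable_zero_to_one mm; have mpl := measurable_zero_to_one ml.
have pm0 x := zero_to_one_gt0 x m0; have pl0 x := zero_to_one_gt0 x l0.
have mi := measurable_inv mpl pl0.
(* The real inverse of 0 is 0, so [nu] vanishes at the zeros of [lam]; in this form its
   measurability is visible. *)
have nuE : nu = fun x => mu x * (zero_to_one lam x)^-1 * \1_(~` [set x | lam x = 0]) x.
  apply/funext => x; rewrite /nu /zero_to_one indicE; case: eqVneq => h.
    by rewrite memNset ?mulr0 ?h ?invr0 ?mulr0// => /(_ h).
  by rewrite mem_set ?mulr1// => /eqP; rewrite (negbTE h).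
have mnu : measurable_fun setT nu.
  rewrite nuE; apply: measurable_funM; first by mfun.
  by apply: measurable_indic; apply: measurableC; exact: measurable_eq0.
(* A null weight would give [nu] mass 0 on [Q0], and the finite norm in BMO(nu) would make the
   oscillation over [Q0] vanish. *)
have nonnull (w : Rn R n -> R) : measurable_fun setT w -> (forall x, w x = 0 -> nu x = 0) ->
    lebesgue_Rn n [set x | w x != 0] <> 0%E.
  move=> mw wnu w0; have nuz : (\int[lebesgue_Rn n]_(x in Q0) (nu x)%:E = 0)%E.
    rewrite (ae_eq_integral (cst 0%E)) ?integral0//.
      by apply/measurable_funTS; mfun.
    exists [set x | w x != 0]; split => //.
      rewrite (_ : mkset _ = ~` [set x | w x = 0]).
        by apply: measurableC; exact: measurable_eq0.
      by apply/seteqP; split => x /= /eqP.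
    move=> x /=; apply: contra_notP => /negP; rewrite negbK => /eqP wx _.
    by rewrite wnu.
  have := osc_le nu0 cQ0 bnfin; rewrite nuz mule0 => /(_ (ltry 0)).
  by rewrite leNgt op.
have mun0 : lebesgue_Rn n [set x | mu x != 0] <> 0%E.
  by apply: nonnull => // x h; rewrite /nu h mul0r.
have lamn0 : lebesgue_Rn n [set x | lam x != 0] <> 0%E.
  by apply: nonnull => // x h; rewrite /nu h invr0 mulr0.
have intnu Q : cubes Q -> (\int[lebesgue_Rn n]_(x in Q) (nu x)%:E =
    \int[lebesgue_Rn n]_(x in Q) (zero_to_one mu x * (zero_to_one lam x)^-1)%:E)%E.
  move=> cQ; have mQ := cubes_measurable cQ.
  transitivity (\int[lebesgue_Rn n]_(x in Q) (mu x * (zero_to_one lam x)^-1)%:E)%E.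
    apply: (eq_integral_null p1 pq Alam lamn0 mQ); [by mfun|by mfun|].
    by move=> x /negbTE h; rewrite /nu /zero_to_one h.
  apply: (eq_integral_null p1 pq Amu mun0 mQ); [by mfun|by mfun|].
  by move=> x /negbTE h; rewrite /zero_to_one h.
have nufin Q : cubes Q -> (\int[lebesgue_Rn n]_(x in Q) (nu x)%:E < +oo)%E.
  by move=> cQ; rewrite intnu//; exact: (nu_cubes p1 pq Amu Alam mun0 lamn0 cQ).
have onefin Q : cubes Q -> (\int[lebesgue_Rn n]_(x in Q) (1%R : R)%:E < +oo)%E.
  move=> cQ; rewrite integral_cst//; last exact: cubes_measurable.
  have [v v0 vE] := cubes_lebesgue cQ.
  by rewrite mul1e; apply: (@le_lt_trans _ _ v%:E); [rewrite -vE|rewrite ltry].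
have fn : bmo_norm nu b \is a fin_num by rewrite (ge0_fin_numE N0).
have f1 : bmo_norm (fun=> 1%R) b \is a fin_num by rewrite (ge0_fin_numE N1).
have [B1 EB1] : exists B1 : R, bmo_norm nu b = B1%:E 
  by exists (fine (bmo_norm nu b)); exact: esym (fineK fn).
have [B2 EB2] : exists B2 : R, bmo_norm (fun=> 1%R) b = B2%:E.
  by exists (fine (bmo_norm (fun=> 1%R) b)); exact: esym (fineK f1).
have B10 : 0 < B1.
  rewrite lt_neqAle -lee_fin -EB1 N0 andbT eq_sym; apply/eqP => B1z.
  have := osc_le nu0 cQ0 bnfin (nufin Q0 cQ0).
  by rewrite EB1 B1z mul0e leNgt op.
have B20 : 0 < B2.
  rewrite lt_neqAle -lee_fin -EB2 N1 andbT eq_sym; apply/eqP => B2z.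
  have := osc_le (fun=> ler01) cQ0 b1fin (onefin Q0 cQ0).
  by rewrite EB2 B2z mul0e leNgt op.
pose st := N (fine (Apq_const p q mu)) (fine (Apq_const p q lam)).
have [cmu clam] := NP (fine (Apq_const p q mu)) (fine (Apq_const p q lam)).
have [_ H] := HC st.
have hf' : (\int[lebesgue_Rn n]_x (`|f x| `^ p * zero_to_one mu x `^ p)%:E <= 1)%E.
  have I0 : (0 <= \int[lebesgue_Rn n]_x (`|(EFin \o f) x| `^ p * (mu x `^ p)%:E))%E.
    by apply: integral_ge0 => x _; rewrite mule_ge0 ?poweR_ge0// lee_fin powR_ge0.
  have -> : (\int[lebesgue_Rn n]_x (`|f x| `^ p * zero_to_one mu x `^ p)%:E =
      \int[lebesgue_Rn n]_x (`|(EFin \o f) x| `^ p * (mu x `^ p)%:E))%E.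
    transitivity (\int[lebesgue_Rn n]_x (`|f x| `^ p * mu x `^ p)%:E)%E.
      apply: (eq_integral_null p1 pq Amu mun0 measurableT); [by mfun|by mfun|].
      by move=> x /negbTE h; rewrite /zero_to_one h.
    by apply: eq_integral => x _; rewrite EFinM.
  have le1 : (wLnorm p (fun x => mu x `^ p)%R (EFin \o f) `^ p <= 1 `^ p)%E.
    by apply: (gt0_ler_poweR (ltW p0)); rewrite ?in_itv/= ?leey ?andbT ?poweR_ge0.
  by move: le1; rewrite /wLnorm -poweRrM mulVf ?gt_eqF// poweRe1// poweR1r.
have := H alpha mu lam b B1 B2 f alphaE Amu Alam cmu clam mun0 lamn0 bL B10 B20 _ _ mf hf'.
have o1 Q : cubes Q -> (osc b Q <= B1%:E * \int[lebesgue_Rn n]_(y in Q)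
    (zero_to_one mu y * (zero_to_one lam y)^-1)%:E)%E.
  by move=> cQ; rewrite -EB1 -intnu//; apply: osc_le => //; exact: nufin.
have o2 Q : cubes Q -> (osc b Q <= B2%:E * \int[lebesgue_Rn n]_(y in Q) 1%:E)%E.
  by move=> cQ; rewrite -EB2; apply: osc_le => //; exact: onefin.
move=> /(_ o1 o2) {}H.
have CB0 : 0 <= C st * (B1 * B2 ^+ k.-1) by rewrite mulr_ge0// ltW// mulr_gt0// exprn_gt0.
apply: (@le_trans _ _ (C st * (B1 * B2 ^+ k.-1))%:E); last first.
  rewrite EB1 EB2 -EFin_expe -!EFinM lee_fin mulrA.
  have b2 : 0 <= B2 ^+ k.-1 by rewrite exprn_ge0// ltW.
  apply: ler_wpM2r => //; apply: ler_wpM2r; first exact: ltW.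
  (* The constant valid for these weights is the last summand of the monotone partial sum. *)
  by rewrite big_ord_recr/= -/st lerDr sumr_ge0.
have qi : 0 <= q^-1 by rewrite invr_ge0 ltW.
have CBE : ((C st * (B1 * B2 ^+ k.-1))%:E = (((C st * (B1 * B2 ^+ k.-1)) `^ q)%:E) `^ q^-1)%E.
  by rewrite poweR_EFin powRKV.
have mT := measurable_commutator alpha k mb mf.
have mTq : measurable_fun setT (fun x => `|commutator_frac_integral alpha k b f x| `^ q)%E.
  apply: (measurableT_comp (@measurable_poweR _ _)).
  exact: (measurableT_comp (@abse_measurable _ _) mT).
have mAq : measurable_fun setT (fun x => abs_commutator (n%:R - alpha) k b f x `^ q)%E.
  by apply: (measurableT_comp (@measurable_poweR _ _)); exact: measurable_abs_commutator.
have le1 : (\int[lebesgue_Rn n]_x (`|commutator_frac_integral alpha k b f x| `^ q * (lam x `^ q)%:E) <=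
    ((C st * (B1 * B2 ^+ k.-1)) `^ q)%:E)%E.
  apply: le_trans H.
  rewrite (eq_integral_null p1 pq Alam lamn0 measurableT
    (H := fun x => `|commutator_frac_integral alpha k b f x| `^ q * (zero_to_one lam x `^ q)%:E)%E); last 3 first.
  - by apply: emeasurable_funM => //; mfun.
  - by apply: emeasurable_funM => //; mfun.
  - by move=> x /negbTE h; rewrite /zero_to_one h.
  apply: ge0_le_integral => //.
  - by move=> x _; rewrite mule_ge0 ?poweR_ge0// lee_fin powR_ge0.
  - by apply: emeasurable_funM => //; mfun.
  - by apply: emeasurable_funM => //; mfun.
  - move=> x _; apply: lee_wpmul2r; first by rewrite lee_fin powR_ge0.
    apply: gt0_ler_poweR; rewrite ?in_itv/= ?leey ?andbT ?abse_ge0 ?abs_commutator_ge0//.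
      exact: ltW.
    exact: commutator_le.
rewrite CBE /wLnorm; apply: gt0_ler_poweR => //; rewrite in_itv/= leey andbT.
  by apply: integral_ge0 => x _; rewrite mule_ge0 ?poweR_ge0// lee_fin powR_ge0.
by rewrite lee_fin powR_ge0.
Qed.
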